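(* The essential spectrum of $J$ is $$\operatorname{Spec}_{\mathrm{ess}}(J)=[-2a,2a].$$ The singular continuous spectrum of $J$ is empty, its pure point subspace is finite-dimensional, and its absolutely continuous spectrum has multiplicity $r$ almost everywhere on $(-2a,2a)$.
   Context: Let $q$ be a prime power, $a=\sqrt q$, $d,r\ge1$ integers, $H_C=H_C^*$ a complex $d\times d$ matrix, and $V:\mathbb C^r\to\mathbb C^d$ linear. Let $\mathscr H=\mathbb C^d\oplus\bigoplus_{c=1}^r\ell^2(\mathbb N)$, $\mathbb N=\{1,2,\dots\}$; write elements as $(u,g)$ with $g(n)=(g_1(n),\dots,g_r(n))^t\in\mathbb C^r$. The bounded self-adjoint operator $J$ on $\mathscr H$ is $J(u,g)=(H_Cu+Vg(1),\,h)$, where $h(1)=a\,g(2)+V^*u$ and $h(n)=a\{g(n-1)+g(n+1)\}$ for $n\ge2$. *)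

(* Defs.v *)
From HB Require Import structures.
From mathcomp Require Import all_boot all_order all_algebra.
From mathcomp Require Import spectral.
From mathcomp Require Import complex.
From mathcomp Require Import all_classical all_reals all_analysis.
From mathcomp Require Import ring.

Set Implicit Arguments.
Unset Strict Implicit.
Unset Printing Implicit Defensive.

Import Order.TTheory GRing.Theory Num.Theory.
Import numFieldNormedType.Exports.

Local Open Scope classical_set_scope.
Local Open Scope ring_scope.
Local Open Scope complex_scope.
Local Open Scope sesquilinear_scope.

Definition prime_power (q : nat) : Prop :=
  exists p k : nat, [/\ prime p, (0 < k)%N & q = (p ^ k)%N].

Definition sqmod (R : realType) (z : R[i]) : R :=
  complex.Re z ^+ 2 + complex.Im z ^+ 2.

(* In this section [T] is meant to be a bounded self-adjoint operator on a
   Hilbert space [H] with inner product [ip].  Subspaces are sets of vectors. *)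
Section SpectralNotions.
Context (R : realType) (H : lmodType R[i]) (ip : H -> H -> R[i]) (T : H -> H).
Implicit Types (f g : H) (M : set H) (z : R[i]) (x : R).

Local Notation leb := (@lebesgue_measure R).

Definition sqnorm f : R := complex.Re (ip f f).

(* [M] need not be given as a linear subspace: it only has to be contained in the
   span of finitely many vectors. *)
Definition finite_dimensional M : Prop :=
  exists (n : nat) (b : 'I_n -> H), forall f, M f ->
    exists c : 'I_n -> R[i], f = \sum_(i < n) c i *: b i.

(* The resolvent set and the spectrum of the restriction of [T] to an invariant
   subspace [M]. *)
Definition resolvent_set_on M : set R[i] := [set z | exists S : H -> H,
  [/\ forall f, M f -> M (S f),
      forall f, M f -> T (S f) - z *: S f = f,
      forall f, M f -> S (T f - z *: f) = f
    & exists c : R, forall f, M f -> sqnorm (S f) <= c * sqnorm f]].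

Definition spectrum_on M : set R[i] := ~` resolvent_set_on M.

Definition spectrum : set R[i] := spectrum_on setT.

Definition eigenspace z : set H := [set f | T f = z *: f].

(* Isolated points of the spectrum that are eigenvalues of finite
   multiplicity. *)
Definition discrete_spectrum : set R[i] := [set z |
  [/\ spectrum z,
      exists e : R, 0 < e /\
        forall w, spectrum w -> `|w - z| < e%:C -> w = z,
      exists2 f, eigenspace z f & f != 0
    & finite_dimensional (eigenspace z)]].

Definition essential_spectrum : set R[i] := spectrum `\` discrete_spectrum.

(* [mu] is the spectral measure of [f]: <p(T) f, f> = \int p dmu for every
   polynomial p (stated on monomials).  For a bounded self-adjoint [T] the
   moments are O(||T||^n), so [mu] is supported in [-||T||, ||T||] and is
   uniquely determined. *)
Definition spectral_measure f
    (mu : {finite_measure set (measurableTypeR R) -> \bar R}) : Prop :=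
  forall n : nat,
    mu.-integrable setT (fun x : measurableTypeR R => (x ^+ n)%:E) /\
    ip (iter n T f) f =
      (Rintegral mu setT (fun x : measurableTypeR R => x ^+ n))%:C.

Definition pure_point_measure
    (mu : {finite_measure set (measurableTypeR R) -> \bar R}) : Prop :=
  exists2 D : set R, countable D & mu (~` D) = 0%E.

Definition singular_continuous_measure
    (mu : {finite_measure set (measurableTypeR R) -> \bar R}) : Prop :=
  (forall x, mu [set x] = 0%E) /\
  exists A : set (measurableTypeR R),
    [/\ measurable A, leb A = 0%E & mu (~` A) = 0%E].

Definition pp_subspace : set H := [set f |
  exists2 mu, spectral_measure f mu & pure_point_measure mu].

Definition sc_subspace : set H := [set f |
  exists2 mu, spectral_measure f mu & singular_continuous_measure mu].

Definition ac_subspace : set H := [set f |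
  exists2 mu, spectral_measure f mu & mu `<< leb].

Definition sc_spectrum : set R[i] := spectrum_on sc_subspace.

(* A multiplicity function takes values in {0, 1, ..., oo}; [None] is oo. *)
Definition below (k : nat) (m : option nat) : bool :=
  if m is Some m' then (k < m')%N else true.

(* Square-integrable measurable sections of the field of Hilbert spaces whose
   fibre at [x] is C^(N x), and l^2(nat) where N x is infinite. *)
Definition L2_section (N : R -> option nat) (F : R -> nat -> R[i]) : Prop :=
  [/\ forall k,
        measurable_fun [set: measurableTypeR R]
          (fun x : measurableTypeR R => complex.Re (F x k)) /\
        measurable_fun [set: measurableTypeR R]
          (fun x : measurableTypeR R => complex.Im (F x k)),
      forall x k, ~~ below k (N x) -> F x k = 0
    & (\int[leb]_x (\sum_(0 <= k <oo) (sqmod (F x k))%:E) < +oo)%E].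

(* [N] is the multiplicity function of the absolutely continuous part of [T]:
   that part is unitarily equivalent, through [U], to multiplication by the
   variable on the direct integral of the spaces C^(N x) with respect to
   Lebesgue measure.  Functions are identified almost everywhere. *)
Definition ac_multiplicity (N : R -> option nat) : Prop :=
  (forall k, measurable [set x : measurableTypeR R | below k (N x)]) /\
  exists U : H -> R -> nat -> R[i],
    [/\ forall f, ac_subspace f -> L2_section N (U f),
        forall (z : R[i]) f g, ac_subspace f -> ac_subspace g ->
          {ae leb, forall x, forall k, U (z *: f + g) x k = z * U f x k + U g x k},
        forall f, ac_subspace f ->
          (\int[leb]_x (\sum_(0 <= k <oo) (sqmod (U f x k))%:E))%E =
          (sqnorm f)%:E,
        forall F, L2_section N F -> exists2 f, ac_subspace f &
          {ae leb, forall x, forall k, U f x k = F x k}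
      & forall f, ac_subspace f ->
          {ae leb, forall x, forall k, U (T f) x k = x%:C * U f x k}].

End SpectralNotions.

(* [g n] is the value at the (n+1)-st point of N = {1, 2, ...}. *)
Definition l2 (R : realType) (r : nat) (g : nat -> 'cV[R[i]]_r) : Prop :=
  forall c, (\sum_(0 <= n <oo) (sqmod (g n c 0))%:E < +oo)%E.

Section L2Theory.
Context (R : realType) (r : nat).
Implicit Types (g h : nat -> 'cV[R[i]]_r).

Lemma sqmod_ge0 (z : R[i]) : 0 <= sqmod z.
Proof. by rewrite addr_ge0 ?sqr_ge0. Qed.

Lemma sqmodM (z w : R[i]) : sqmod (z * w) = sqmod z * sqmod w.
Proof. by case: z w => [a b] [c e]; rewrite /sqmod /=; ring. Qed.

Lemma sqmodD_le (z w : R[i]) : sqmod (z + w) <= 2 * sqmod z + 2 * sqmod w.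
Proof.
case: z w => [a b] [c e]; rewrite /sqmod /= -subr_ge0.
have -> : 2 * (a ^+ 2 + b ^+ 2) + 2 * (c ^+ 2 + e ^+ 2) -
    ((a + c) ^+ 2 + (b + e) ^+ 2) = (a - c) ^+ 2 + (b - e) ^+ 2 by ring.
by rewrite addr_ge0 ?sqr_ge0.
Qed.

Lemma l2_0 : l2 (fun=> 0 : 'cV[R[i]]_r).
Proof.
move=> c; rewrite eseries0 ?ltry// => n _ _.
by rewrite mxE /sqmod /= !expr0n addr0.
Qed.

Lemma l2Z (z : R[i]) g : l2 g -> l2 (fun n => z *: g n).
Proof.
move=> hg c; under eq_eseriesr do rewrite mxE sqmodM EFinM.
rewrite nneseriesZl; last by move=> n _; rewrite lee_fin sqmod_ge0.
by rewrite lte_mul_pinfty ?lee_fin ?sqmod_ge0.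
Qed.

Lemma l2D g h : l2 g -> l2 h -> l2 (fun n => g n + h n).
Proof.
move=> hg hh c.
have pos (u : nat -> R[i]) n : (0 <= (2 * sqmod (u n))%:E)%E.
  by rewrite lee_fin mulr_ge0 ?sqmod_ge0.
have fin (u : nat -> R[i]) :
    (\sum_(0 <= n <oo) (sqmod (u n))%:E < +oo ->
     \sum_(0 <= n <oo) (2 * sqmod (u n))%:E < +oo)%E.
  move=> hu; under eq_eseriesr do rewrite EFinM.
  rewrite nneseriesZl; last by move=> n _; rewrite lee_fin sqmod_ge0.
  by rewrite lte_mul_pinfty ?lee_fin.
apply: (@le_lt_trans _ _ (\sum_(0 <= n <oo)
    ((2 * sqmod (g n c 0%R))%:E + (2 * sqmod (h n c 0%R))%:E))%E).
  apply: lee_nneseries => n _; first by rewrite lee_fin sqmod_ge0.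
  by rewrite mxE -EFinD lee_fin sqmodD_le.
rewrite nneseriesD; last 2 first.
- by move=> n _ _; exact: (pos (fun n => g n c 0)).
- by move=> n _ _; exact: (pos (fun n => h n c 0)).
by rewrite lte_add_pinfty// fin.
Qed.

Lemma l2_shift g : l2 (fun n => g n.+1) <-> l2 g.
Proof.
have E c : (\sum_(0 <= n <oo) (sqmod (g n c 0%R))%:E =
    (sqmod (g 0%N c 0%R))%:E + \sum_(0 <= n <oo) (sqmod (g n.+1 c 0%R))%:E)%E.
  rewrite nneseries_recl//; last by move=> n; rewrite lee_fin sqmod_ge0.
  congr (_ + _)%E.
  rewrite -(@nneseries_addn _ (fun n => (sqmod (g n c 0%R))%:E) 1%N); last first.
    by move=> n; rewrite lee_fin sqmod_ge0.
  by apply: eq_eseriesr => n _; rewrite addn1.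
split=> hg c; move: (hg c); rewrite E.
  by move=> h; rewrite lte_add_pinfty ?ltry.
apply: le_lt_trans; rewrite leeDr// lee_fin sqmod_ge0 //.
Qed.

End L2Theory.

Section HilbertSpace.
Context (R : realType) (d r : nat).

Local Notation pre := ('cV[R[i]]_d * (nat -> 'cV[R[i]]_r))%type.

Definition in_hilb : {pred pre} := fun f => `[< l2 f.2 >].

Lemma in_hilb_submod : submod_closed in_hilb.
Proof.
split; first by apply/asboolP; exact: l2_0.
move=> z f g /asboolP hf /asboolP hg; apply/asboolP => /=.
exact: (l2D (l2Z z hf) hg).
Qed.
HB.instance Definition _ := GRing.isSubmodClosed.Build _ _ in_hilb in_hilb_submod.

Record hilb : Type := Hilb { hval :> pre ; hvalP : in_hilb hval }.
HB.instance Definition _ := [isSub for hval].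
HB.instance Definition _ := [Choice of hilb by <:].
HB.instance Definition _ := [SubChoice_isSubLmodule of hilb by <:].

Definition dot (n : nat) (u v : 'cV[R[i]]_n) : R[i] :=
  \sum_(i < n) u i 0 * (v i 0)^*%C.

(* The series converges for [f] and [g] in [hilb] (Cauchy-Schwarz); its limit is
   taken on real and imaginary parts. *)
Definition hdot (f g : hilb) : R[i] :=
  dot (hval f).1 (hval g).1 +
  (limn (series (fun n => complex.Re (dot ((hval f).2 n) ((hval g).2 n)))) +i*
   limn (series (fun n => complex.Im (dot ((hval f).2 n) ((hval g).2 n))))).

Section Operator.
Context (a : R) (HC : 'M[R[i]]_d) (V : 'M[R[i]]_(d, r)).

Definition J_fun (f : pre) : pre :=
  (HC *m f.1 + V *m f.2 0%N,
   fun n => if n is m.+1 then a%:C *: (f.2 m + f.2 m.+2)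
            else a%:C *: f.2 1%N + V ^t* *m f.1).

Lemma J_funP (f : hilb) : in_hilb (J_fun (hval f)).
Proof.
case: f => -[u g] /= /asboolP /= hg; apply/asboolP/l2_shift => /=.
by apply: l2Z; apply: l2D => //; do 2 apply/(l2_shift (fun n => g _)).
Qed.

Definition J (f : hilb) : hilb := Hilb (J_funP f).

End Operator.
End HilbertSpace.

(* Main.v *)
Require Import Defs.
From HB Require Import structures.
From mathcomp Require Import all_boot all_order all_algebra.
From mathcomp Require Import spectral.
From mathcomp Require Import complex.
From mathcomp Require Import all_classical all_reals all_analysis.
From mathcomp Require Import measurable_realfun.
From mathcomp Require Import ring lra.

Set Implicit Arguments.
Unset Strict Implicit.
Unset Printing Implicit Defensive.

Import Order.TTheory GRing.Theory Num.Theory.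
Import numFieldNormedType.Exports.

Local Open Scope classical_set_scope.
Local Open Scope ring_scope.
Local Open Scope complex_scope.
Local Open Scope sesquilinear_scope.

(** The functions sqrt(w) U_n(x / 2a), with w the semicircle weight on
    D = ]-2a, 2a[ and U_n the Chebyshev polynomials of the second kind, turn the
    free half-line operator into multiplication by x on L^2(D).  Put
    chi = det(x - HC), Y = a^-1 V^* adj(x - HC) V,
    zeta = (x + i sqrt(4a^2 - x^2)) / 2a and L = chi - zeta Y.  Cramer's rule
    gives an explicit bounded map Z : H -> L^2(D; C^r) with Z J = x Z and, because
    |zeta| = 1 and zeta + zeta^* = x / a, also Z Z^* = L^* L.  The imaginary part
    of <L w, w> shows that L is invertible where chi <> 0, so U = (L^* )^-1 Z is a
    co-isometry onto L^2(D; C^r) that intertwines J with x.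

    Vectors of ker U satisfy, beyond the index d, a backward recursion with
    constant coefficients; hence ker U is finite-dimensional.  If the polynomial q
    is such that q(J) kills ker U, then |q|^2 d(mu_f) and |q|^2 |U f|^2 dx have the
    same moments, hence are equal.  So pure point vectors lie in ker U, there are
    no singular continuous ones, and the absolutely continuous subspace is
    (ker U)^perp.  Off [-2a, 2a] the resolvent is built from 1 / (x - z) and a
    factor of q; indicator functions of short intervals put [-2a, 2a] in the
    spectrum. *)

(** * Measures determined by their moments *)

(** Using the adjugate instead of the resolvent of [HC] keeps every coefficient of Z polynomial in
    x, hence bounded on D, without poles at the eigenvalues of [HC]. The price is that det L may
    vanish where chi does, so the inverse of L^* can be unbounded: U is studied where |det L|^2 is
    at least 1/(k+1), and bounds independent of k pass to the limit. Z itself is the adjoint of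
    superposing formal eigenvectors of [J], and L is, up to a factor, the amplitude of one of the
    two travelling waves in them.

    The spectral subspaces are defined by the moments of a single vector, so statements about them
    come from comparing two finite measures with equal moments. Only one of the two, |q|^2 |U f|^2
    dx, is known beforehand to have bounded support, and the comparison needs no more. The kernel of
    U is never split into eigenvectors: a polynomial that annihilates it removes its contribution,
    at the cost of finitely many real zeros, which are null for Lebesgue measure and for measures
    without atoms. The same comparison of measures shows that the Chebyshev functions are total. *)

Section ThresholdPolynomials.
Context (R : realType).
Implicit Types (x y z t : R).

Lemma bernoulli_ge z n : -1 <= z -> 1 + n%:R * z <= (1 + z) ^+ n.
Proof.
move=> z1; elim: n => [|n IHn]; first by rewrite mul0r addr0 expr0.
rewrite exprS; apply: (@le_trans _ _ ((1 + z) * (1 + n%:R * z))); last first.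
  by rewrite ler_wpM2l// -(opprK 1) addrC subr_ge0.
rewrite -subr_ge0.
have -> : (1 + z) * (1 + n%:R * z) - (1 + n.+1%:R * z) = n%:R * z ^+ 2.
  by rewrite -natr1; ring.
by rewrite mulr_ge0// sqr_ge0.
Qed.

(** With w the square root of z, Bernoulli's inequality for 1/w bounds [n w^n], and the remaining
    factor [w^n] tends to 0. *)
Lemma cvg_natmul_expr z : 0 <= z < 1 -> n%:R * z ^+ n @[n --> \oo] --> (0 : R).
Proof.
move=> /andP[z0 z1]; have [->|zn0] := eqVneq z 0.
  apply: (@cvg_trans _ ((0 : R) @[n --> \oo])); last exact: cvg_cst.
  apply: near_eq_cvg; near=> n.
  have n0 : (0 < n)%N by near: n; exact: nbhs_infty_gt.
  by rewrite expr0n eqn0Ngt n0 mulr0.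
have z_gt0 : 0 < z by rewrite lt_neqAle eq_sym zn0.
pose w := Num.sqrt z.
have w0 : 0 < w by rewrite sqrtr_gt0.
have w1 : w < 1 by rewrite -sqrtr1 ltr_sqrt.
have h0 : 0 < w^-1 - 1 by rewrite subr_gt0 invf_gt1.
have nw n : n%:R * w ^+ n <= (w^-1 - 1)^-1.
  rewrite -ler_pdivlMr ?exprn_gt0// -exprVn -[leLHS]mulr1.
  rewrite [leRHS]mulrC ler_pdivlMr// mulr1.
  apply: (@le_trans _ _ (1 + n%:R * (w^-1 - 1))); first by rewrite lerDr.
  by rewrite -[X in _ <= X ^+ n](subrKC 1) bernoulli_ge// (le_trans _ (ltW h0))// lerN10.
apply: (@squeeze_cvgr _ _ _ _ (cst 0) (fun n => (w^-1 - 1)^-1 * w ^+ n)).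
- apply: nearW => n /=; rewrite mulr_ge0 ?exprn_ge0//=.
  rewrite -[in leLHS](@sqr_sqrtr _ z)// -/w expr2 exprMn mulrA.
  by rewrite ler_wpM2r ?exprn_ge0// ltW.
- exact: cvg_cst.
- rewrite -[X in _ --> X](mulr0 (w^-1 - 1)^-1); apply: cvgM; first exact: cvg_cst.
  by apply: cvg_expr; rewrite gtr0_norm.
Unshelve. all: by end_near.
Qed.

(* With values in [0, 1] and a limit indicating y < 1/2, these polynomials let
   moments determine a distribution function. *)
Lemma cvg_threshold y : 0 <= y <= 1 ->
  (1 - y ^+ m) ^+ (m * 2 ^ m) @[m --> \oo] --> ((y < 2^-1)%R%:R : R).
Proof.
move=> /andP[y0 y1].
have ym m : 0 <= 1 - y ^+ m <= 1.
  by rewrite subr_ge0 exprn_ile1//= lerBlDr lerDl exprn_ge0.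
have [y2|y2] := ltP y 2^-1.
(* The exponent [m * 2 ^ m] balances two Bernoulli bounds: below 1/2 the value is at least
   [1 - m (2y)^m], and from 1/2 on it is at most [1 / (1 + m)]. *)
- apply: (@squeeze_cvgr _ _ _ _ (fun m => 1 - m%:R * (2 * y) ^+ m) (cst 1)).
  + apply: nearW => m /=; apply/andP; split; last first.
      by apply: exprn_ile1; case/andP: (ym m).
    have := @bernoulli_ge (- y ^+ m) (m * 2 ^ m)%N; rewrite lerN2.
    move=> /(_ (exprn_ile1 _ y0 y1)); apply: le_trans.
    by rewrite mulrN natrM natrX exprMn mulrA.
  + rewrite -[X in _ --> X]subr0; apply: cvgB; first exact: cvg_cst.
    apply: cvg_natmul_expr; rewrite mulr_ge0//= -[ltRHS](@divff _ 2)//.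
    by rewrite ltr_pM2l.
  + exact: cvg_cst.
- have e m : (1 - y ^+ m) ^+ (m * 2 ^ m) <= (1 + m%:R)^-1.
    have h0 : 0 < (1 + (2^-1 : R) ^+ m) by rewrite ltr_wpDr// exprn_ge0.
    apply: (@le_trans _ _ ((1 + 2^-1 ^+ m)^-1 ^+ (m * 2 ^ m))).
      apply: lerXn2r; rewrite ?nnegrE ?invr_ge0 ?(ltW h0)//.
        by case/andP: (ym m).
      rewrite -[leRHS]mul1r ler_pdivlMr//.
      apply: (@le_trans _ _ ((1 - 2^-1 ^+ m) * (1 + 2^-1 ^+ m))).
        rewrite ler_wpM2r ?(ltW h0)// lerB// lerXn2r ?nnegrE//.
      by rewrite -subr_sqr expr1n lerBlDr lerDl sqr_ge0.
    rewrite exprVn lef_pV2 ?posrE ?exprn_gt0//.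
    have := @bernoulli_ge (2^-1 ^+ m) (m * 2 ^ m)%N.
    rewrite natrM natrX -mulrA -exprMn mulfV// expr1n mulr1; apply.
    by rewrite (@le_trans _ _ 0)// ?lerN10// exprn_ge0.
  apply: (@squeeze_cvgr _ _ _ _ (cst 0) (fun m => (1 + m%:R)^-1)).
  + by apply: nearW => m; rewrite e exprn_ge0//; case/andP: (ym m).
  + exact: cvg_cst.
  + have := @cvg_harmonic R; apply: cvg_trans; apply: near_eq_cvg.
    by apply: nearW => m; rewrite /harmonic /= nat1r.
Qed.
End ThresholdPolynomials.

Section MomentUniqueness.
Context (R : realType).
Local Notation borel := (measurableTypeR R).
Implicit Types (nu : {finite_measure set borel -> \bar R}) (p : {poly R}).

Definition has_moments nu : Prop :=
  forall n : nat, nu.-integrable setT (fun x : borel => (x ^+ n)%:E).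

Lemma integrable_horner nu p : has_moments nu ->
  nu.-integrable setT (fun x : borel => (p.[x])%:E).
Proof.
move=> hnu.
have -> : (fun x : borel => (p.[x])%:E) =
    (fun x => (\sum_(i < size p) (p`_i)%:E * (x ^+ i)%:E)%E).
  by apply/funext => x; rewrite horner_coef -sumEFin.
by apply: integrable_sum => // i _; apply: integrableZl.
Qed.

Lemma Rintegral_horner nu p : has_moments nu ->
  Rintegral nu setT (fun x : borel => p.[x]) =
  \sum_(i < size p) p`_i * Rintegral nu setT (fun x : borel => x ^+ i).
Proof.
move=> hnu; rewrite {1}/Rintegral.
have -> : (fun x : borel => (p.[x])%:E) =
    (fun x => (\sum_(i < size p) (p`_i)%:E * (x ^+ i)%:E)%E).
  by apply/funext => x; rewrite horner_coef -sumEFin.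
rewrite integral_sum//; last by move=> i; apply: integrableZl.
rewrite -sum_fine => [|i _]; last first.
  by apply: integrable_fin_num => //; apply: integrableZl.
by apply: eq_bigr => i _; rewrite integralZl// fineM// integrable_fin_num.
Qed.

Lemma measurable_abs_gt (C : R) : measurable [set x : borel | C < `|x|].
Proof.
rewrite (_ : [set _ | _] = @Num.norm R R @^-1` `]C, +oo[%classic).
  have mn : measurable_fun [set: borel] (@Num.norm R R : borel -> borel) by [].
  by rewrite -[X in measurable X]setTI; exact: mn.
by apply/seteqP; split=> x /=; rewrite in_itv/= andbT.
Qed.

Lemma measurable_abs_ge (C : R) : measurable [set x : borel | C <= `|x|].
Proof.
rewrite (_ : [set _ | _] = @Num.norm R R @^-1` `[C, +oo[%classic).
  have mn : measurable_fun [set: borel] (@Num.norm R R : borel -> borel) by [].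
  by rewrite -[X in measurable X]setTI; exact: mn.
by apply/seteqP; split=> x /=; rewrite in_itv/= andbT.
Qed.

Context (nu1 nu2 : {finite_measure set borel -> \bar R}).
Hypotheses (mom1 : has_moments nu1) (mom2 : has_moments nu2).
Hypothesis eq_moments : forall n : nat,
  Rintegral nu1 setT (fun x : borel => x ^+ n) =
  Rintegral nu2 setT (fun x : borel => x ^+ n).
Context (C : R).
Hypotheses (C_gt0 : 0 < C) (supp2 : nu2 [set x : borel | C < `|x|] = 0%E).

Lemma eq_horner p : Rintegral nu1 setT (fun x : borel => p.[x]) =
  Rintegral nu2 setT (fun x : borel => p.[x]).
Proof.
by rewrite !Rintegral_horner//; apply: eq_bigr => i _; rewrite eq_moments.
Qed.

(** Markov's inequality for the moment of order 2n, which may be computed against [nu2], where |x|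
    <= C almost everywhere. *)
Let tail_bound c n : C < c ->
  fine (nu1 [set x : borel | c <= `|x|]) <=
  ((C / c) ^+ 2) ^+ n * fine (nu2 setT).
Proof.
move=> Cc; have c0 : 0 < c by exact: lt_trans Cc.
set E := [set x : borel | _].
have mE : measurable E by exact: measurable_abs_ge.
pose p : {poly R} := ((c^-1) *: 'X) ^+ (2 * n).
have pE x : p.[x] = ((x / c) ^+ 2) ^+ n.
  by rewrite /p exprM !(horner_exp, hornerZ, hornerX) [x / c]mulrC.
have i1 : nu1.-integrable setT (fun x : borel => (p.[x])%:E).
  exact: integrable_horner.
have i2 : nu2.-integrable setT (fun x : borel => (p.[x])%:E).
  exact: integrable_horner.
apply: (@le_trans _ _ (Rintegral nu1 setT (fun x : borel => p.[x]))).
  rewrite /Rintegral; apply: fine_le.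
  - exact: fin_num_measure.
  - exact: integrable_fin_num.
  - rewrite -[leLHS]mul1e -integral_cst//.
    apply: (@le_trans _ _ (\int[nu1]_(x in E) (p.[x])%:E)%E).
      apply: ge0_le_integral => //.
      + apply: measurable_funS (measurable_int _ i1) => //.
      + move=> x /= cx; rewrite lee_fin pE exprn_ege1//.
        rewrite -(real_normK (num_real (x / c))) exprn_ege1// normrM normfV (gtr0_norm c0).
        by rewrite ler_pdivlMr// mul1r.
    apply: ge0_subset_integral => //; first exact: (measurable_int _ i1).
    by move=> x _; rewrite lee_fin pE -exprM exprn_even_ge0// oddM.
rewrite eq_horner /Rintegral.
rewrite -[X in _ <= X * _]/(fine (((C / c) ^+ 2) ^+ n)%:E) -fineM//; last first.
  exact: fin_num_measure.
apply: fine_le; first exact: integrable_fin_num.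
  by rewrite fin_numM// fin_num_measure.
rewrite -integral_cst//; apply: ae_ge0_le_integral => //.
- by move=> x _; rewrite lee_fin pE -exprM exprn_even_ge0// oddM.
- exact: (measurable_int _ i2).
- by move=> x _; rewrite lee_fin -exprM exprn_even_ge0// oddM.
- exists [set x : borel | C < `|x|]; split => //; first exact: measurable_abs_gt.
  move=> x /= /not_implyP[_ /negP]; rewrite lee_fin pE -ltNge ltNge.
  move=> h; rewrite ltNge; apply: contra h => xC.
  rewrite lerXn2r ?nnegrE ?sqr_ge0// -(real_normK (num_real (x / c))) lerXn2r ?nnegrE//.
    by rewrite divr_ge0// ltW.
  by rewrite normrM normfV (gtr0_norm c0) ler_wpM2r// invr_ge0 ltW.
Qed.

(** Letting n grow in [tail_bound] kills each set |x| >= c with c > C. The support of [nu1] is thus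
    deduced and not assumed, which is what allows spectral measures, known only through their
    moments, in the role of [nu1]. *)
Lemma moment_support : nu1 [set x : borel | C < `|x|] = 0%E.
Proof.
have tail0 c : C < c -> nu1 [set x : borel | c <= `|x|] = 0%E.
  move=> Cc; have mE := @measurable_abs_ge c.
  have c0 : 0 < c by exact: lt_trans Cc.
  rewrite -[LHS]fineK ?fin_num_measure//; congr EFin; apply/eqP.
  rewrite eq_le fine_ge0 ?andbT//.
  apply: (@cvgr_to_ge _ \oo _ _ (fun n => ((C / c) ^+ 2) ^+ n * fine (nu2 setT))).
    rewrite -[X in _ --> X](mul0r (fine (nu2 setT))).
    apply: cvgM; last exact: cvg_cst.
    apply: cvg_expr; rewrite ger0_norm ?sqr_ge0// expr_lt1//.
      by rewrite ltr_pdivrMr// mul1r.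
    by rewrite divr_ge0// ltW.
  by apply: nearW => n; exact: tail_bound.
have : nu1.-negligible (\bigcup_k [set x : borel | C + k.+1%:R^-1 <= `|x|]).
  apply: negligible_bigcup => k; exists [set x : borel | C + k.+1%:R^-1 <= `|x|].
  by split=> //; [exact: measurable_abs_ge|apply: tail0; rewrite ltrDl invr_gt0].
move/negligibleP => <-; last by apply: bigcupT_measurable => k; exact: measurable_abs_ge.
congr (nu1 _); apply/seteqP; split=> [x /= Cx|x [k _ /=]]; last first.
  by apply: lt_le_trans; rewrite ltrDl invr_gt0.
have [k] := ltr_add_invr Cx; rewrite -addrC => h.
by exists k => //=; rewrite addrC ltW.
Qed.

Let D : set borel := [set x | `|x| <= C].

Let mD : measurable D.
Proof.
by rewrite (_ : D = ~` [set x : borel | C < `|x|]);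
  [apply: measurableC; exact: measurable_abs_gt|
   apply/seteqP; split=> x /=; rewrite /D /= leNgt => /negP].
Qed.

Let cvg_below (nu : {finite_measure set borel -> \bar R}) (t : R) : `|t| <= C ->
  has_moments nu -> nu [set x : borel | C < `|x|] = 0%E ->
  (\int[nu]_x ((1 - ((2 * (t + 3 * C))^-1 *: ('X + (3 * C)%:P)) ^+ m)
     ^+ (m * 2 ^ m)).[x]%:E @[m --> \oo] --> nu `]-oo, t[%classic)%E.
Proof.
move=> tC mom nu0.
(* This affine map sends t to 1/2, the jump of the threshold. With the offset 3C it maps [-C, C]
   into [0, 1] for every t >= -C. *)
pose y (x : borel) : R := (2 * (t + 3 * C))^-1 * (x + 3 * C).
have tC' : - C <= t <= C by rewrite -ler_norml.
have den : 0 < 2 * (t + 3 * C) by case/andP: tC' => ? ?; move: C_gt0; lra.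
have pE m x : ((1 - ((2 * (t + 3 * C))^-1 *: ('X + (3 * C)%:P)) ^+ m)
     ^+ (m * 2 ^ m)).[x] = (1 - y x ^+ m) ^+ (m * 2 ^ m).
  by rewrite /y !(horner_exp, hornerD, hornerN, hornerZ, hornerX, hornerC).
have yD x : D x -> 0 <= y x <= 1.
  rewrite /D /= ler_norml => /andP[h1 h2]; case/andP: tC' => h3 h4.
  rewrite /y mulrC; apply/andP; split.
    by rewrite divr_ge0 ?(ltW den)//; move: C_gt0; lra.
  by rewrite ler_pdivrMr// mul1r; move: C_gt0; lra.
have int m : nu.-integrable setT (fun x : borel => ((1 - ((2 * (t + 3 * C))^-1 *:
    ('X + (3 * C)%:P)) ^+ m) ^+ (m * 2 ^ m)).[x]%:E).
  exact: integrable_horner.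
have DC : setT `\` [set x : borel | C < `|x|] = D.
  apply/seteqP; split=> [x [_ /= /negP]|x Dx]; first by rewrite /D/= -leNgt.
  by split=> //=; apply/negP; rewrite -leNgt.
have -> : nu `]-oo, t[%classic = (\int[nu]_(x in D) ((\1_`]-oo, t[ x : R)%:E))%E.
  rewrite -DC -(negligible_integral (measurable_abs_gt C))//; last first.
    by apply: integrable_indic => //; exact: measurable_itv.
  by rewrite integral_indic ?setIT//; exact: measurable_itv.
under eq_fun do rewrite (negligible_integral (measurable_abs_gt C))// DC.
apply: (@dominated_cvg _ _ _ nu _ mD _ _ (cst 1%E)).
- by move=> m; apply: measurable_funS (measurable_int _ (int m)).
- move=> x Dx; under eq_fun do rewrite pE.
  rewrite (_ : \1_`]-oo, t[ x = (y x < 2^-1)%R%:R).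
    by apply: cvg_EFin; [exact: nearW|exact: cvg_threshold (yD x Dx)].
  rewrite indicE /y mulrC ltr_pdivrMr// mulrA mulVf// mul1r ltrD2r.
  by rewrite mem_setE in_itv.
- by [].
- exact: finite_measure_integrable_cst.
- move=> m x /yD /andP[y0 y1]; rewrite pE /= lee_fin ger0_norm.
    by rewrite exprn_ile1 ?subr_ge0 ?exprn_ile1// lerBlDr lerDl exprn_ge0.
  by rewrite exprn_ge0// subr_ge0 exprn_ile1.
Qed.

Let eq_below (t : R) : nu1 `]-oo, t[%classic = nu2 `]-oo, t[%classic.
Proof.
have [tC|] := leP `|t| C.
  have h1 := cvg_below tC mom1 moment_support.
  have h2 := cvg_below tC mom2 supp2.
  rewrite -(cvg_lim (@ereal_hausdorff R) h1) -(cvg_lim (@ereal_hausdorff R) h2).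
  congr (limn _); apply/funext => m.
  rewrite -[LHS]fineK; last by apply: integrable_fin_num => //; exact: integrable_horner.
  rewrite -[RHS]fineK; last by apply: integrable_fin_num => //; exact: integrable_horner.
  by congr EFin; exact: eq_horner.
move=> Ct.
have e (nu : {finite_measure set borel -> \bar R}) (E : set borel) :
    measurable E -> nu [set x : borel | C < `|x|] = 0%E ->
    nu E = nu (E `\` [set x : borel | C < `|x|]).
  move=> mE nu0; rewrite measureD//; first last.
  - by rewrite ltey_eq fin_num_measure.
  - exact: measurable_abs_gt.
  rewrite -[LHS]sube0; congr (_ - _)%E; apply/esym.
  apply: (@subset_measure0 _ _ _ nu _ [set x : borel | C < `|x|]) => //.
  - by apply: measurableI => //; exact: measurable_abs_gt.
  - exact: measurable_abs_gt.
have mI : measurable (`]-oo, t[%classic : set borel) by exact: measurable_itv.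
rewrite (e nu1)// ?(moment_support)// (e nu2)//.
(* For t > C the half-line carries the total mass, which is the moment of order 0; for t < -C it
   carries nothing. *)
have [t0|t0] := leP 0 t.
  have -> : `]-oo, t[%classic `\` [set x : borel | C < `|x|] =
      setT `\` [set x : borel | C < `|x|].
    apply/seteqP; split=> [x [_ Dx]|x [_ Dx]]; split=> //=.
    move/negP: Dx; rewrite /= -leNgt => xC; rewrite in_itv/=.
    by rewrite (le_lt_trans (ler_norm x))// (le_lt_trans xC)// -(ger0_norm t0).
  rewrite -(e nu1)// ?(moment_support)// -(e nu2)//.
  have := eq_moments 0; under eq_Rintegral do rewrite expr0.
  under [in RHS]eq_Rintegral do rewrite expr0.
  rewrite !Rintegral_cst// !mul1r => h.
  rewrite -[LHS]fineK ?fin_num_measure// -[RHS]fineK ?fin_num_measure//.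
  by rewrite h.
have -> : `]-oo, t[%classic `\` [set x : borel | C < `|x|] = set0.
  apply/seteqP; split=> // x [/=]; rewrite in_itv/= => xt; apply.
  rewrite (lt_trans Ct)// (ltr0_norm t0) ltr0_norm ?ltrN2//.
  exact: lt_trans t0.
by rewrite !measure0.
Qed.

Theorem moment_unique (A : set borel) : measurable A -> nu1 A = nu2 A.
Proof.
rewrite RGenInftyO.measurableE => mA.
have Gm : @RGenInftyO.G R `<=` (@measurable _ borel).
  by move=> _ [x ->]; exact: measurable_itv.
have Gg (n : nat) : @RGenInftyO.G R `]-oo, n%:R[%classic by exists n%:R.
have cov : \bigcup_n `]-oo, (n%:R : R)[%classic = setT.
  rewrite -subTset => x _; exists (Num.truncn `|x|).+1 => //=.
  by rewrite in_itv/= (le_lt_trans (ler_norm x))// truncnS_gt.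
refine (@g_sigma_algebra_measure_unique _ R borel _ Gm _ Gg cov nu1 nu2 _ _ _ _ mA).
- move=> _ _ [x ->] [y ->]; exists (Num.min x y).
  apply/seteqP; split=> z /=; rewrite !in_itv/= lt_min.
    by move=> [-> ->].
  by case/andP.
- by move=> _ [x ->]; exact: eq_below.
- by move=> n; rewrite ltey_eq fin_num_measure//; exact: measurable_itv.
Qed.
End MomentUniqueness.

(** * Measures given by a density *)

Section Density.
Context d (T : measurableType d) (R : realType).
Context (m : {sigma_finite_measure set T -> \bar R}) (f : T -> R).
Hypotheses (f_ge0 : forall x, 0 <= f x) (f_int : m.-integrable setT (EFin \o f)).

(** The proofs of positivity and integrability are part of the term so that the finite measure
    structure declared below can be inferred from it. *)
Definition density of (forall x, 0 <= f x) & m.-integrable setT (EFin \o f) :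
  set T -> \bar R := fun A => (\int[m]_(x in A) (f x)%:E)%E.

Local Notation nu := (density f_ge0 f_int).

Let nu0 : nu set0 = 0%E. Proof. by rewrite /density integral_set0. Qed.

Let nu_ge0 A : (0 <= nu A)%E.
Proof. by apply: integral_ge0 => x _; rewrite lee_fin. Qed.

Let nu_sigma : semi_sigma_additive nu.
Proof.
apply: semi_sigma_additive_nng_induced; first exact: measurable_int f_int.
by move=> x; rewrite lee_fin.
Qed.

HB.instance Definition _ := isMeasure.Build _ _ _ nu nu0 nu_ge0 nu_sigma.

Let nu_fin : fin_num_fun nu.
Proof.
by move=> A mA; apply: integrable_fin_num => //; exact: integrableS f_int.
Qed.

HB.instance Definition _ := @Measure_isFinite.Build _ _ _ nu nu_fin.

Lemma density_dominates : nu `<< m.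
Proof.
apply/null_content_dominatesP => A mA mA0.
apply: null_set_integral => //; apply: measurable_funTS; exact: measurable_int f_int.
Qed.

Let rn := Radon_Nikodym_SigmaFinite.f nu m.

(* The library has change of variables only for its own Radon-Nikodym derivative,
   so that one is identified with f. *)
Let rn_ae : ae_eq m setT rn (EFin \o f).
Proof.
apply: integral_ae_eq => //.
- exact: Radon_Nikodym_SigmaFinite.f_integrable density_dominates.
- exact: measurable_int f_int.
move=> E _ mE; rewrite -Radon_Nikodym_SigmaFinite.f_integral//.
exact: density_dominates.
Qed.

Lemma ge0_integral_density (g : T -> \bar R) : measurable_fun setT g ->
  (forall x, 0 <= g x)%E ->
  (\int[nu]_x g x = \int[m]_x (g x * (f x)%:E))%E.
Proof.
move=> mg g0; have mf := measurable_int _ f_int.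
have mrn := measurable_int _ (Radon_Nikodym_SigmaFinite.f_integrable density_dominates).
rewrite -(Radon_Nikodym_SigmaFinite.change_of_variables density_dominates)//.
apply: ae_eq_integral => //; try exact: emeasurable_funM.
exact: ae_eqe_mul2l.
Qed.

Lemma integrable_density (g : T -> \bar R) : measurable_fun setT g ->
  m.-integrable setT (fun x => g x * (f x)%:E)%E -> nu.-integrable setT g.
Proof.
move=> mg /integrableP[_ gf]; apply/integrableP; split => //.
rewrite ge0_integral_density//; last exact: measurableT_comp.
under eq_integral do rewrite -(@gee0_abs _ (f _)%:E) ?lee_fin// -abseM.
exact: gf.
Qed.

Lemma integral_density (g : T -> \bar R) : measurable_fun setT g ->
  m.-integrable setT (fun x => g x * (f x)%:E)%E ->
  (\int[nu]_x g x = \int[m]_x (g x * (f x)%:E))%E.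
Proof.
move=> mg gf; rewrite integralE [in RHS]integralE.
rewrite !ge0_integral_density//; first last.
- exact: measurable_funepos.
- exact: measurable_funeneg.
congr (_ - _)%E; apply: eq_integral => x _; rewrite ?funeposE ?funenegE.
  by rewrite muleC maxe_pMr ?lee_fin// mule0 [in RHS]muleC.
by rewrite muleC maxe_pMr ?lee_fin// mule0 muleN [in RHS]muleC.
Qed.
End Density.

(** * Real L2 spaces and orthonormal bases *)

Section RealL2.
Context d (T : measurableType d) (R : realType).
Context (mu : {measure set T -> \bar R}).
Implicit Types (f g h : T -> R).

Definition L2 f : Prop := measurable_fun setT f /\
  mu.-integrable setT (fun x => (f x ^+ 2)%:E).

Definition ipr f g : R := Rintegral mu setT (fun x => f x * g x).

Lemma L2_measurable f : L2 f -> measurable_fun setT f. Proof. by case. Qed.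

Lemma L2_dom f h (K : R) : measurable_fun setT h ->
  (forall x, `|h x| <= K * `|f x|) -> L2 f -> L2 h.
Proof.
move=> mh hK [mf f2]; split => //.
apply: (@le_integrable _ _ _ mu setT _ _ (fun x => (K ^+ 2)%:E * (f x ^+ 2)%:E)%E) => //.
- by apply/measurable_EFinP; exact: measurable_funX.
- move=> x _; rewrite -EFinM lee_fin -exprMn !normrX.
  by rewrite lerXn2r ?nnegrE// normrM (le_trans (hK x))// ler_wpM2r// ler_norm.
- exact: integrableZl.
Qed.

Lemma L2_mul_integrable f g : L2 f -> L2 g ->
  mu.-integrable setT (fun x => (f x * g x)%:E).
Proof.
move=> [mf f2] [mg g2].
apply: (@le_integrable _ _ _ mu setT _ _ (fun x => (f x ^+ 2)%:E + (g x ^+ 2)%:E)%E) => //.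
- by apply/measurable_EFinP; exact: measurable_funM.
- move=> x _; rewrite -EFinD lee_fin (@ger0_norm _ (_ + _)) ?addr_ge0 ?sqr_ge0//.
  rewrite ler_norml; apply/andP; split; rewrite -subr_ge0.
    have -> : f x * g x - - (f x ^+ 2 + g x ^+ 2) =
      ((f x + g x) ^+ 2 + f x ^+ 2 + g x ^+ 2) / 2 by field.
    by rewrite divr_ge0// !addr_ge0// sqr_ge0.
  have -> : f x ^+ 2 + g x ^+ 2 - f x * g x =
    ((f x - g x) ^+ 2 + f x ^+ 2 + g x ^+ 2) / 2 by field.
  by rewrite divr_ge0// !addr_ge0// sqr_ge0.
- exact: integrableD.
Qed.

Lemma L2_0 : L2 (fun=> 0).
Proof.
split; first exact: measurable_cst.
by apply: eq_integrable (integrable0 _ _) => // x _; rewrite expr0n.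
Qed.

Lemma L2_add f g : L2 f -> L2 g -> L2 (fun x => f x + g x).
Proof.
move=> hf hg; split; first by apply: measurable_funD; apply: L2_measurable.
have fg := L2_mul_integrable hf hg.
case: hf hg => [mf f2] [mg g2].
apply: (@eq_integrable _ _ _ mu setT _ (fun x => ((f x ^+ 2)%:E + (g x ^+ 2)%:E) + 2%:E * (f x * g x)%:E)%E) => //.
  by move=> x _; rewrite -EFinM -!EFinD; congr EFin; ring.
by apply: integrableD => //; [exact: integrableD|exact: integrableZl].
Qed.

Lemma L2_scale (k : R) f : L2 f -> L2 (fun x => k * f x).
Proof.
move=> hf; apply: (@L2_dom f _ `|k|) => //.
  by apply: measurable_funM => //; exact: L2_measurable.
by move=> x; rewrite normrM.
Qed.

Lemma L2_opp f : L2 f -> L2 (fun x => - f x).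
Proof.
by move=> /(L2_scale (-1)); under eq_fun do rewrite mulN1r.
Qed.

Lemma L2_sub f g : L2 f -> L2 g -> L2 (fun x => f x - g x).
Proof. by move=> hf hg; apply: L2_add => //; exact: L2_opp. Qed.

Lemma L2_sum (I : Type) (s : seq I) (F : I -> T -> R) : (forall i, L2 (F i)) ->
  L2 (fun x => \sum_(i <- s) F i x).
Proof.
move=> hF; elim: s => [|i s IHs].
  by under eq_fun do rewrite big_nil; exact: L2_0.
by under eq_fun do rewrite big_cons; exact: L2_add.
Qed.

Lemma iprC f g : ipr f g = ipr g f.
Proof. by apply: eq_Rintegral => x _; rewrite mulrC. Qed.

Lemma iprDl f g h : L2 f -> L2 g -> L2 h ->
  ipr (fun x => f x + g x) h = ipr f h + ipr g h.
Proof.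
move=> hf hg hh; rewrite /ipr -RintegralD//; try exact: L2_mul_integrable.
by apply: eq_Rintegral => x _; rewrite mulrDl.
Qed.

Lemma iprZl (k : R) f g : L2 f -> L2 g -> ipr (fun x => k * f x) g = k * ipr f g.
Proof.
move=> hf hg; rewrite /ipr -RintegralZl//; last exact: L2_mul_integrable.
by apply: eq_Rintegral => x _; rewrite mulrA.
Qed.

Lemma iprBl f g h : L2 f -> L2 g -> L2 h ->
  ipr (fun x => f x - g x) h = ipr f h - ipr g h.
Proof.
move=> hf hg hh; rewrite /ipr -RintegralB//; try exact: L2_mul_integrable.
by apply: eq_Rintegral => x _; rewrite mulrBl.
Qed.

Lemma ipr_suml (I : Type) (s : seq I) (F : I -> T -> R) g : (forall i, L2 (F i)) ->
  L2 g -> ipr (fun x => \sum_(i <- s) F i x) g = \sum_(i <- s) ipr (F i) g.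
Proof.
move=> hF hg; elim: s => [|i s IHs].
  rewrite big_nil /ipr; under eq_Rintegral do rewrite big_nil mul0r.
  by rewrite Rintegral_cst// mul0r.
rewrite big_cons -IHs -iprDl//; last exact: L2_sum.
by apply: eq_Rintegral => x _; rewrite big_cons.
Qed.

Lemma ipr_ge0 f : 0 <= ipr f f.
Proof. by apply: Rintegral_ge0 => x _; rewrite -expr2 sqr_ge0. Qed.

Lemma EFin_ipr f g : L2 f -> L2 g -> ((ipr f g)%:E = \int[mu]_x (f x * g x)%:E)%E.
Proof.
by move=> hf hg; rewrite fineK//; apply: integrable_fin_num => //; exact: L2_mul_integrable.
Qed.

Lemma ipr_sqE f : L2 f -> ((ipr f f)%:E = \int[mu]_x (f x ^+ 2)%:E)%E.
Proof. by move=> hf; rewrite EFin_ipr//; apply: eq_integral => x _; rewrite expr2. Qed.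

Lemma ae_eq_ipr f1 f2 g : measurable_fun setT f1 -> measurable_fun setT f2 ->
  measurable_fun setT g -> ae_eq mu setT f1 f2 -> ipr f1 g = ipr f2 g.
Proof.
move=> m1 m2 mg e; congr fine; apply: ae_eq_integral => //.
- by apply/measurable_EFinP; exact: measurable_funM.
- by apply/measurable_EFinP; exact: measurable_funM.
- by apply: filterS e => x /= e xT; rewrite e.
Qed.

End RealL2.

(** * The Riesz-Fischer theorem *)

Section RieszFischer.
Context d (T : measurableType d) (R : realType).
Context (mu : {measure set T -> \bar R}) (phi : nat -> T -> R).
Hypothesis phi_L2 : forall n, L2 mu (phi n).
Hypothesis phi_orth : forall n m, ipr mu (phi n) (phi m) = (n == m)%:R.

Lemma orth_sum_sq (s : seq nat) (c : nat -> R) : uniq s ->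
  ipr mu (fun x => \sum_(k <- s) c k * phi k x)
         (fun x => \sum_(k <- s) c k * phi k x) = \sum_(k <- s) c k ^+ 2.
Proof.
move=> us; have L k : L2 mu (fun x => c k * phi k x) by exact: L2_scale.
rewrite ipr_suml//; last exact: L2_sum.
rewrite !big_seq; apply: eq_bigr => k ks; rewrite iprZl//; last exact: L2_sum.
rewrite iprC ipr_suml// (bigD1_seq k)//= iprZl// phi_orth eqxx mulr1.
rewrite big1 ?addr0 ?expr2// => j jk.
by rewrite iprZl// phi_orth (negPf jk) mulr0.
Qed.

Lemma bessel f n : L2 mu f -> \sum_(k < n) ipr mu f (phi k) ^+ 2 <= ipr mu f f.
Proof.
move=> hf; pose c k := ipr mu f (phi k).
pose g x := \sum_(k <- index_iota 0 n) c k * phi k x.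
have L k : L2 mu (fun x => c k * phi k x) by exact: L2_scale.
have hg : L2 mu g by exact: L2_sum.
have := ipr_ge0 mu (fun x => f x - g x).
rewrite iprBl//; last exact: L2_sub.
rewrite ![ipr _ _ (fun x => f x - g x)]iprC !iprBl//.
have -> : ipr mu g g = \sum_(k <- index_iota 0 n) c k ^+ 2 by rewrite orth_sum_sq ?iota_uniq.
have -> : ipr mu g f = \sum_(k <- index_iota 0 n) c k ^+ 2.
  rewrite ipr_suml//; apply: eq_bigr => k _.
  by rewrite iprZl// iprC -expr2.
have -> : ipr mu f g = \sum_(k <- index_iota 0 n) c k ^+ 2.
  rewrite iprC ipr_suml//; apply: eq_bigr => k _.
  by rewrite iprZl// iprC -expr2.
by rewrite subrr subr0 big_mkord subr_ge0.
Qed.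

Context (c : nat -> R).
Hypothesis c_l2 : (\sum_(0 <= n <oo) (c n ^+ 2)%:E < +oo)%E.

Let S n x := \sum_(0 <= k < n) c k * phi k x.
Let P n := \sum_(0 <= k < n) c k ^+ 2.
Let E := fine (\sum_(0 <= n <oo) (c n ^+ 2)%:E).

Let EE : (\sum_(0 <= n <oo) (c n ^+ 2)%:E)%E = E%:E.
Proof.
by rewrite fineK// ge0_fin_numE// nneseries_ge0// => n _ _; rewrite lee_fin sqr_ge0.
Qed.

Let P_le n : P n <= E.
Proof.
rewrite -lee_fin -EE -sumEFin; apply: nneseries_lim_ge => k _ _.
by rewrite lee_fin sqr_ge0.
Qed.

Let P_cvg : P n @[n --> \oo] --> E.
Proof.
have : (\sum_(0 <= k < n) (c k ^+ 2)%:E)%E @[n --> \oo] --> E%:E.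
  rewrite -EE; apply: is_cvg_nneseries => n _ _; by rewrite lee_fin sqr_ge0.
move/fine_cvgP => [_]; apply: cvg_trans; apply: near_eq_cvg.
by apply: nearW => n /=; rewrite sumEFin.
Qed.

Let S_L2 n : L2 mu (S n).
Proof. by apply: L2_sum => k; exact: L2_scale. Qed.

Let S_dist n m : ipr mu (fun x => S n x - S m x) (fun x => S n x - S m x) =
  `|P n - P m|.
Proof.
wlog mn : n m / (m <= n)%N.
  move=> h; have [/h//|/ltnW/h nm] := leqP m n.
  rewrite distrC -nm; apply: eq_Rintegral => x _.
  by rewrite -(opprB (S m x)) mulrNN.
have e x : S n x - S m x = \sum_(k <- index_iota m n) c k * phi k x.
  by rewrite /S (big_cat_nat (n := m))//= addrAC subrr add0r.
rewrite (_ : P n - P m = \sum_(k <- index_iota m n) c k ^+ 2); last first.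
  by rewrite /P (big_cat_nat (n := m))//= addrAC subrr add0r.
rewrite ger0_norm ?sumr_ge0// => [|k _]; last exact: sqr_ge0.
rewrite -orth_sum_sq ?iota_uniq//.
by apply: eq_Rintegral => x _; rewrite !e.
Qed.

(** The factor [4 ^+ k] pays for the weights of the squared increments in [h] below; the factor
    [2 ^ k.+1] leaves a summable series. *)
Let dl k : R := ((2 ^ k.+1)%:R * 4 ^+ k)^-1.

Let dl_gt0 k : 0 < dl k.
Proof. by rewrite invr_gt0 mulr_gt0 ?exprn_gt0// ltr0n expn_gt0. Qed.

Let subseq_ex : exists N : nat -> nat, forall k, E - P (N k) <= dl k.
Proof.
suff h k : exists n, E - P n <= dl k by have [N hN] := choice h; exists N.
have /cvgrPdist_le /(_ _ (dl_gt0 k)) [n _ /(_ n (leqnn _))] := P_cvg.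
by move=> h; exists n; apply: le_trans h; exact: ler_norm.
Qed.

(** A sufficiently sparse subsequence of partial sums converges almost everywhere, and F is its
    pointwise limsup. Since F is given by a formula at every point, it vanishes wherever all [phi n]
    do; the last clause keeps F in the space of functions supported on D. *)
Lemma riesz_fischer : exists F, [/\ L2 mu F,
  ((ipr mu F F)%:E <= \sum_(0 <= n <oo) (c n ^+ 2)%:E)%E,
  forall n, ipr mu F (phi n) = c n &
  forall x, (forall n, phi n x = 0) -> F x = 0].
Proof.
have [N hN] := subseq_ex.
pose Dk k x := S (N k.+1) x - S (N k) x.
(* The integral of h is at most the sum of [2^-(k+1)], so h is finite almost everywhere. There |Dk|
   <= 2^-k sqrt(h), and the telescoping series of the increments converges absolutely. *)
pose h x := (\sum_(0 <= k <oo) (4 ^+ k * Dk k x ^+ 2)%:E)%E.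
have Dk_L2 k : L2 mu (Dk k) by exact: L2_sub.
have mDk k : measurable_fun setT (fun x => (4 ^+ k * Dk k x ^+ 2)%:E).
  apply/measurable_EFinP; apply: measurable_funM => //.
  by apply: measurable_funX; exact: L2_measurable.
have Dk_ge0 k x : (0 <= (4 ^+ k * Dk k x ^+ 2)%:E)%E.
  by rewrite lee_fin mulr_ge0 ?sqr_ge0// exprn_ge0.
have h_ge0 x : (0 <= h x)%E by apply: nneseries_ge0 => k _ _.
have mh : measurable_fun setT h by apply: ge0_emeasurable_sum.
have h_int : mu.-integrable setT h.
  apply/integrableP; split=> //.
  under eq_integral do rewrite gee0_abs//.
  rewrite integral_nneseries//.
  apply: (@le_lt_trans _ _ (\sum_(0 <= k <oo) (1 / (2 ^ k.+1)%:R)%:E)%E); last first.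
    by apply: le_lt_trans (epsilon_trick0 _ _) _ => //; exact: ltry.
  apply: lee_nneseries => k _; first by rewrite integral_ge0.
  under eq_integral do rewrite EFinM.
  rewrite ge0_integralZl//; first last.
  - by move=> x _; rewrite lee_fin sqr_ge0.
  - by apply/measurable_EFinP; apply: measurable_funX; exact: L2_measurable.
  rewrite -ipr_sqE// -EFinM lee_fin S_dist.
  have PN i : E - dl i <= P (N i) <= E by rewrite P_le andbT lerBlDr -lerBlDl hN.
  have PNS i j : `|P (N j) - P (N i)| <= Num.max (dl i) (dl j).
    have /andP[? ?] := PN i; have /andP[? ?] := PN j.
    rewrite le_max !ler_norml; apply/orP; have := dl_gt0 i; have := dl_gt0 j => ? ?.
    by have [?|?] := leP (P (N i)) (P (N j)); [left|right]; apply/andP; split; lra.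
  have dlS : dl k.+1 <= dl k.
    rewrite lef_pV2 ?posrE ?mulr_gt0 ?exprn_gt0 ?ltr0n ?expn_gt0//.
    rewrite ler_pM ?exprn_ge0// ?ler_nat ?leq_exp2l//.
    by rewrite ler_eXn2l// ltr1n.
  have := PNS k k.+1; rewrite (max_idPl dlS) => hk.
  apply: (@le_trans _ _ (4 ^+ k * dl k)); first by rewrite ler_wpM2l ?exprn_ge0.
  rewrite /dl invfM mulrCA mulfV ?mulr1 ?mul1r// expf_neq0//.
pose F x := fine (limn_esup (fun k => (S (N k) x)%:E)).
have mF : measurable_fun setT F.
  apply: (measurableT_comp (fine_measurable measurableT)).
  apply: measurable_fun_limn_esup => k; apply/measurable_EFinP.
  exact: L2_measurable.
have F_lim x : h x \is a fin_num -> S (N k) x @[k --> \oo] --> F x.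
  move=> hx; have cv : cvgn (fun k => S (N k) x).
    have e : (fun k => S (N k) x) = (fun k => series (Dk^~ x) k + S (N 0%N) x).
      apply/funext => k; rewrite /series /= /Dk.
      by rewrite (telescope_sumr (fun k => S (N k) x))// subrK.
    rewrite e; apply: is_cvgD; last exact: is_cvg_cst.
    apply: normed_cvg.
    apply: (@series_le_cvg _ _ (geometric (Num.sqrt (fine (h x))) 2^-1)) => [n|n|n|] /=.
    - by [].
    - by rewrite mulr_ge0 ?sqrtr_ge0 ?exprn_ge0.
    - rewrite -(@ler_pXn2r _ 2)// ?nnegrE ?mulr_ge0 ?sqrtr_ge0 ?exprn_ge0//.
      rewrite exprMn sqr_sqrtr ?fine_ge0// real_normK ?num_real//.
      have -> : (2^-1 : R) ^+ n ^+ 2 = (4 ^+ n)^-1.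
        by rewrite -exprM mulnC exprM -exprVn; congr (_ ^+ n); field.
      rewrite mulrC ler_pdivlMl ?exprn_gt0//.
      rewrite -lee_fin fineK// /h.
      have := @nneseries_lim_ge _ (fun k => (4 ^+ k * Dk k x ^+ 2)%:E) xpredT 0%N n.+1.
      move=> /(_ (fun k _ _ => Dk_ge0 k x)); apply: le_trans.
      rewrite big_nat_recr//= leeDr// sume_ge0// => k _; exact: Dk_ge0.
    - by apply: is_cvg_geometric_series; rewrite ger0_norm// invf_lt1// ltr1n.
  have cE : (S (N k) x)%:E @[k --> \oo] --> (limn (fun k => S (N k) x))%:E.
    by apply: cvg_EFin; [exact: nearW|exact: cv].
  by rewrite /F (cvg_limn_einf_sup cE).2.
have ae_lim : {ae mu, forall x, S (N k) x @[k --> \oo] --> F x}.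
  have := integrable_ae measurableT h_int.
  by apply: filterS => x /(_ Logic.I); exact: F_lim.
(* Fatou's lemma along the subsequence: the squared distances of its partial sums to [S m] tend to
   [E - P m]. *)
have dist m : (\int[mu]_x ((F x - S m x) ^+ 2)%:E <= (E - P m)%:E)%E.
  pose f_ k x := ((S (N k) x - S m x) ^+ 2)%:E.
  have mf_ k : measurable_fun setT (f_ k).
    by apply/measurable_EFinP; apply: measurable_funX; apply: L2_measurable; exact: L2_sub.
  have f_ge0 k x : setT x -> (0 <= f_ k x)%E by rewrite lee_fin sqr_ge0.
  have := fatou mu measurableT mf_ f_ge0.
  have PN_cvg : P (N n) @[n --> \oo] --> E.
    apply: (@squeeze_cvgr _ _ _ _ (fun n => E - dl n) (cst E)).
    - by apply: nearW => n; rewrite P_le andbT lerBlDr -lerBlDl hN.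
    - rewrite -[X in _ --> X]subr0; apply: cvgB; first exact: cvg_cst.
      apply: (@squeeze_cvgr _ _ _ _ (cst 0) (@harmonic R)).
      + apply: nearW => n; rewrite ltW//= lef_pV2 ?posrE ?mulr_gt0 ?exprn_gt0 ?ltr0n ?expn_gt0//.
        rewrite -[leLHS]mulr1 ler_pM// ?exprn_ege1 ?ler1n//.
        by rewrite ler_nat ltnW// ltn_expl.
      + exact: cvg_cst.
      + exact: cvg_harmonic.
    - exact: cvg_cst.
  have lim_dist : limn_einf (fun n => \int[mu]_x f_ n x)%E = (E - P m)%:E.
    apply: (cvg_limn_einf_sup _).1.
    rewrite (_ : (fun n => _) = (fun n => `|P (N n) - P m|%:E)); last first.
      by apply/funext => n; rewrite -S_dist ipr_sqE//; exact: L2_sub.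
    apply: cvg_EFin; first exact: nearW.
    rewrite -[E - P m]ger0_norm ?subr_ge0//; apply: cvg_norm.
    by apply: cvgB; [exact: PN_cvg|exact: cvg_cst].
  rewrite lim_dist; apply: le_trans; rewrite le_eqVlt; apply/orP; left; apply/eqP.
  apply: ae_eq_integral => //.
  - apply/measurable_EFinP; apply: measurable_funX; apply: measurable_funB => //.
    exact: L2_measurable.
  - rewrite (_ : (fun x => _) = (fun x => - limn_esup (fun k => - f_ k x))%E).
      apply: measurableT_comp => //; apply: measurable_fun_limn_esup => k.
      exact: measurableT_comp.
    apply/funext => x; rewrite -limn_einfN; congr limn_einf.
    by apply/funext => k; exact/esym/oppeK.
  - apply: filterS ae_lim => x hx _; apply/esym.
    apply: (cvg_limn_einf_sup _).1; apply: cvg_EFin; first exact: nearW.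
    have hd : (S (N k) x - S m x) @[k --> \oo] --> F x - S m x.
      by apply: cvgB => //; exact: cvg_cst.
    exact: (cvgM hd hd).
have FS_L2 m : L2 mu (fun x => F x - S m x).
  have mFS : measurable_fun setT (fun x => F x - S m x).
    by apply: measurable_funB => //; exact: L2_measurable.
  split=> //; apply/integrableP; split.
    by apply/measurable_EFinP; exact: measurable_funX.
  under eq_integral do rewrite gee0_abs ?lee_fin ?sqr_ge0//.
  by apply: le_lt_trans (dist m) _; exact: ltry.
have F_L2 : L2 mu F.
  rewrite (_ : F = fun x => F x - S 0%N x); first exact: FS_L2.
  by apply/funext => x; rewrite /S big_geq// subr0.
exists F; split=> // [|n|x phi0].
- rewrite EE ipr_sqE//; have := dist 0%N; rewrite /P big_geq// subr0.
  by under eq_integral do rewrite /S big_geq// subr0.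

- have ipS m : (n < m)%N -> ipr mu (S m) (phi n) = c n.
    move=> nm; have L k : L2 mu (fun x => c k * phi k x) by exact: L2_scale.
    rewrite ipr_suml// (bigD1_seq n)/= ?iota_uniq ?mem_index_iota//.
    rewrite iprZl// phi_orth eqxx mulr1 big1 ?addr0// => j jn.
    by rewrite iprZl// phi_orth (negPf jn) mulr0.
  have bd m : (n < m)%N -> (ipr mu F (phi n) - c n) ^+ 2 <= E - P m.
    move=> nm; rewrite -(ipS m)// -iprBl//.
    rewrite -lee_fin; apply: le_trans (dist m); rewrite -ipr_sqE// lee_fin.
    (* The squared n-th coefficient is one term of the Bessel sum of [F - S m], hence is bounded by
       the squared distance. *)
    apply: le_trans (bessel n.+1 (FS_L2 m)).
    by rewrite big_ord_recr/= lerDr sumr_ge0// => k _; exact: sqr_ge0.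
  apply/eqP; rewrite -subr_eq0 -sqrf_eq0 eq_le sqr_ge0 andbT.
  apply: (@cvgr_to_ge _ \oo _ _ (fun m => E - P m)).
    by rewrite -(subrr E); apply: cvgB; [exact: cvg_cst|exact: P_cvg].
  by exists n.+1 => // m /= nm; exact: bd.
- rewrite /F (_ : (fun k => (S (N k) x)%:E) = cst 0%E).
    by rewrite (cvg_limn_einf_sup (cvg_cst _)).2.
  by apply/funext => k; rewrite /S big1// => j _; rewrite phi0 mulr0.
Qed.
End RieszFischer.

(** * Orthonormal bases of the functions supported on D *)

Section HilbertBasis.
Context d (T : measurableType d) (R : realType).
Context (mu : {measure set T -> \bar R}) (D : set T) (phi : nat -> T -> R).

(** Vanishing off D is required at every point and not merely almost everywhere, so that a
    multiplier needs a bound on D only. *)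
Definition L2on (f : T -> R) : Prop := L2 mu f /\ forall x, ~ D x -> f x = 0.

Hypothesis phi_L2 : forall n, L2on (phi n).
Hypothesis phi_orth : forall n m, ipr mu (phi n) (phi m) = (n == m)%:R.
Hypothesis phi_total : forall f, L2on f -> (forall n, ipr mu f (phi n) = 0) ->
  ae_eq mu setT f (fun=> 0).

Let phi_L2' n : L2 mu (phi n). Proof. by case: (phi_L2 n). Qed.

Lemma L2on_sub f g : L2on f -> L2on g -> L2on (fun x => f x - g x).
Proof.
move=> [hf f0] [hg g0]; split; first exact: L2_sub.
by move=> x Dx; rewrite f0// g0// subrr.
Qed.

Lemma basis_inj f g : L2on f -> L2on g ->
  (forall n, ipr mu f (phi n) = ipr mu g (phi n)) -> ae_eq mu setT f g.
Proof.
move=> hf hg fg; have := phi_total (L2on_sub hf hg).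
have [hf' _] := hf; have [hg' _] := hg.
case=> [n|A [mA A0 sA]]; first by rewrite iprBl// fg subrr.
exists A; split => // x /= h; apply: sA => /= h'; apply: h => _.
by apply/eqP; rewrite -subr_eq0 h'.
Qed.

Lemma basis_surj (c : nat -> R) : (\sum_(0 <= n <oo) (c n ^+ 2)%:E < +oo)%E ->
  exists2 F, L2on F & forall n, ipr mu F (phi n) = c n.
Proof.
move=> hc; have [F [hF _ Fc F0]] := riesz_fischer phi_L2' phi_orth hc.
exists F => //; split=> // x Dx; apply: F0 => n.
by have [_] := phi_L2 n; apply.
Qed.

(** One inequality is Bessel's. For the other, Riesz-Fischer rebuilds from the coefficients a
    function whose squared norm is at most their sum, and totality identifies it with f. *)
Lemma parseval f : L2on f ->
  (\sum_(0 <= n <oo) (ipr mu f (phi n) ^+ 2)%:E = (ipr mu f f)%:E)%E.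
Proof.
move=> hf; have [hf' _] := hf; pose c n := ipr mu f (phi n).
have le : (\sum_(0 <= n <oo) (c n ^+ 2)%:E <= (ipr mu f f)%:E)%E.
  apply: lime_le; first by apply: is_cvg_nneseries => n _ _; rewrite lee_fin sqr_ge0.
  apply: nearW => n; rewrite sumEFin lee_fin big_mkord.
  exact: (bessel phi_L2' phi_orth).
apply/eqP; rewrite eq_le le/=.
have hc : (\sum_(0 <= n <oo) (c n ^+ 2)%:E < +oo)%E by rewrite (le_lt_trans le)// ltry.
have [F [hF FE Fc F0]] := riesz_fischer phi_L2' phi_orth hc.
have hF' : L2on F.
  by split=> // x Dx; apply: F0 => n; have [_] := phi_L2 n; apply.
apply: le_trans FE; rewrite lee_fin le_eqVlt; apply/orP; left; apply/eqP.
have e : ae_eq mu setT f F by apply: basis_inj => // n; rewrite Fc.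
have [mf mF] := (L2_measurable hf', L2_measurable hF).
by rewrite (ae_eq_ipr mf mF mf e) iprC (ae_eq_ipr mf mF mF e).
Qed.
End HilbertBasis.

(** * Chebyshev polynomials on the band *)

Section ChebyshevBasis.
Context (R : realType) (a : R).
Hypothesis a_gt0 : 0 < a.
Local Notation borel := (measurableTypeR R).
Local Notation leb := (@lebesgue_measure R).

Fixpoint chebU (n : nat) : {poly R} :=
  if n is m.+1 then
    if m is k.+1 then a^-1 *: ('X * chebU m) - chebU k else a^-1 *: 'X
  else 1.

Lemma chebUSS n : chebU n.+2 = a^-1 *: ('X * chebU n.+1) - chebU n.
Proof. by []. Qed.

Lemma mulX_chebUS n : 'X * chebU n.+1 = a *: (chebU n.+2 + chebU n).
Proof. by rewrite chebUSS subrK scalerA divff ?scale1r// gt_eqF. Qed.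

Lemma mulX_chebU0 : 'X * chebU 0 = a *: chebU 1.
Proof. by rewrite /= mulr1 scalerA divff ?scale1r// gt_eqF. Qed.

(** This is [(1 - t^2) U_n' = (n+2) t U_n - (n+1) U_(n+1)] after x = 2at. It replaces the
    trigonometric substitution: integration by parts then stays among the polynomials [chebU]. Two
    consecutive indices go through the induction because the recurrence has order two. *)
Lemma chebU_deriv n : ((4 * a ^+ 2)%:P - 'X^2) * (chebU n)^`() =
  n.+2%:R *: ('X * chebU n) - (2 * a * n.+1%:R) *: chebU n.+1.
Proof.
have a0 : a != 0 by rewrite gt_eqF.
have aa : a%:P * a^-1%:P = 1 :> {poly R} by rewrite -polyCM divff.
suff : ((4 * a ^+ 2)%:P - 'X^2) * (chebU n)^`() =
    n.+2%:R *: ('X * chebU n) - (2 * a * n.+1%:R) *: chebU n.+1 /\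
  ((4 * a ^+ 2)%:P - 'X^2) * (chebU n.+1)^`() =
    n.+3%:R *: ('X * chebU n.+1) - (2 * a * n.+2%:R) *: chebU n.+2 by case.
elim: n => [|n [IH1 IH2]].
  rewrite !chebUSS /= derivC mulr0 derivZ derivX -!mul_polyC.
  rewrite !(polyCM, polyCB, rmorphXn)/=.
  split; [ring: aa|ring: aa].
split=> //; rewrite (chebUSS n.+1) [in LHS]chebUSS.
rewrite derivB derivZ derivM derivX mul1r -mul_polyC.
set K := (_ - 'X^2); set U' := (chebU n)^`() in IH1 *.
set V' := (chebU n.+1)^`() in IH2 *.
have -> : K * (a^-1%:P * (chebU n.+1 + 'X * V') - U') =
  a^-1%:P * (K * chebU n.+1 + 'X * (K * V')) - K * U' by ring.
rewrite IH1 IH2 chebUSS /K; move: (chebU n) (chebU n.+1) => U V.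
rewrite -!mul_polyC !(polyCM, polyCB, rmorphXn)/=.
rewrite -[n.+4%:R]natr1 -[n.+3%:R]natr1 -[n.+2%:R]natr1 -[n.+1%:R]natr1 !polyCD.
ring: aa.
Qed.

Definition semic (x : R) : R := Num.sqrt (4 * a ^+ 2 - x ^+ 2).

Lemma semic_ge0 x : 0 <= semic x. Proof. exact: sqrtr_ge0. Qed.

Lemma semic_gt0 x : `|x| < 2 * a -> 0 < semic x.
Proof.
move=> xa; rewrite sqrtr_gt0 subr_gt0 -real_normK ?num_real//.
rewrite (_ : 4 * a ^+ 2 = (2 * a) ^+ 2); last by ring.
by rewrite ltrXn2r// ?nnegrE// mulr_ge0// ltW.
Qed.

Lemma semic_sq x : `|x| <= 2 * a -> semic x ^+ 2 = 4 * a ^+ 2 - x ^+ 2.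
Proof.
move=> xa; rewrite sqr_sqrtr// subr_ge0 -(real_normK (num_real x)).
rewrite (_ : 4 * a ^+ 2 = (2 * a) ^+ 2); last by ring.
by rewrite lerXn2r// ?nnegrE// mulr_ge0// ltW.
Qed.

Lemma semic_out x : 2 * a <= `|x| -> semic x = 0.
Proof.
move=> xa; apply: ler0_sqrtr; rewrite subr_le0 -(real_normK (num_real x)).
rewrite (_ : 4 * a ^+ 2 = (2 * a) ^+ 2); last by ring.
by rewrite lerXn2r// ?nnegrE// mulr_ge0// ltW.
Qed.

Let semicE : semic = Num.sqrt \o horner ((4 * a ^+ 2)%:P - 'X^2).
Proof.
by apply/funext => x; rewrite /semic /= hornerD hornerN hornerC hornerXn.
Qed.

Lemma semic_continuous : continuous semic.
Proof.
move=> x; rewrite semicE; apply: continuous_comp; first exact: continuous_horner.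
exact: sqrt_continuous.
Qed.

Lemma semic_derive x : `|x| < 2 * a -> is_derive x (1 : R) semic (- (x / semic x)).
Proof.
move=> xa; have s0 := semic_gt0 xa.
have K0 : 0 < ((4 * a ^+ 2)%:P - 'X^2).[x].
  by rewrite hornerD hornerN hornerC hornerXn -semic_sq 1?ltW// exprn_gt0.
have := is_derive1_comp (is_derive1_sqrt K0) (is_derive_poly ((4 * a ^+ 2)%:P - 'X^2) x).
rewrite -semicE derivB derivC derivXn sub0r hornerN hornerMn hornerXn expr1.
have -> : Num.sqrt ((4 * a ^+ 2)%:P - 'X^2).[x] = semic x by rewrite semicE.
by have -> : (2 * semic x)^-1 * - (x *+ 2) = - (x / semic x) by field; rewrite gt_eqF.
Qed.

Let ab : - (2 * a) < 2 * a. Proof. by move: a_gt0; lra. Qed.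

Lemma itv_abs (x : R) : (x \in `](- (2 * a)), (2 * a)[) = (`|x| < 2 * a).
Proof. by rewrite in_itv/= ltr_norml. Qed.

Let sp_restrict (f : R -> R) : (fun x => (semic x * f x)%:E) =
  (fun x => (semic x * f x)%:E) \_ `[(- (2 * a)), (2 * a)]%classic.
Proof.
apply/funext => x; rewrite /patch; case: ifPn => //.
rewrite notin_setE /= in_itv/= => /negP; rewrite -ler_norml -ltNge => xa.
by rewrite semic_out ?mul0r// ltW.
Qed.

Let sp_continuous (p : {poly R}) : continuous (fun x => semic x * p.[x]).
Proof.
move=> x; apply: cvgM; [exact: semic_continuous|exact: continuous_horner].
Qed.

Lemma semic_integrable (p : {poly R}) :
  leb.-integrable setT (fun x : borel => (semic x * p.[x])%:E).
Proof.
have mI : measurable (`[(- (2 * a)), (2 * a)]%classic : set borel).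
  exact: measurable_itv.
rewrite sp_restrict; apply/(integrable_mkcond _ mI).
apply: continuous_compact_integrable; first exact: segment_compact.
by apply: continuous_subspaceT; exact: sp_continuous.
Qed.

Let semic_integral_itv (p : {poly R}) :
  (\int[leb]_x (semic x * p.[x])%:E =
   \int[leb]_(x in `[(- (2 * a))%R, (2 * a)%R]) (semic x * p.[x])%:E)%E.
Proof. by rewrite [in LHS]sp_restrict [RHS]integral_mkcond. Qed.

(** The integrand is the derivative of (4a^2 - x^2)^(3/2) q, which vanishes at both ends of the
    band. The exponent 3/2 makes that derivative a polynomial multiple of [semic], hence continuous
    up to the ends. *)
Lemma semic_stokes (q : {poly R}) :
  Rintegral leb setT (fun x : borel =>
    semic x * (((4 * a ^+ 2)%:P - 'X^2) * q^`() - 3 *: ('X * q)).[x]) = 0.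
Proof.
rewrite /Rintegral semic_integral_itv.
pose F x := semic x ^+ 3 * q.[x].
have cF : continuous F.
  move=> x; apply: cvgM; last exact: continuous_horner.
  exact: (@continuous_comp _ _ _ semic (fun y => y ^+ 3) _ (@semic_continuous x) (@exprn_continuous _ 3 _)).
have dF x : `|x| < 2 * a -> is_derive x (1 : R) F
    (semic x ^+ 3 * q^`().[x] + q.[x] * (3 * semic x ^+ 2 * - (x / semic x))).
  move=> xD; have h3 := is_deriveX 3 (semic_derive xD).
  exact: is_deriveM h3 (is_derive_poly q x).
rewrite (@continuous_FTC2 _ _ F) // /F.
- rewrite !semic_out ?normrN ?(ger0_norm (ltW _)) ?mulr_gt0//.
  by rewrite expr0n/= !mul0r subrr.
- by apply: continuous_subspaceT; exact: sp_continuous.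
- split.
  + by move=> x; rewrite itv_abs => xD; have [] := dF x xD.
  + by apply: cvg_at_right_filter; exact: cF.
  + by apply: cvg_at_left_filter; exact: cF.
- move=> x; rewrite itv_abs => xD; rewrite derive1E.
  have -> := @derive_val _ _ _ _ _ _ _ (dF x xD).
  rewrite hornerD hornerN hornerM hornerZ hornerM hornerX hornerD hornerN.
  rewrite hornerC hornerXn -(semic_sq (ltW xD)).
  by field; rewrite gt_eqF// semic_gt0.
Qed.

Definition semic_int (p : {poly R}) : R :=
  Rintegral leb setT (fun x : borel => semic x * p.[x]).

Lemma semic_intD p q : semic_int (p + q) = semic_int p + semic_int q.
Proof.
rewrite /semic_int -RintegralD//; try exact: semic_integrable.
by apply: eq_Rintegral => x _; rewrite hornerD mulrDr.
Qed.

Lemma semic_intZ c p : semic_int (c *: p) = c * semic_int p.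
Proof.
rewrite /semic_int -RintegralZl//; last exact: semic_integrable.
by apply: eq_Rintegral => x _; rewrite hornerZ mulrCA.
Qed.

Lemma semic_intB p q : semic_int (p - q) = semic_int p - semic_int q.
Proof. by rewrite -scaleN1r semic_intD semic_intZ mulN1r. Qed.

(* Integrating the derivative of (4a^2 - x^2)^(3/2) U_m, with chebU_deriv, gives
   (m + 3) I(m+1) = (m - 1) I(m-1) for I(k) the integral of U_k. *)
Lemma semic_int_chebU n : semic_int (chebU n.+1) = 0.
Proof.
have a0 : a != 0 by rewrite gt_eqF.
have st q := semic_stokes q.
have I1 : semic_int (chebU 1) = 0.
  have := st (chebU 0); rewrite -/(semic_int _) chebU_deriv mulX_chebU0.
  move: (chebU 1) => u; rewrite !semic_intB !semic_intZ => h.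
  have : 3 * a * semic_int u = 0 by rewrite -[RHS]oppr0 -h; ring.
  by move/eqP; rewrite mulf_eq0 mulf_eq0 (negPf a0) pnatr_eq0 => /eqP.
have I2 m : (m.+4)%:R * semic_int (chebU m.+2) = m%:R * semic_int (chebU m).
  have := st (chebU m.+1); rewrite -/(semic_int _) chebU_deriv mulX_chebUS.
  move: (chebU m) (chebU m.+2) => u v.
  rewrite !semic_intB !semic_intZ !semic_intD => h.
  apply: (mulfI a0); apply/eqP; rewrite -subr_eq0; apply/eqP.
  rewrite -[RHS]oppr0 -h -[m.+4%:R]natr1 -[m.+3%:R]natr1 -[m.+2%:R]natr1 -[m.+1%:R]natr1.
  ring.
suff : semic_int (chebU n.+1) = 0 /\ semic_int (chebU n.+2) = 0 by case.
elim: n => [|n [IH1 IH2]]; split=> //.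
- have /eqP := I2 0%N; rewrite mul0r mulf_eq0 pnatr_eq0 => /eqP //.
- have /eqP := I2 n.+1; rewrite IH1 mulr0 mulf_eq0 pnatr_eq0 => /eqP //.
Qed.

Lemma semic_int_gt0 : 0 < semic_int 1.
Proof.
have mI : measurable (`[(- a), a]%classic : set borel) by exact: measurable_itv.
have i0 : leb.-integrable setT (fun x : borel => (semic x)%:E).
  by have := semic_integrable 1; under eq_fun do rewrite hornerC mulr1.
rewrite /semic_int; under eq_Rintegral do rewrite hornerC mulr1.
rewrite /Rintegral -lte_fin fineK ?integrable_fin_num//.
(* On [-a, a] the weight is at least a, because 4a^2 - x^2 >= 3a^2 there. *)
apply: (@lt_le_trans _ _ (\int[leb]_(x in `[(- a)%R, a]) (a%:E))%E).
  have lI : leb (`[(- a), a]%classic : set borel) = (2 * a)%:E.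
    have : - a < a by move: a_gt0; lra.
    rewrite lebesgue_measure_itv/= lte_fin => ->.
    by rewrite -EFinD; congr EFin; ring.
  rewrite integral_cst//= -[X in (a%:E * X)%E]/(leb (`[(- a), a]%classic : set borel)) lI.
  by rewrite -EFinM lte_fin !mulr_gt0.
apply: (@le_trans _ _ (\int[leb]_(x in `[(- a)%R, a]) (semic x)%:E)%E).
  apply: ge0_le_integral => //.
  - by move=> x _; rewrite lee_fin ltW.
  - by apply: measurable_funS (measurable_int _ i0).
  - move=> x; rewrite /= in_itv/= -ler_norml lee_fin => xa.
    rewrite -(@ler_pXn2r _ 2)// ?nnegrE ?semic_ge0 ?(ltW a_gt0)//.
    rewrite semic_sq; last by apply: le_trans xa _; move: a_gt0; lra.
    rewrite -(real_normK (num_real x)).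
    have : `|x| ^+ 2 <= a ^+ 2 by rewrite lerXn2r// ?nnegrE// ltW.
    have := sqr_ge0 a; lra.
apply: ge0_subset_integral => //; first exact: (measurable_int _ i0).
by move=> x _; rewrite lee_fin semic_ge0.
Qed.

(** Multiplication by x is symmetric for the weight, so [step] moves one unit of index from the
    first factor to the second. Everything reduces to integrals of a single [chebU]. *)
Lemma chebU_orth n m : semic_int (chebU n * chebU m) = (n == m)%:R * semic_int 1.
Proof.
have a0 : a != 0 by rewrite gt_eqF.
have b0 m' : semic_int (chebU 0 * chebU m') = (0%N == m')%:R * semic_int 1.
  by case: m' => [|m']; rewrite mul1r ?mul1r// semic_int_chebU mul0r.
(* [X m] is the polynomial of index m - 1, with the convention that index -1 gives 0; it makes the
   three-term recurrence uniform in m. *)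
pose X m' : {poly R} := if m' is k.+1 then chebU k else 0.
have XE m' : 'X * chebU m' = a *: (chebU m'.+1 + X m').
  by case: m' => [|k]; rewrite ?mulX_chebU0 ?mulX_chebUS//= addr0.
suff : forall m, semic_int (chebU n * chebU m) = (n == m)%:R * semic_int 1 /\
   semic_int (chebU n.+1 * chebU m) = (n.+1 == m)%:R * semic_int 1.
  by move=> /(_ m) [].
have bX k p : semic_int (X k * p) = if k is j.+1 then semic_int (chebU j * p) else 0.
  by case: k => [|k]//=; rewrite mul0r -(scale0r 0) semic_intZ mul0r.
have step k l : semic_int (chebU k.+1 * chebU l) = semic_int (chebU k * chebU l.+1)
    + semic_int (X l * chebU k) - semic_int (X k * chebU l).
  have : semic_int ('X * chebU k * chebU l) = semic_int ('X * chebU l * chebU k).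
    by congr semic_int; ring.
  rewrite !XE -!scalerAl !semic_intZ => /(mulfI a0).
  rewrite !mulrDl !semic_intD (mulrC (chebU l.+1)) => h.
  by rewrite -h addrK.
elim: n => [|n IH] k.
  split=> //; rewrite step b0 !bX subr0.
  case: k => [|k]; first by rewrite addr0 mul0r.
  by rewrite (mulrC (chebU k)) b0 mul0r add0r eqSS.
split; first by have [] := IH k.
rewrite step !bX (IH k.+1).2 (IH k).1; case: k => [|k].
  by rewrite eqSS; case: eqP => _; rewrite ?mul1r ?mul0r addr0 ?subrr.
rewrite (mulrC (chebU k)) (IH k).2 !eqSS; ring.
Qed.

Definition chebphi n (x : R) : R :=
  Num.sqrt (semic x / semic_int 1) * (chebU n).[x].

Let D : set borel := `](- (2 * a)), (2 * a)[%classic.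

Lemma chebphi_out n x : ~ D x -> chebphi n x = 0.
Proof.
rewrite /D /= itv_abs => /negP; rewrite -leNgt => xa.
by rewrite /chebphi semic_out// mul0r sqrtr0 mul0r.
Qed.

Lemma chebphiM n m x : chebphi n x * chebphi m x =
  semic x * ((semic_int 1)^-1 *: (chebU n * chebU m)).[x].
Proof.
rewrite /chebphi mulrACA -expr2 sqr_sqrtr.
  by rewrite hornerZ hornerM !mulrA.
by rewrite divr_ge0 ?semic_ge0// ltW// semic_int_gt0.
Qed.

Lemma chebphi0_gt0 x : D x -> 0 < chebphi 0 x.
Proof.
rewrite /D /= itv_abs => /semic_gt0 xa; rewrite /chebphi hornerC mulr1 sqrtr_gt0.
by rewrite divr_gt0// semic_int_gt0.
Qed.

Lemma chebphiE n x : chebphi n x = chebphi 0 x * (chebU n).[x].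
Proof. by rewrite /chebphi hornerC mulr1. Qed.

Lemma chebphi_measurable n : measurable_fun [set: borel] (chebphi n : borel -> borel).
Proof.
apply: continuous_measurable_fun => x; apply: cvgM; last exact: continuous_horner.
apply: (@continuous_comp _ _ _ (fun y => semic y / semic_int 1)).
  by apply: cvgM; [exact: semic_continuous|exact: cvg_cst].
exact: sqrt_continuous.
Qed.

Lemma chebphi_L2 n : L2on leb D (chebphi n).
Proof.
split; last exact: chebphi_out.
split; first exact: chebphi_measurable.
by under eq_fun do rewrite expr2 chebphiM; exact: semic_integrable.
Qed.

Lemma chebphi_orth n m : ipr leb (chebphi n) (chebphi m) = (n == m)%:R.
Proof.
rewrite /ipr; under eq_Rintegral do rewrite chebphiM.
rewrite -/(semic_int _) semic_intZ chebU_orth mulrCA mulVf ?mulr1//.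
by rewrite gt_eqF// semic_int_gt0.
Qed.

Lemma mulX_chebphi0 x : x * chebphi 0 x = a * chebphi 1 x.
Proof.
have a0 : a != 0 by rewrite gt_eqF.
by rewrite /chebphi /= hornerZ hornerX hornerC mulr1; field.
Qed.

Lemma mulX_chebphiS n x :
  x * chebphi n.+1 x = a * (chebphi n.+2 x + chebphi n x).
Proof.
rewrite (chebphiE n.+1) (chebphiE n.+2) (chebphiE n) -mulrDr mulrCA [RHS]mulrCA.
congr (_ * _); have := congr1 (horner^~ x) (mulX_chebUS n).
by rewrite hornerM hornerZ hornerD hornerX.
Qed.

(** Orthogonality makes all moments of k = f phi_0 vanish. The positive and negative parts of k are
    then densities of two finite measures with equal moments and support in the band, so they agree;
    finally phi_0 > 0 on D. *)
Lemma chebphi_total (f : borel -> R) : L2on leb D f ->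
  (forall n, ipr leb f (chebphi n) = 0) -> ae_eq leb setT f (fun=> 0).
Proof.
move=> [hf f0] f_orth; pose k x := f x * chebphi 0 x.
have hphi n : L2 leb (chebphi n) by case: (chebphi_L2 n).
have k_int : leb.-integrable setT (EFin \o k).
  exact: L2_mul_integrable hf (hphi 0%N).
have k0 x : ~ D x -> k x = 0 by move=> Dx; rewrite /k f0// mul0r.
have mk := measurable_int _ k_int.
have k_L2 (h : borel -> R) : measurable_fun setT h ->
    (forall x, `|h x| <= `|k x|) -> leb.-integrable setT (EFin \o h) /\
    forall p : {poly R}, leb.-integrable setT (fun x => (p.[x] * h x)%:E).
  move=> mh hk; have hi : leb.-integrable setT (EFin \o h).
    by apply: le_integrable k_int => //; [exact/measurable_EFinP|move=> x _; exact: hk].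
  split=> // p.
  have [K Kp] : exists K : R, forall x, D x -> `|p.[x]| <= K.
    exists (\sum_(i < size p) `|p`_i| * (2 * a) ^+ i) => x.
    rewrite /D /= itv_abs => xa; rewrite horner_coef.
    apply: le_trans (ler_norm_sum _ _ _) _; apply: ler_sum => i _.
    rewrite normrM normrX ler_wpM2l//.
    by apply: lerXn2r; rewrite ?nnegrE ?mulr_ge0 ?(ltW a_gt0) ?(ltW xa).
  apply: (@le_integrable _ _ _ leb setT _ _ (fun x => K%:E * (h x)%:E)%E) => //.
  - apply/measurable_EFinP; apply: measurable_funM => //.
    by apply: continuous_measurable_fun; exact: continuous_horner.
  - move=> x _; rewrite -EFinM lee_fin !normrM.
    have [Dx|Dx] := pselect (D x).
      by rewrite ler_wpM2r// (le_trans (Kp x Dx))// ler_norm.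
    have -> : h x = 0 by apply/eqP; rewrite -normr_le0 (le_trans (hk x))// k0// normr0.
    by rewrite normr0 !mulr0.
  - exact: integrableZl.
have mk' : measurable_fun setT k by exact/measurable_EFinP.
have kp_int p : leb.-integrable setT (fun x => (p.[x] * k x)%:E) by apply: (k_L2 k mk' _).2.
pose Lk (p : {poly R}) := Rintegral leb setT (fun x : borel => p.[x] * k x).
have LkD p p' : Lk (p + p') = Lk p + Lk p'.
  rewrite /Lk -RintegralD//; try exact: kp_int.
  by apply: eq_Rintegral => x _; rewrite hornerD mulrDl.
have LkZ c p : Lk (c *: p) = c * Lk p.
  rewrite /Lk -RintegralZl//; last exact: kp_int.
  by apply: eq_Rintegral => x _; rewrite hornerZ -mulrA.
(* A power of x is traded for neighbouring Chebyshev indices, which is why the induction on n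
   quantifies over all m. *)
have kX n m : Lk ('X^n * chebU m) = 0.
  elim: n m => [|n IH] m.
    rewrite -[RHS](f_orth m); apply: eq_Rintegral => x _.
    by rewrite mul1r /k mulrCA [chebphi m x]chebphiE; ring.
  rewrite exprSr -mulrA; case: m => [|m].
    by rewrite mulX_chebU0 -scalerAr LkZ IH mulr0.
  by rewrite mulX_chebUS -scalerAr LkZ mulrDr LkD !IH addr0 mulr0.
pose kp x := Num.max (k x) 0; pose kn x := Num.max (- k x) 0.
have kp0 x : 0 <= kp x by rewrite le_max lexx orbT.
have kn0 x : 0 <= kn x by rewrite le_max lexx orbT.
have mkp : measurable_fun setT kp by exact: measurable_maxr.
have mkn : measurable_fun setT kn by apply: measurable_maxr => //; exact: measurableT_comp.
have kpk x : `|kp x| <= `|k x|.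
  by rewrite (ger0_norm (kp0 x)) ge_max ler_norm normr_ge0.
have knk x : `|kn x| <= `|k x|.
  by rewrite (ger0_norm (kn0 x)) ge_max -normrN ler_norm normr_ge0.
have [ikp ikpX] := k_L2 kp mkp kpk; have [ikn iknX] := k_L2 kn mkn knk.
have kE x : k x = kp x - kn x.
  rewrite /kp /kn; have [?|?] := leP (k x) 0.
    by rewrite max_l ?oppr_ge0// sub0r opprK.
  by rewrite max_r ?subr0// oppr_le0 ltW.
have mom (h : borel -> R) (h0 : forall x, 0 <= h x)
   (ih : leb.-integrable setT (EFin \o h)) :
   (forall p : {poly R}, leb.-integrable setT (fun x => (p.[x] * h x)%:E)) ->
   has_moments (density h0 ih) /\ forall n : nat,
     Rintegral (density h0 ih) setT (fun x : borel => x ^+ n) =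
     Rintegral leb setT (fun x : borel => x ^+ n * h x).
  move=> hp.
  have mX n : measurable_fun [set: borel] (fun x : borel => (x ^+ n)%:E).
    by apply/measurable_EFinP; exact: measurable_funX.
  have hX n : leb.-integrable setT (fun x : borel => (x ^+ n)%:E * (h x)%:E)%E.
    by have := hp 'X^n; under eq_fun do rewrite hornerXn EFinM.
  split=> n; first exact: integrable_density.
  rewrite /Rintegral integral_density//.
have [momp momp'] := mom kp kp0 ikp ikpX; have [momn momn'] := mom kn kn0 ikn iknX.
have eqm : forall A : set borel, measurable A ->
    density kp0 ikp A = density kn0 ikn A.
  move=> A mA; apply: (@moment_unique _ _ _ momp momn _ (2 * a)) => //.
  - move=> n; rewrite momp' momn'; apply/eqP; rewrite -subr_eq0 -RintegralB//.
    + have := kX n 0%N; rewrite mulr1 /Lk => h; rewrite -[X in _ == X]h; apply/eqP.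
      by apply: eq_Rintegral => x _; rewrite hornerXn kE mulrBr.
    + by have := ikpX 'X^n; under eq_fun do rewrite hornerXn.
    + by have := iknX 'X^n; under eq_fun do rewrite hornerXn.
  - by rewrite mulr_gt0.
  - apply: integral0_eq => x /= xa; congr EFin; apply/eqP.
    rewrite -normr_le0 (le_trans (knk x))// k0 ?normr0//.
    by rewrite /D /= itv_abs => /(lt_trans xa); rewrite ltxx.
have : ae_eq leb setT (EFin \o kp) (EFin \o kn).
  apply: integral_ae_eq => //; first exact/measurable_EFinP.
  by move=> E _ mE; exact: eqm.
apply: filterS => x /(_ Logic.I) /= [] kpn _.
have [Dx|Dx] := pselect (D x); last by rewrite f0.
have : k x = 0 by rewrite kE kpn subrr.
move/eqP; rewrite /k mulf_eq0 => /orP[/eqP//|].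
by rewrite gt_eqF// chebphi0_gt0.
Qed.

End ChebyshevBasis.

(** * Vector-valued complex L2 functions *)

Lemma sqmod_eq0 (R : realType) (z : R[i]) : (sqmod z == 0) = (z == 0).
Proof. by rewrite /sqmod paddr_eq0 ?sqr_ge0// !sqrf_eq0 eq_complex. Qed.

Lemma sqmod_le0 (R : realType) (z : R[i]) : sqmod z <= 0 -> z = 0.
Proof. by move=> z0; apply/eqP; rewrite -sqmod_eq0 eq_le z0 sqmod_ge0. Qed.

Section ComplexMeasurable.
Context d (T : measurableType d) (R : realType).
Implicit Types (f g : T -> R[i]).

Definition cmeas f : Prop :=
  measurable_fun setT (fun x => complex.Re (f x)) /\
  measurable_fun setT (fun x => complex.Im (f x)).

Lemma cmeas_cst z : cmeas (fun=> z).
Proof. by split; exact: measurable_cst. Qed.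

Lemma cmeas_real (f : T -> R) : measurable_fun setT f -> cmeas (fun x => (f x)%:C).
Proof. by move=> mf; split=> //=; exact: measurable_cst. Qed.

Lemma cmeasD f g : cmeas f -> cmeas g -> cmeas (fun x => f x + g x).
Proof.
move=> [f1 f2] [g1 g2]; split.
  rewrite (_ : (fun x => _) = (fun x => complex.Re (f x) + complex.Re (g x))).
    exact: measurable_funD.
  by apply/funext => x; case: (f x) (g x) => [? ?] [? ?].
rewrite (_ : (fun x => _) = (fun x => complex.Im (f x) + complex.Im (g x))).
  exact: measurable_funD.
by apply/funext => x; case: (f x) (g x) => [? ?] [? ?].
Qed.

Lemma cmeasM f g : cmeas f -> cmeas g -> cmeas (fun x => f x * g x).
Proof.
move=> [f1 f2] [g1 g2]; split.
  rewrite (_ : (fun x => _) = (fun x => complex.Re (f x) * complex.Re (g x) -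
     complex.Im (f x) * complex.Im (g x))).
    by apply: measurable_funB; exact: measurable_funM.
  by apply/funext => x; case: (f x) (g x) => [? ?] [? ?].
rewrite (_ : (fun x => _) = (fun x => complex.Re (f x) * complex.Im (g x) +
   complex.Im (f x) * complex.Re (g x))).
  by apply: measurable_funD; exact: measurable_funM.
by apply/funext => x; case: (f x) (g x) => [? ?] [? ?].
Qed.

Lemma cmeas_conj f : cmeas f -> cmeas (fun x => (f x)^*%C).
Proof.
move=> [f1 f2]; split.
  rewrite (_ : (fun x => _) = (fun x => complex.Re (f x)))//.
  by apply/funext => x; case: (f x).
rewrite (_ : (fun x => _) = (fun x => - complex.Im (f x))).
  exact: measurableT_comp.
by apply/funext => x; case: (f x).
Qed.

Lemma sqmod_measurable f : cmeas f -> measurable_fun setT (fun x => sqmod (f x)).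
Proof. by move=> [f1 f2]; apply: measurable_funD; exact: measurable_funX. Qed.

Lemma cmeasV f : cmeas f -> cmeas (fun x => (f x)^-1).
Proof.
move=> hf; have [f1 f2] := hf.
have mi : measurable_fun setT (fun x => (sqmod (f x))^-1).
  rewrite (_ : (fun x => _) = (fun x => sqmod (f x) `^ (-1))).
    by apply: (measurableT_comp (measurable_powR _)); exact: sqmod_measurable.
  by apply/funext => x; rewrite powR_inv1// sqmod_ge0.
split.
  rewrite (_ : (fun x => _) = (fun x => complex.Re (f x) * (sqmod (f x))^-1)).
    exact: measurable_funM.
  by apply/funext => x; case: (f x).
rewrite (_ : (fun x => _) = (fun x => - (complex.Im (f x) * (sqmod (f x))^-1))).
  by apply: measurableT_comp => //; exact: measurable_funM.
by apply/funext => x; case: (f x).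
Qed.

End ComplexMeasurable.

Section FunctionAlgebra.
Context (T : Type) (R : realType) (P : (T -> R[i]) -> Prop).
Hypothesis P_cst : forall z, P (fun=> z).
Hypothesis P_add : forall f g, P f -> P g -> P (fun x => f x + g x).
Hypothesis P_mul : forall f g, P f -> P g -> P (fun x => f x * g x).

(** Closure under matrix operations, determinants and adjugates is proved once for any algebra P of
    functions containing the constants; it serves both measurable functions and functions that are
    moreover bounded on D. *)
Definition entrywise m n (M : T -> 'M[R[i]]_(m, n)) : Prop :=
  forall i j, P (fun x => M x i j).

Lemma alg_opp f : P f -> P (fun x => - f x).
Proof. by move=> /(P_mul (P_cst (-1))); under eq_fun do rewrite mulN1r. Qed.

Lemma alg_sum (I : Type) (s : seq I) (Q : pred I) (F : I -> T -> R[i]) :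
  (forall i, P (F i)) -> P (fun x => \sum_(i <- s | Q i) F i x).
Proof.
move=> hF; elim: s => [|i s IH].
  by under eq_fun do rewrite big_nil; exact: P_cst.
by under eq_fun do rewrite big_cons; case: (Q i) => //; exact: P_add.
Qed.

Lemma alg_prod (I : Type) (s : seq I) (Q : pred I) (F : I -> T -> R[i]) :
  (forall i, P (F i)) -> P (fun x => \prod_(i <- s | Q i) F i x).
Proof.
move=> hF; elim: s => [|i s IH].
  by under eq_fun do rewrite big_nil; exact: P_cst.
by under eq_fun do rewrite big_cons; case: (Q i) => //; exact: P_mul.
Qed.

Lemma entrywise_cst m n (A : 'M[R[i]]_(m, n)) : entrywise (fun=> A).
Proof. by move=> i j; exact: P_cst. Qed.

Lemma entrywiseD m n (M N : T -> 'M[R[i]]_(m, n)) : entrywise M -> entrywise N ->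
  entrywise (fun x => M x + N x).
Proof. by move=> hM hN i j; under eq_fun do rewrite mxE; exact: P_add. Qed.

Lemma entrywiseN m n (M : T -> 'M[R[i]]_(m, n)) : entrywise M ->
  entrywise (fun x => - M x).
Proof. by move=> hM i j; under eq_fun do rewrite mxE; exact: alg_opp. Qed.

Lemma entrywiseZ m n f (M : T -> 'M[R[i]]_(m, n)) : P f -> entrywise M ->
  entrywise (fun x => f x *: M x).
Proof. by move=> hf hM i j; under eq_fun do rewrite mxE; exact: P_mul. Qed.

Lemma entrywiseM m n p (M : T -> 'M[R[i]]_(m, n)) (N : T -> 'M[R[i]]_(n, p)) :
  entrywise M -> entrywise N -> entrywise (fun x => M x *m N x).
Proof.
move=> hM hN i j; under eq_fun do rewrite mxE.
by apply: alg_sum => k; exact: P_mul.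
Qed.

Lemma alg_det n (M : T -> 'M[R[i]]_n) : entrywise M -> P (fun x => \det (M x)).
Proof.
move=> hM; rewrite /determinant; apply: alg_sum => s; apply: P_mul.
  exact: P_cst.
exact: alg_prod.
Qed.

Lemma entrywise_adj n (M : T -> 'M[R[i]]_n) : entrywise M ->
  entrywise (fun x => \adj (M x)).
Proof.
move=> hM i j; under eq_fun do rewrite mxE.
apply: P_mul; first exact: P_cst.
by apply: alg_det => k l; under eq_fun do rewrite !mxE; exact: hM.
Qed.
End FunctionAlgebra.

Section BoundedMeasurable.
Context d (T : measurableType d) (R : realType) (D : set T).
Implicit Types (f g : T -> R[i]).

(** The bound is asked on D only: the coefficients of the transform are polynomials in x, bounded on
    the band but not on the line. *)
Definition bmeas f : Prop :=
  cmeas f /\ exists K, forall x, D x -> sqmod (f x) <= K.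

Lemma bmeas_cst z : bmeas (fun=> z).
Proof. by split; [exact: cmeas_cst|exists (sqmod z)]. Qed.

Lemma bmeasD f g : bmeas f -> bmeas g -> bmeas (fun x => f x + g x).
Proof.
move=> [mf [K hK]] [mg [L hL]]; split; first exact: cmeasD.
exists (2 * K + 2 * L) => x Dx; apply: le_trans (sqmodD_le _ _) _.
by apply: lerD; rewrite ler_wpM2l ?hK ?hL.
Qed.

Lemma bmeasM f g : bmeas f -> bmeas g -> bmeas (fun x => f x * g x).
Proof.
move=> [mf [K hK]] [mg [L hL]]; split; first exact: cmeasM.
exists (K * L) => x Dx; rewrite sqmodM.
by apply: ler_pM; rewrite ?sqmod_ge0 ?hK ?hL.
Qed.

Lemma sqmod_conj (z : R[i]) : sqmod (z^*%C) = sqmod z.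
Proof. by case: z => x y; rewrite /sqmod /= sqrrN. Qed.

Lemma bmeas_conj f : bmeas f -> bmeas (fun x => (f x)^*%C).
Proof.
move=> [mf [K hK]]; split; first exact: cmeas_conj.
by exists K => x Dx; rewrite sqmod_conj hK.
Qed.

Lemma bmeas_adjoint m n (M : T -> 'M[R[i]]_(m, n)) : entrywise bmeas M ->
  entrywise bmeas (fun x => (M x)^t*).
Proof. by move=> hM i j; under eq_fun do rewrite !mxE; exact: bmeas_conj. Qed.
End BoundedMeasurable.

Section ComplexL2.
Context d (T : measurableType d) (R : realType).
Context (mu : {measure set T -> \bar R}) (D : set T).
Implicit Types (f g : T -> R[i]).

Definition CL2 f : Prop :=
  L2on mu D (fun x => complex.Re (f x)) /\ L2on mu D (fun x => complex.Im (f x)).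

Lemma CL2_cmeas f : CL2 f -> cmeas f.
Proof. by move=> [[[? _] _] [[? _] _]]. Qed.

Lemma CL2_out f x : CL2 f -> ~ D x -> f x = 0.
Proof.
by case=> -[_ h1] [_ h2] Dx; apply/eqP; rewrite eq_complex/= h1// h2// eqxx.
Qed.

Lemma CL2_sqmod f : CL2 f <-> [/\ cmeas f,
  mu.-integrable setT (fun x => (sqmod (f x))%:E) & forall x, ~ D x -> f x = 0].
Proof.
split=> [hf|[mf fi f0]].
  split; [exact: CL2_cmeas|case: hf => -[[_ h1] _] [[_ h2] _]|].
    by rewrite /sqmod; under eq_fun do rewrite EFinD; exact: integrableD.
  by move=> x; exact: CL2_out.
have [f1 f2] := mf.
split; split; try by move=> x Dx; rewrite f0.
  split=> //; apply: le_integrable fi => //.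
    by apply/measurable_EFinP; exact: measurable_funX.
  move=> x _; rewrite lee_fin !ger0_norm ?sqr_ge0 ?sqmod_ge0//.
  by rewrite /sqmod lerDl sqr_ge0.
split=> //; apply: le_integrable fi => //.
  by apply/measurable_EFinP; exact: measurable_funX.
move=> x _; rewrite lee_fin !ger0_norm ?sqr_ge0 ?sqmod_ge0//.
by rewrite /sqmod lerDr sqr_ge0.
Qed.

Lemma CL2_add f g : CL2 f -> CL2 g -> CL2 (fun x => f x + g x).
Proof.
move=> /CL2_sqmod[mf fi f0] /CL2_sqmod[mg gi g0]; apply/CL2_sqmod; split.
- exact: cmeasD.
- apply: (@le_integrable _ _ _ mu setT _ _
      (fun x => 2%:E * (sqmod (f x))%:E + 2%:E * (sqmod (g x))%:E)%E) => //.
  + by apply/measurable_EFinP; apply: sqmod_measurable; exact: cmeasD.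
  + move=> x _; rewrite -!EFinM -EFinD lee_fin !ger0_norm ?sqmod_ge0 ?sqmodD_le//.
    by rewrite addr_ge0// mulr_ge0// sqmod_ge0.
  + by apply: integrableD => //; exact: integrableZl.
- by move=> x Dx; rewrite f0// g0// addr0.
Qed.

Lemma CL2_bmul g f : bmeas D g -> CL2 f -> CL2 (fun x => g x * f x).
Proof.
move=> [mg [K hK]] /CL2_sqmod[mf fi f0]; apply/CL2_sqmod; split.
- exact: cmeasM.
- apply: (@le_integrable _ _ _ mu setT _ _ (fun x => K%:E * (sqmod (f x))%:E)%E) => //.
  + by apply/measurable_EFinP; apply: sqmod_measurable; exact: cmeasM.
  + move=> x _; rewrite -EFinM lee_fin ger0_norm ?sqmod_ge0// sqmodM.
    apply: le_trans (ler_norm _).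
    have [Dx|Dx] := pselect (D x); first by rewrite ler_wpM2r ?sqmod_ge0 ?hK.
    by rewrite f0// /sqmod /= !expr0n addr0 !mulr0.
  + exact: integrableZl.
- by move=> x Dx; rewrite f0// mulr0.
Qed.

Lemma CL2_scale z f : CL2 f -> CL2 (fun x => z * f x).
Proof. by apply: CL2_bmul; exact: bmeas_cst. Qed.

Lemma CL2_0 : CL2 (fun=> 0).
Proof. by split; split=> //=; exact: L2_0. Qed.

Definition cintegrable f : Prop :=
  mu.-integrable setT (fun x => (complex.Re (f x))%:E) /\
  mu.-integrable setT (fun x => (complex.Im (f x))%:E).

Definition cint f : R[i] :=
  Rintegral mu setT (fun x => complex.Re (f x)) +i*
  Rintegral mu setT (fun x => complex.Im (f x)).

Lemma cint0 : cint (fun=> 0) = 0.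
Proof. by rewrite /cint /= Rintegral_cst// mul0r. Qed.

Lemma cintegrable0 : cintegrable (fun=> 0).
Proof. by split; exact: integrable0. Qed.

Lemma cintegrableD f g : cintegrable f -> cintegrable g ->
  cintegrable (fun x => f x + g x).
Proof.
move=> [f1 f2] [g1 g2]; split.
  apply: (@eq_integrable _ _ _ mu setT _ (fun x => (complex.Re (f x))%:E + (complex.Re (g x))%:E)%E) => //.
    by move=> x _; case: (f x) (g x) => ? ? [? ?].
  exact: integrableD.
apply: (@eq_integrable _ _ _ mu setT _ (fun x => (complex.Im (f x))%:E + (complex.Im (g x))%:E)%E) => //.
  by move=> x _; case: (f x) (g x) => ? ? [? ?].
exact: integrableD.
Qed.

Lemma cintD f g : cintegrable f -> cintegrable g ->
  cint (fun x => f x + g x) = cint f + cint g.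
Proof.
move=> [f1 f2] [g1 g2]; apply/eqP; rewrite eq_complex /=; apply/andP; split; apply/eqP.
  rewrite -RintegralD//; apply: eq_Rintegral => x _.
  by case: (f x) (g x) => ? ? [? ?].
rewrite -RintegralD//; apply: eq_Rintegral => x _.
by case: (f x) (g x) => ? ? [? ?].
Qed.

Lemma cintegrableZ z f : cintegrable f -> cintegrable (fun x => z * f x).
Proof.
case: z => p q [f1 f2]; split.
  apply: (@eq_integrable _ _ _ mu setT _ (fun x => p%:E * (complex.Re (f x))%:E - q%:E * (complex.Im (f x))%:E)%E) => //.
    by move=> x _; case: (f x) => ? ?.
  by apply: integrableB => //; exact: integrableZl.
apply: (@eq_integrable _ _ _ mu setT _ (fun x => p%:E * (complex.Im (f x))%:E + q%:E * (complex.Re (f x))%:E)%E) => //.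
  by move=> x _; case: (f x) => ? ?.
by apply: integrableD => //; exact: integrableZl.
Qed.

Let integrableZr (p : R) (h : T -> R) : mu.-integrable setT (EFin \o h) ->
  mu.-integrable setT (EFin \o (fun x => p * h x)).
Proof. by move=> hi; rewrite /comp; under eq_fun do rewrite EFinM; exact: integrableZl. Qed.

Lemma cintZ z f : cintegrable f -> cint (fun x => z * f x) = z * cint f.
Proof.
case: z => p q [f1 f2]; apply/eqP; rewrite eq_complex /=; apply/andP; split; apply/eqP.
  rewrite -!RintegralZl// -RintegralB//; try exact: integrableZr.
  by apply: eq_Rintegral => x _; case: (f x) => ? ?.
rewrite -!RintegralZl// -RintegralD//; try exact: integrableZr.
by apply: eq_Rintegral => x _; case: (f x) => ? ?.
Qed.

Lemma cintegrable_sum (I : Type) (s : seq I) (F : I -> T -> R[i]) :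
  (forall i, cintegrable (F i)) -> cintegrable (fun x => \sum_(i <- s) F i x).
Proof.
move=> hF; elim: s => [|i s IH].
  by under eq_fun do rewrite big_nil; exact: cintegrable0.
by under eq_fun do rewrite big_cons; exact: cintegrableD.
Qed.

Lemma cint_sum (I : Type) (s : seq I) (F : I -> T -> R[i]) :
  (forall i, cintegrable (F i)) ->
  cint (fun x => \sum_(i <- s) F i x) = \sum_(i <- s) cint (F i).
Proof.
move=> hF; elim: s => [|i s IH].
  by rewrite big_nil; under eq_fun do rewrite big_nil; exact: cint0.
rewrite big_cons -IH -cintD//; last exact: cintegrable_sum.
by under eq_fun do rewrite big_cons.
Qed.

Lemma cint_conj f : cintegrable f -> cint (fun x => (f x)^*%C) = (cint f)^*%C.
Proof.
move=> [f1 f2]; apply/eqP; rewrite eq_complex /=; apply/andP; split; apply/eqP.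
  by apply: eq_Rintegral => x _; case: (f x).
rewrite -[RHS]mulN1r -RintegralZl//; apply: eq_Rintegral => x _.
by case: (f x) => ? ?; rewrite mulN1r.
Qed.

Lemma CL2_cintegrable f g : CL2 f -> CL2 g -> cintegrable (fun x => f x * (g x)^*%C).
Proof.
move=> [[f1 _] [f2 _]] [[g1 _] [g2 _]]; split.
  apply: (@eq_integrable _ _ _ mu setT _ (fun x => (complex.Re (f x) * complex.Re (g x))%:E
     + (complex.Im (f x) * complex.Im (g x))%:E)%E) => //.
    by move=> x _; case: (f x) (g x) => ? ? [? ?] /=; rewrite mulrN opprK.
  by apply: integrableD => //; exact: L2_mul_integrable.
apply: (@eq_integrable _ _ _ mu setT _ (fun x => (complex.Im (f x) * complex.Re (g x))%:E
     - (complex.Re (f x) * complex.Im (g x))%:E)%E) => //.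
  by move=> x _; case: (f x) (g x) => ? ? [? ?] /=; rewrite mulrN -EFinB addrC.
by apply: integrableB => //; exact: L2_mul_integrable.
Qed.

Lemma cint_mul_conj f g : CL2 f -> CL2 g -> cint (fun x => f x * (g x)^*%C) =
  (ipr mu (fun x => complex.Re (f x)) (fun x => complex.Re (g x)) +
   ipr mu (fun x => complex.Im (f x)) (fun x => complex.Im (g x))) +i*
  (ipr mu (fun x => complex.Im (f x)) (fun x => complex.Re (g x)) -
   ipr mu (fun x => complex.Re (f x)) (fun x => complex.Im (g x))).
Proof.
move=> [[f1 _] [f2 _]] [[g1 _] [g2 _]]; apply/eqP; rewrite eq_complex /=.
apply/andP; split; apply/eqP.
  rewrite /ipr -RintegralD//; try exact: L2_mul_integrable.
  apply: eq_Rintegral => x _.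
  by case: (f x) (g x) => ? ? [? ?] /=; rewrite mulrN opprK.
rewrite /ipr -RintegralB//; try exact: L2_mul_integrable.
apply: eq_Rintegral => x _.
by case: (f x) (g x) => ? ? [? ?] /=; rewrite mulrN addrC.
Qed.
End ComplexL2.

Section Dot.
Context (R : realType).
Local Notation C := R[i].

Lemma conjc_is (z : C) : z^*%C = Num.conj z. Proof. by []. Qed.

Lemma mul_conjc (z : C) : z * z^*%C = (sqmod z)%:C.
Proof. by case: z => x y; rewrite /sqmod; simpc => /=; congr (_ +i* _); ring. Qed.

Lemma dotDl n (u v w : 'cV[C]_n) : dot (u + v) w = dot u w + dot v w.
Proof. by rewrite /dot -big_split; apply: eq_bigr => i _; rewrite mxE mulrDl. Qed.

Lemma dotZl n z (u w : 'cV[C]_n) : dot (z *: u) w = z * dot u w.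
Proof. by rewrite /dot mulr_sumr; apply: eq_bigr => i _; rewrite mxE mulrA. Qed.

Lemma dot_conj n (u w : 'cV[C]_n) : dot w u = (dot u w)^*%C.
Proof.
rewrite /dot (conjc_is (\sum_i _)) rmorph_sum; apply: eq_bigr => i _.
by rewrite rmorphM/= -conjc_is -!conjc_is conjcK mulrC.
Qed.

Lemma dot_self n (u : 'cV[C]_n) : dot u u = (\sum_i sqmod (u i 0))%:C.
Proof.
rewrite /dot (rmorph_sum (@real_complex R)); apply: eq_bigr => i _.
exact: mul_conjc.
Qed.

Lemma dot_mulmx m n (A : 'M[C]_(m, n)) u v : dot (A *m u) v = dot u (A ^t* *m v).
Proof.
rewrite /dot; under eq_bigr do rewrite mxE mulr_suml.
under [in RHS]eq_bigr do rewrite mxE (conjc_is (\sum_i _)) rmorph_sum mulr_sumr.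
rewrite exchange_big; apply: eq_bigr => j _; apply: eq_bigr => i _.
by rewrite !mxE rmorphM/= -!conjc_is conjcK mulrCA mulrA.
Qed.
End Dot.

(** * Vector-valued functions and their coefficient sequences *)

Section VectorL2.
Context d (T : measurableType d) (R : realType).
Context (mu : {measure set T -> \bar R}) (D : set T) (phi : nat -> T -> R).
Hypothesis phi_L2 : forall n, L2on mu D (phi n).
Hypothesis phi_orth : forall n m, ipr mu (phi n) (phi m) = (n == m)%:R.
Hypothesis phi_total : forall f, L2on mu D f -> (forall n, ipr mu f (phi n) = 0) ->
  ae_eq mu setT f (fun=> 0).

(** Polarization of Parseval's identity, applied to f + g, f and g. *)
Lemma cvg_ipr f g : L2on mu D f -> L2on mu D g ->
  series (fun n => ipr mu f (phi n) * ipr mu g (phi n)) @ \oo --> ipr mu f g.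
Proof.
move=> hf hg.
have cv h : L2on mu D h ->
    series (fun n => ipr mu h (phi n) ^+ 2) @ \oo --> ipr mu h h.
  move=> hh; have := parseval phi_L2 phi_orth phi_total hh.
  have : cvgn (fun n => \sum_(0 <= k < n) (ipr mu h (phi k) ^+ 2)%:E)%E.
    by apply: is_cvg_nneseries => n _ _; rewrite lee_fin sqr_ge0.
  move=> h1 h2; move: h1; rewrite h2 => /fine_cvgP[_].
  apply: cvg_trans; apply: near_eq_cvg; apply: nearW => n /=.
  by rewrite sumEFin.
have hfg : L2on mu D (fun x => f x + g x).
  have [h1 h2] := hf; have [h3 h4] := hg; split; first exact: L2_add.
  by move=> x Dx; rewrite h2// h4// addr0.
have [lf _] := hf; have [lg _] := hg; have [lfg _] := hfg.
have lp n : L2 mu (phi n) by case: (phi_L2 n).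
have -> : ipr mu f g = 2^-1 * (ipr mu (fun x => f x + g x) (fun x => f x + g x) -
    ipr mu f f - ipr mu g g).
  rewrite iprDl// (iprC mu f (fun x => f x + g x)) (iprC mu g (fun x => f x + g x)) !iprDl//.
  by rewrite (iprC _ g f); field.
rewrite (_ : series _ = (fun N => 2^-1 * (series (fun n =>
    ipr mu (fun x => f x + g x) (phi n) ^+ 2) N -
    series (fun n => ipr mu f (phi n) ^+ 2) N -
    series (fun n => ipr mu g (phi n) ^+ 2) N))).
  apply: cvgM; first exact: cvg_cst.
  by apply: cvgB; [apply: cvgB|]; exact: cv.
apply/funext => N; rewrite /series /= -!sumrB mulr_sumr; apply: eq_bigr => n _.
by rewrite iprDl//; field.
Qed.

Definition L2v k (F : T -> 'cV[R[i]]_k) : Prop :=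
  forall i, CL2 mu D (fun x => F x i 0).

(** The real function [phi n] is conjugated so that a coefficient has the form of an inner product
    and [cint_mul_conj] applies to it. *)
Definition hat k (F : T -> 'cV[R[i]]_k) (n : nat) : 'cV[R[i]]_k :=
  \col_i cint mu (fun x => F x i 0 * ((phi n x)%:C)^*%C).

Lemma CL2_phi n : CL2 mu D (fun x => (phi n x)%:C).
Proof.
split; first exact: phi_L2.
by split; [exact: L2_0|].
Qed.

Lemma L2v_out k (F : T -> 'cV[R[i]]_k) x : L2v F -> ~ D x -> F x = 0.
Proof. by move=> hF Dx; apply/matrixP => i j; rewrite ord1 mxE (CL2_out (hF i)). Qed.

Lemma L2v0 k : L2v (fun=> 0 : 'cV_k).
Proof. by move=> i; under eq_fun do rewrite mxE; exact: CL2_0. Qed.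

Lemma L2vD k (F G : T -> 'cV[R[i]]_k) : L2v F -> L2v G -> L2v (fun x => F x + G x).
Proof. by move=> hF hG i; under eq_fun do rewrite mxE; exact: CL2_add. Qed.

Lemma CL2_sum (I : Type) (s : seq I) (F : I -> T -> R[i]) :
  (forall i, CL2 mu D (F i)) -> CL2 mu D (fun x => \sum_(i <- s) F i x).
Proof.
move=> hF; elim: s => [|i s IH].
  by under eq_fun do rewrite big_nil; exact: CL2_0.
by under eq_fun do rewrite big_cons; exact: CL2_add.
Qed.

Lemma L2v_bmul m k (M : T -> 'M[R[i]]_(m, k)) F : entrywise (bmeas D) M -> L2v F ->
  L2v (fun x => M x *m F x).
Proof.
move=> hM hF i; under eq_fun do rewrite mxE.
by apply: CL2_sum => j; exact: CL2_bmul.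
Qed.

Lemma L2v_bscale k (g : T -> R[i]) (F : T -> 'cV[R[i]]_k) : bmeas D g -> L2v F ->
  L2v (fun x => g x *: F x).
Proof. by move=> hg hF i; under eq_fun do rewrite mxE; exact: CL2_bmul. Qed.

Lemma L2v_mx m k (A : 'M[R[i]]_(m, k)) F : L2v F -> L2v (fun x => A *m F x).
Proof.
by apply: L2v_bmul => i j; exact: bmeas_cst.
Qed.

Lemma L2vZ k z (F : T -> 'cV[R[i]]_k) : L2v F -> L2v (fun x => z *: F x).
Proof. by apply: L2v_bscale; exact: bmeas_cst. Qed.

Lemma L2vB k (F G : T -> 'cV[R[i]]_k) : L2v F -> L2v G -> L2v (fun x => F x - G x).
Proof.
move=> hF hG; have := L2vD hF (L2vZ (-1) hG).
by under eq_fun do rewrite scaleN1r.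
Qed.

Lemma hatD k (F G : T -> 'cV[R[i]]_k) n : L2v F -> L2v G ->
  hat (fun x => F x + G x) n = hat F n + hat G n.
Proof.
move=> hF hG; apply/matrixP => i j; rewrite !mxE -cintD.
- by congr cint; apply/funext => x; rewrite mxE mulrDl.
- exact: CL2_cintegrable (hF i) (CL2_phi n).
- exact: CL2_cintegrable (hG i) (CL2_phi n).
Qed.

Lemma hat_mx m k (A : 'M[R[i]]_(m, k)) F n : L2v F ->
  hat (fun x => A *m F x) n = A *m hat F n.
Proof.
move=> hF; apply/matrixP => i j; rewrite !mxE.
have hj l := CL2_cintegrable (hF l) (CL2_phi n).
transitivity (cint mu (fun x => \sum_l A i l * (F x l 0 * ((phi n x)%:C)^*%C))).
  congr cint; apply/funext => x; rewrite mxE mulr_suml.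
  by apply: eq_bigr => l _; rewrite mulrA.
rewrite cint_sum => [|l]; last exact: cintegrableZ.
by apply: eq_bigr => l _; rewrite cintZ// mxE.
Qed.

Lemma hatZ k z (F : T -> 'cV[R[i]]_k) n : L2v F ->
  hat (fun x => z *: F x) n = z *: hat F n.
Proof.
move=> hF; rewrite -mul_scalar_mx -hat_mx//; congr hat.
by apply/funext => x; rewrite mul_scalar_mx.
Qed.

Lemma hatB k (F G : T -> 'cV[R[i]]_k) n : L2v F -> L2v G ->
  hat (fun x => F x - G x) n = hat F n - hat G n.
Proof.
move=> hF hG; rewrite -[in RHS]scaleN1r -hatZ// -hatD//; last exact: L2vZ.
by congr hat; apply/funext => x; rewrite scaleN1r.
Qed.

Lemma hatE k (F : T -> 'cV[R[i]]_k) n i : L2v F -> hat F n i 0 =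
  ipr mu (fun x => complex.Re (F x i 0)) (phi n) +i*
  ipr mu (fun x => complex.Im (F x i 0)) (phi n).
Proof.
move=> hF; rewrite mxE (cint_mul_conj (hF i) (CL2_phi n)) /=.
have z f : ipr mu f (fun=> 0) = 0.
  by rewrite /ipr; under eq_Rintegral do rewrite mulr0; rewrite Rintegral_cst// mul0r.
by rewrite !z addr0 subr0.
Qed.

Lemma l2_hat k (F : T -> 'cV[R[i]]_k) : L2v F -> l2 (hat F).
Proof.
move=> hF i; have [h1 h2] := hF i.
under eq_eseriesr do rewrite hatE// /sqmod/= EFinD.
rewrite nneseriesD; try by move=> n _ _; rewrite lee_fin sqr_ge0.
by rewrite !(parseval phi_L2 phi_orth phi_total)// -EFinD ltry.
Qed.

Lemma hat_inj k (F G : T -> 'cV[R[i]]_k) : L2v F -> L2v G -> hat F =1 hat G ->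
  {ae mu, forall x, F x = G x}.
Proof.
move=> hF hG FG.
have : forall i : 'I_k, {ae mu, forall x, F x i 0 = G x i 0}.
  move=> i; have [f1 f2] := hF i; have [g1 g2] := hG i.
  have e1 n : ipr mu (fun x => complex.Re (F x i 0)) (phi n) =
      ipr mu (fun x => complex.Re (G x i 0)) (phi n) /\
      ipr mu (fun x => complex.Im (F x i 0)) (phi n) =
      ipr mu (fun x => complex.Im (G x i 0)) (phi n).
    by have := congr1 (fun v : 'cV_k => v i 0) (FG n); rewrite !hatE// => -[].
  have a1 := basis_inj phi_L2 phi_total f1 g1 (fun n => (e1 n).1).
  have a2 := basis_inj phi_L2 phi_total f2 g2 (fun n => (e1 n).2).
  apply: filterS2 a1 a2 => x /(_ Logic.I) h1 /(_ Logic.I) h2.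
  by apply/eqP; rewrite eq_complex h1 h2 !eqxx.
move=> h; have : {ae mu, forall x, forall i, F x i 0 = G x i 0}.
  exact: filter_forall.
by apply: filterS => x hx; apply/matrixP => i j; rewrite ord1.
Qed.

Lemma hat_surj k (g : nat -> 'cV[R[i]]_k) : l2 g ->
  exists2 F, L2v F & hat F =1 g.
Proof.
move=> hg.
have h (i : 'I_k) : exists f : T -> R[i], CL2 mu D f /\ forall n,
   ipr mu (fun x => complex.Re (f x)) (phi n) +i*
   ipr mu (fun x => complex.Im (f x)) (phi n) = g n i 0.
  have le (h : R[i] -> R) : (forall z, h z ^+ 2 <= sqmod z) ->
      (\sum_(0 <= n <oo) (h (g n i 0) ^+ 2)%:E < +oo)%E.
    move=> hz; apply: le_lt_trans (hg i); apply: lee_nneseries => n _.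
      by rewrite lee_fin sqr_ge0.
    by rewrite lee_fin.
  have le1 : forall z : R[i], (@complex.Re R z) ^+ 2 <= sqmod z by move=> z; rewrite lerDl sqr_ge0.
  have le2 : forall z : R[i], (@complex.Im R z) ^+ 2 <= sqmod z by move=> z; rewrite lerDr sqr_ge0.
  have [f1 f1L f1E] := basis_surj phi_L2 phi_orth (le _ le1).
  have [f2 f2L f2E] := basis_surj phi_L2 phi_orth (le _ le2).
  exists (fun x => f1 x +i* f2 x); split; first by split.
  by move=> n; rewrite f1E f2E; case: (g n i 0).
have [f hf] := choice h.
have hL : L2v (fun x => \col_i f i x).
  by move=> i; under eq_fun do rewrite mxE; have [] := hf i.
exists (fun x => \col_i f i x) => // n; apply/matrixP => i j; rewrite ord1 hatE//.
rewrite -(hf i).2; apply/eqP; rewrite eq_complex/=; apply/andP; split;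
  by apply/eqP; congr ipr; apply/funext => x; rewrite mxE.
Qed.

Definition pairing k (F G : T -> 'cV[R[i]]_k) : R[i] :=
  cint mu (fun x => dot (F x) (G x)).

Lemma dot_cintegrable k (F G : T -> 'cV[R[i]]_k) : L2v F -> L2v G ->
  cintegrable mu (fun x => dot (F x) (G x)).
Proof. by move=> hF hG; apply: cintegrable_sum => i; exact: CL2_cintegrable (hF i) (hG i). Qed.

Lemma pairing_conj k (F G : T -> 'cV[R[i]]_k) : L2v F -> L2v G ->
  pairing G F = (pairing F G)^*%C.
Proof.
move=> hF hG; rewrite /pairing -cint_conj; last exact: dot_cintegrable.
by congr cint; apply/funext => x; exact: dot_conj.
Qed.

Lemma pairingDl k (F G H : T -> 'cV[R[i]]_k) : L2v F -> L2v G -> L2v H ->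
  pairing (fun x => F x + G x) H = pairing F H + pairing G H.
Proof.
move=> hF hG hH; rewrite /pairing -cintD; try exact: dot_cintegrable.
by congr cint; apply/funext => x; exact: dotDl.
Qed.

Lemma pairingZl k z (F H : T -> 'cV[R[i]]_k) : L2v F -> L2v H ->
  pairing (fun x => z *: F x) H = z * pairing F H.
Proof.
move=> hF hH; rewrite /pairing -cintZ; last exact: dot_cintegrable.
by congr cint; apply/funext => x; exact: dotZl.
Qed.

Lemma pairing_ae k (F F' G : T -> 'cV[R[i]]_k) : L2v F -> L2v F' -> L2v G ->
  {ae mu, forall x, F x = F' x} -> pairing F G = pairing F' G.
Proof.
move=> hF hF' hG e; have h1 := dot_cintegrable hF hG.
have h2 := dot_cintegrable hF' hG.
apply/eqP; rewrite eq_complex/= /Rintegral; apply/andP.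
split; apply/eqP; congr fine; apply: ae_eq_integral => //.
- exact: measurable_int h1.1.
- exact: measurable_int h2.1.
- by apply: filterS e => x ->.
- exact: measurable_int h1.2.
- exact: measurable_int h2.2.
- by apply: filterS e => x ->.
Qed.

Lemma pairing_adjoint m k (M : T -> 'M[R[i]]_(m, k)) F G :
  pairing (fun x => M x *m F x) G = pairing F (fun x => (M x)^t* *m G x).
Proof. by congr cint; apply/funext => x; exact: dot_mulmx. Qed.

Lemma pairing_self k (F : T -> 'cV[R[i]]_k) : L2v F ->
  ((complex.Re (pairing F F))%:E = \int[mu]_x (\sum_i sqmod (F x i 0))%:E)%E.
Proof.
move=> hF; rewrite /= fineK; last first.
  by apply: integrable_fin_num => //; have [] := dot_cintegrable hF hF.
by apply: eq_integral => x _; rewrite dot_self.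
Qed.

Lemma pairing_series k (F G : T -> 'cV[R[i]]_k) : L2v F -> L2v G ->
  series (fun n => complex.Re (dot (hat F n) (hat G n))) @ \oo -->
    complex.Re (pairing F G) /\
  series (fun n => complex.Im (dot (hat F n) (hat G n))) @ \oo -->
    complex.Im (pairing F G).
Proof.
move=> hF hG.
(* The sign s is 1 for the real part and -1 for the imaginary part. *)
have cv (c e f g : 'I_k -> T -> R) :
    (forall i, L2on mu D (c i)) -> (forall i, L2on mu D (e i)) ->
    (forall i, L2on mu D (f i)) -> (forall i, L2on mu D (g i)) ->
    forall s : R, series (fun n => \sum_i (ipr mu (c i) (phi n) * ipr mu (e i) (phi n) +
      s * (ipr mu (f i) (phi n) * ipr mu (g i) (phi n)))) @ \oo -->
    \sum_i (ipr mu (c i) (e i) + s * ipr mu (f i) (g i)).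
  move=> hc he hf hg s.
  rewrite (_ : series _ = fun N => \sum_i
      (series (fun n => ipr mu (c i) (phi n) * ipr mu (e i) (phi n)) N +
      s * series (fun n => ipr mu (f i) (phi n) * ipr mu (g i) (phi n)) N)).
    apply: cvg_big => [|i _]; first exact: add_continuous.
    by apply: cvgD; [|apply: cvgM; first exact: cvg_cst]; exact: cvg_ipr.
  apply/funext => N; rewrite /series /= exchange_big; apply: eq_bigr => i _.
  by rewrite mulr_sumr -big_split.
have hFi i := (hF i).1; have hFi' i := (hF i).2.
have hGi i := (hG i).1; have hGi' i := (hG i).2.
have -> : pairing F G = \sum_i cint mu (fun x => F x i 0 * (G x i 0)^*%C).
  by apply: cint_sum => i; exact: CL2_cintegrable (hF i) (hG i).
under [X in complex.Re X]eq_bigr do rewrite (cint_mul_conj (hF _) (hG _)).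
under [X in complex.Im X]eq_bigr do rewrite (cint_mul_conj (hF _) (hG _)).
have cvg_ext (u v : nat -> R) (l m : R) : u @ \oo --> l -> u = v -> l = m ->
    v @ \oo --> m by move=> h <- <-.
split.
- apply: (cvg_ext _ _ _ _ (cv _ _ _ _ hFi hGi hFi' hGi' 1)).
    congr series; apply/funext => n; rewrite /dot (raddf_sum (@complex.Re R)).
    by apply: eq_bigr => i _; rewrite !hatE//= mul1r mulrN opprK.
  by rewrite (raddf_sum (@complex.Re R)); apply: eq_bigr => i _; rewrite mul1r.
- apply: (cvg_ext _ _ _ _ (cv _ _ _ _ hFi' hGi hFi hGi' (-1))).
    congr series; apply/funext => n; rewrite /dot (raddf_sum (@complex.Im R)).
    by apply: eq_bigr => i _; rewrite !hatE//= mulN1r mulrN addrC.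
  by rewrite (raddf_sum (@complex.Im R)); apply: eq_bigr => i _; rewrite mulN1r.
Qed.
End VectorL2.

Lemma conjcM (R : realType) (y z : R[i]) : (y * z)^*%C = y^*%C * z^*%C.
Proof. by case: y z => [? ?] [? ?]; simpc; congr (_ +i* _); ring. Qed.

Lemma conjcD (R : realType) (y z : R[i]) : (y + z)^*%C = y^*%C + z^*%C.
Proof. by case: y z => [? ?] [? ?]; simpc; congr (_ +i* _); ring. Qed.

Lemma conjcR (R : realType) (y : R) : (y%:C)^*%C = y%:C.
Proof. by simpc. Qed.

(** * Square-summable sequences as functions on the band *)

Section SequenceModel.
Context (R : realType) (a : R).
Hypothesis a_gt0 : 0 < a.
Local Notation C := R[i].
Local Notation borel := (measurableTypeR R).
Local Notation leb := (@lebesgue_measure R).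
Local Notation D := (`](- (2 * a)), (2 * a)[%classic : set borel).
Local Notation phi := (chebphi a).
Local Notation L2v := (L2v leb D).
Local Notation hat := (hat leb phi).
Local Notation pairing := (@pairing _ _ R leb _).

Let pL := chebphi_L2 a_gt0.
Let pO := chebphi_orth a_gt0.
Let pT := chebphi_total a_gt0.

(** An inverse of [hat], obtained by choice and hence determined only almost everywhere; the value
    on sequences that are not square summable makes it total. *)
Definition realize k (g : nat -> 'cV[C]_k) : borel -> 'cV[C]_k :=
  if pselect (l2 g) is left hg then sval (cid2 (hat_surj pL pO hg)) else fun=> 0.

Lemma realize_L2v k (g : nat -> 'cV[C]_k) : L2v (realize g).
Proof.
rewrite /realize; case: pselect => [hg|_]; last exact: L2v0.
by case: cid2.
Qed.

Lemma hat_realize k (g : nat -> 'cV[C]_k) : l2 g -> hat (realize g) = g.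
Proof.
rewrite /realize; case: pselect => // hg _; case: cid2 => F _ /= FE.
exact/funext.
Qed.

Lemma realize_ae k (g : nat -> 'cV[C]_k) (F : borel -> 'cV[C]_k) :
  L2v F -> hat F = g -> {ae leb, forall x, realize g x = F x}.
Proof.
move=> hF Fg; apply: (hat_inj pL pT) => //; first exact: realize_L2v.
move=> n; rewrite hat_realize -?Fg//; exact: l2_hat pL pO pT _ _ hF.
Qed.

Lemma hat_l2 k (F : borel -> 'cV[C]_k) : L2v F -> l2 (hat F).
Proof. exact: (l2_hat pL pO pT). Qed.

Lemma bmeas_id : bmeas D (fun x : borel => x%:C).
Proof.
split; first by apply: cmeas_real; exact: measurable_id.
exists ((2 * a) ^+ 2) => x; rewrite /= itv_abs => xa.
rewrite /sqmod /= expr0n addr0 -(real_normK (num_real x)).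
by rewrite lerXn2r ?nnegrE ?mulr_ge0 ?(ltW a_gt0) ?(ltW xa).
Qed.

Lemma L2v_mulX k (F : borel -> 'cV[C]_k) : L2v F -> L2v (fun x => x%:C *: F x).
Proof. exact: L2v_bscale bmeas_id. Qed.

Let hat_mulX_gen k (F : borel -> 'cV[C]_k) n (f : borel -> R) : L2v F ->
  (forall x, x * phi n x = a * f x) -> CL2 leb D (fun x => (f x)%:C) ->
  hat (fun x => x%:C *: F x) n =
  a%:C *: \col_i cint leb (fun x => F x i 0 * ((f x)%:C)^*%C).
Proof.
move=> hF hf Lf; apply/matrixP => i j; rewrite !mxE -cintZ; last first.
  exact: CL2_cintegrable (hF i) Lf.
congr cint; apply/funext => x; rewrite mxE.
have h : x%:C * (phi n x)%:C = a%:C * (f x)%:C by rewrite -!rmorphM/= hf.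
by rewrite !conjcR mulrAC h; ring.
Qed.

Lemma hat_mulX0 k (F : borel -> 'cV[C]_k) : L2v F ->
  hat (fun x => x%:C *: F x) 0 = a%:C *: hat F 1.
Proof.
move=> hF; apply: hat_mulX_gen => // [x|]; first exact: mulX_chebphi0.
exact: CL2_phi pL 1.
Qed.

Lemma hat_mulXS k (F : borel -> 'cV[C]_k) n : L2v F ->
  hat (fun x => x%:C *: F x) n.+1 = a%:C *: (hat F n + hat F n.+2).
Proof.
move=> hF; rewrite (@hat_mulX_gen _ _ _ (fun x => phi n.+2 x + phi n x))//.
- congr (_ *: _); apply/matrixP => i j; rewrite !mxE -cintD.
  + congr cint; apply/funext => x.
    by rewrite !conjcR (rmorphD (real_complex R)) mulrDr addrC.
  + exact: CL2_cintegrable (hF i) (CL2_phi pL n).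
  + exact: CL2_cintegrable (hF i) (CL2_phi pL n.+2).
- by move=> x; exact: mulX_chebphiS.
- rewrite (_ : (fun x => _) = (fun x => (phi n.+2 x)%:C + (phi n x)%:C)); last first.
    by apply/funext => x; apply/eqP; rewrite eq_complex/= addr0 !eqxx.
  by apply: CL2_add; exact: CL2_phi pL _.
Qed.

Definition delta0 k (c : 'cV[C]_k) (x : borel) : 'cV[C]_k := (phi 0 x)%:C *: c.

Lemma delta0_L2v k (c : 'cV[C]_k) : L2v (delta0 c).
Proof.
move=> i; rewrite /delta0; under [X in CL2 _ _ X]eq_fun do rewrite mxE mulrC.
exact: CL2_scale (CL2_phi pL 0).
Qed.

Lemma hat_delta0 k (c : 'cV[C]_k) n : hat (delta0 c) n = (n == 0%N)%:R *: c.
Proof.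
apply/matrixP => i j; rewrite !mxE /delta0.
rewrite (_ : (fun x => _) = (fun x => c i 0 * ((phi 0 x)%:C * ((phi n x)%:C)^*%C))); last first.
  by apply/funext => x; rewrite mxE; ring.
rewrite cintZ; last first.
  exact: CL2_cintegrable (CL2_phi pL 0) (CL2_phi pL n).
rewrite (cint_mul_conj (CL2_phi pL 0) (CL2_phi pL n)) /=.
have z f : ipr leb f (fun=> 0) = 0.
  by rewrite /ipr; under eq_Rintegral do rewrite mulr0; rewrite Rintegral_cst// mul0r.
rewrite !z (iprC _ (fun=> 0)) z addr0 subr0 pO eq_sym ord1 mulrC.
by congr (_ * _); case: eqP => _ //; apply/eqP; rewrite eq_complex/= !eqxx.
Qed.

Lemma pairing_delta0 k (F : borel -> 'cV[C]_k) c : L2v F ->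
  pairing F (delta0 c) = dot (hat F 0) c.
Proof.
move=> hF; rewrite /pairing /dot /delta0.
rewrite (_ : (fun x => _) = (fun x => \sum_i (c i 0)^*%C * (F x i 0 * ((phi 0 x)%:C)^*%C))); last first.
  apply/funext => x; apply: eq_bigr => i _.
  by rewrite mxE conjcM; ring.
rewrite cint_sum => [|i]; last first.
  exact: cintegrableZ (CL2_cintegrable (hF i) (CL2_phi pL 0)).
apply: eq_bigr => i _; rewrite mxE [RHS]mulrC; apply: cintZ.
exact: CL2_cintegrable (hF i) (CL2_phi pL 0).
Qed.

Definition rshift k (g : nat -> 'cV[C]_k) (n : nat) : 'cV[C]_k :=
  if n is m.+1 then g m else 0.

Lemma l2_rshift k (g : nat -> 'cV[C]_k) : l2 g -> l2 (rshift g).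
Proof. by move=> hg; apply/l2_shift. Qed.

Lemma l2_lshift k (g : nat -> 'cV[C]_k) : l2 g -> l2 (fun n => g n.+1).
Proof. by move=> hg; apply/l2_shift. Qed.

(** The right and the left shift are adjoint: the two coefficient series agree after moving the
    index by one, since the first coefficient of a right shift is 0. *)
Lemma pairing_shift k (F F' G G' : borel -> 'cV[C]_k) :
  L2v F -> L2v F' -> L2v G -> L2v G' ->
  hat F' = rshift (hat F) -> hat G' = (fun n => hat G n.+1) ->
  pairing F' G = pairing F G'.
Proof.
move=> hF hF' hG hG' FE GE.
have [r1 i1] := pairing_series pL pO pT hF' hG.
have [r2 i2] := pairing_series pL pO pT hF hG'.
have sh (h : C -> R) : h 0 = 0 ->
    forall l : R, series (fun n => h (dot (hat F n) (hat G' n))) @ \oo --> l ->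
    series (fun n => h (dot (hat F' n) (hat G n))) @ \oo --> l.
  move=> h0 l; rewrite -(cvg_shiftS (series (fun n => h (dot (hat F' n) _)))).
  apply: cvg_trans; apply: near_eq_cvg; apply: nearW => n.
  have d0 : h (dot (hat F' 0) (hat G 0)) = 0.
    by rewrite FE /= /dot big1 ?h0// => i _; rewrite mxE mul0r.
  rewrite /series /= big_nat_recl//= d0 add0r.
  by apply: eq_bigr => j _; rewrite FE GE.
apply/eqP; rewrite eq_complex; apply/andP; split; apply/eqP.
  have r3 := sh (@complex.Re R) erefl _ r2.
  by rewrite -(cvg_lim (@Rhausdorff R) r1) -(cvg_lim (@Rhausdorff R) r3).
have i3 := sh (@complex.Im R) erefl _ i2.
by rewrite -(cvg_lim (@Rhausdorff R) i1) -(cvg_lim (@Rhausdorff R) i3).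
Qed.

(** The series in [hdot] become one integral, so the sesquilinearity of [hdot] and adjoint
    computations are inherited from [pairing]. *)
Lemma hdotE d r (f g : hilb R d r) F G : L2v F -> L2v G ->
  hat F = (hval f).2 -> hat G = (hval g).2 ->
  hdot f g = dot (hval f).1 (hval g).1 + pairing F G.
Proof.
move=> hF hG FE GE; rewrite /hdot; congr (_ + _).
have [h1 h2] := pairing_series pL pO pT hF hG.
rewrite -FE -GE; apply/eqP; rewrite eq_complex/=; apply/andP; split; apply/eqP.
  by apply/cvg_lim => //; exact: Rhausdorff.
by apply/cvg_lim => //; exact: Rhausdorff.
Qed.
End SequenceModel.

(** * Inner products and completeness *)

Section InnerProduct.
Context (R : realType) (H : lmodType R[i]) (ip : H -> H -> R[i]).
Implicit Types (f g h : H) (z : R[i]).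

Definition inner_product : Prop :=
  [/\ forall z f g h, ip (z *: f + g) h = z * ip f h + ip g h,
      forall f g, ip g f = (ip f g)^*%C,
      forall f, 0 <= sqnorm ip f & forall f, sqnorm ip f = 0 -> f = 0].

Hypothesis ipH : inner_product.
Local Notation sqnorm := (sqnorm ip).

Lemma ip_conj f g : ip g f = (ip f g)^*%C. Proof. by case: ipH. Qed.
Lemma sqnorm_ge0 f : 0 <= sqnorm f. Proof. by case: ipH. Qed.
Lemma sqnorm_eq0 f : sqnorm f = 0 -> f = 0. Proof. by case: ipH => _ _ _; apply. Qed.

Lemma ipDl f g h : ip (f + g) h = ip f h + ip g h.
Proof. by case: ipH => l _ _ _; rewrite -[f]scale1r l mul1r scale1r. Qed.

Lemma ip0l h : ip 0 h = 0.
Proof.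
have /eqP := ipDl 0 0 h.
by rewrite addr0 -subr_eq0 opprD addrA subrr sub0r oppr_eq0 => /eqP.
Qed.

Lemma ipZl z f h : ip (z *: f) h = z * ip f h.
Proof. by case: ipH => l _ _ _; rewrite -[z *: f]addr0 l ip0l addr0. Qed.

Lemma ipBl f g h : ip (f - g) h = ip f h - ip g h.
Proof. by rewrite -scaleN1r ipDl ipZl mulN1r. Qed.

Lemma ipDr f g h : ip h (f + g) = ip h f + ip h g.
Proof. by rewrite [LHS]ip_conj ipDl conjcD -!ip_conj. Qed.

Lemma ipZr z f h : ip h (z *: f) = z^*%C * ip h f.
Proof. by rewrite [LHS]ip_conj ipZl conjcM -!ip_conj. Qed.

Lemma ipBr f g h : ip h (f - g) = ip h f - ip h g.
Proof. 
rewrite -[f - g]/(f + - g) ipDr -[- g]scaleN1r ipZr.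
by congr (_ + _); rewrite -[RHS]mulN1r; congr (_ * _); simpc. Qed.

Lemma ip0r h : ip h 0 = 0.
Proof. by rewrite ip_conj ip0l conjc0. Qed.

Lemma ip_self f : ip f f = (sqnorm f)%:C.
Proof.
rewrite /Defs.sqnorm; have := ip_conj f f; case: (ip f f) => x y /= [] h.
apply/eqP; rewrite eq_complex/= eqxx/=; apply/eqP; move: h; lra.
Qed.

Lemma sqnormD f g : sqnorm (f + g) = sqnorm f + sqnorm g + 2 * complex.Re (ip f g).
Proof.
rewrite /Defs.sqnorm ipDl !ipDr (ip_conj f g).
by case: (ip f f) (ip g g) (ip f g) => [? ?] [? ?] [? ?] /=; ring.
Qed.

Lemma sqnormZ z f : sqnorm (z *: f) = sqmod z * sqnorm f.
Proof.
rewrite /Defs.sqnorm ipZl ipZr mulrA mul_conjc.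
by case: (ip f f) => ? ? /=; rewrite mul0r subr0.
Qed.

Lemma sqnormN f : sqnorm (- f) = sqnorm f.
Proof. by rewrite -scaleN1r sqnormZ /sqmod /= oppr0 sqrrN expr1n expr0n addr0 mul1r. Qed.

Lemma sqnormB f g : sqnorm (f - g) = sqnorm f + sqnorm g - 2 * complex.Re (ip f g).
Proof.
rewrite sqnormD sqnormN -scaleN1r ipZr; case: (ip f g) => x y.
rewrite /= !(oppr0, mulr0, mul0r, subr0, sub0r); ring.
Qed.

Lemma sqnormD_le f g : sqnorm (f + g) <= 2 * sqnorm f + 2 * sqnorm g.
Proof. by have := sqnorm_ge0 (f - g); rewrite sqnormB sqnormD; lra. Qed.

Lemma sqnorm0 : sqnorm 0 = 0.
Proof. by rewrite /Defs.sqnorm ip0l. Qed.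

Lemma cauchy_schwarz f g : sqmod (ip f g) <= sqnorm f * sqnorm g.
Proof.
have [g0|g0] := eqVneq (sqnorm g) 0.
  by rewrite (sqnorm_eq0 g0) ip0r sqnorm0 mulr0 /sqmod /= expr0n addr0.
have gp : 0 < sqnorm g by rewrite lt_neqAle eq_sym g0 sqnorm_ge0.
have := sqnorm_ge0 (f - (ip f g / (sqnorm g)%:C) *: g).
rewrite sqnormB sqnormZ ipZr.
have e : (ip f g / (sqnorm g)%:C) = ((sqnorm g)^-1)%:C * ip f g.
  by rewrite mulrC fmorphV.
rewrite e conjcM conjcR -mulrA (mulrC (ip f g)^*%C) mul_conjc sqmodM.
rewrite [sqmod (_%:C)]/sqmod /= !(oppr0, mulr0, mul0r, subr0, sub0r, expr0n, addr0).
set s := sqnorm g in gp g0 *; set N := sqnorm f; set q := sqmod _ => h.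
have : 0 <= (N - q / s) * s.
  by rewrite mulr_ge0 ?(ltW gp)//; apply: le_trans h _; rewrite le_eqVlt; apply/orP; left; apply/eqP; field.
by rewrite mulrBl divfK// subr_ge0.
Qed.
End InnerProduct.

(** * The space of [J] as a Hilbert space *)

Section HilbHilbert.
Context (R : realType) (d r : nat).
Local Notation H := (hilb R d r).
Local Notation C := R[i].
Local Notation sqnorm := (sqnorm (@hdot R d r)).
Local Notation borel := (measurableTypeR R).
Local Notation leb := (@lebesgue_measure R).

(** The inner product does not involve a, so its properties can be read off in the band model with a
    = 1. *)
Let a1 : 0 < 1 :> R. Proof. by []. Qed.
Let rz (f : H) := realize a1 (hval f).2.
Let rzL (f : H) := realize_L2v a1 (hval f).2.

Let l2_hval (f : H) : l2 (hval f).2.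
Proof. by have /asboolP := hvalP f. Qed.

Let rzE (f : H) : hat leb (chebphi 1) (rz f) = (hval f).2.
Proof. exact: hat_realize. Qed.

Let hdotE1 (f g : H) : hdot f g =
  dot (hval f).1 (hval g).1 + pairing leb (rz f) (rz g).
Proof. exact: (hdotE a1) (rzL f) (rzL g) (rzE f) (rzE g). Qed.

Local Notation pre := ('cV[C]_d * (nat -> 'cV[C]_r))%type.

(** Defined on all pairs, so that it makes sense for a coordinatewise limit before that limit is
    known to be square summable. *)
Let comp_sum (p : pre) N : R := \sum_i sqmod (p.1 i 0) +
  \sum_(0 <= n < N) \sum_c sqmod (p.2 n c 0).

Let comp_sum_nd (p : pre) : nondecreasing_seq (comp_sum p).
Proof.
move=> m n mn; rewrite /comp_sum lerD2l (big_cat_nat (n := m) (p := n))//= lerDl.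
by apply: sumr_ge0 => k _; apply: sumr_ge0 => c _; exact: sqmod_ge0.
Qed.

Let comp_sum_cvg (f : H) : comp_sum (hval f) @ \oo --> sqnorm f.
Proof.
have [h _] := pairing_series (chebphi_L2 a1) (chebphi_orth a1) (chebphi_total a1) (rzL f) (rzL f).
rewrite /Defs.sqnorm hdotE1 dot_self (raddfD (@complex.Re R)).
apply: cvgD; first exact: cvg_cst.
apply: cvg_trans h; apply: near_eq_cvg; apply: nearW => N.
by apply: eq_bigr => n _; rewrite rzE dot_self.
Qed.

Let comp_sum_le (f : H) N : comp_sum (hval f) N <= sqnorm f.
Proof.
rewrite -(cvg_lim (@Rhausdorff R) (@comp_sum_cvg f)).
by apply: nondecreasing_cvgn_le => //; apply/cvg_ex; exists (sqnorm f); exact: comp_sum_cvg.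
Qed.

Let comp1_le (f : H) i : sqmod ((hval f).1 i 0) <= sqnorm f.
Proof.
apply: le_trans (comp_sum_le f 0); rewrite /comp_sum big_geq// addr0.
by rewrite (bigD1 i)//= lerDl sumr_ge0// => j _; exact: sqmod_ge0.
Qed.

Let comp2_le (f : H) n c : sqmod ((hval f).2 n c 0) <= sqnorm f.
Proof.
apply: le_trans (comp_sum_le f n.+1); rewrite /comp_sum big_nat_recr//=.
apply: le_trans (_ : \sum_c' sqmod ((hval f).2 n c' 0) <= _).
  by rewrite (bigD1 c)//= lerDl sumr_ge0// => *; exact: sqmod_ge0.
rewrite addrA lerDr addr_ge0// sumr_ge0// => *; rewrite ?sqmod_ge0//.
by rewrite sumr_ge0// => *; exact: sqmod_ge0.
Qed.

Lemma hdot_inner_product : inner_product (@hdot R d r).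
Proof.
have ge0 f : 0 <= sqnorm f.
  by apply: le_trans (comp_sum_le f 0); rewrite /comp_sum big_geq// addr0 sumr_ge0// => *; exact: sqmod_ge0.
split=> // [z f g h|f g|f].
- rewrite (hdotE a1 (F := fun x => z *: rz f x + rz g x) (G := rz h)).
  + rewrite (pairingDl (L2vZ z (rzL f)) (rzL g) (rzL h)).
    rewrite (pairingZl z (rzL f) (rzL h)) !hdotE1.
    rewrite (_ : (hval (z *: f + g)).1 = z *: (hval f).1 + (hval g).1)//.
    by rewrite dotDl dotZl mulrDr -!addrA; congr (_ + _); rewrite addrCA.
  + exact: L2vD (L2vZ z (rzL f)) (rzL g).
  + exact: rzL.
  + apply/funext => n; rewrite (hatD (chebphi_L2 a1) n (L2vZ z (rzL f)) (rzL g)).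
    by rewrite (hatZ (chebphi_L2 a1) z n (rzL f)) !rzE.
  + exact: rzE.
- rewrite !hdotE1 conjcD -(pairing_conj (rzL f) (rzL g)).
  by rewrite -dot_conj.
- move=> f0; apply: val_inj; apply: injective_projections.
    apply/matrixP => i j; rewrite ord1 mxE; apply: sqmod_le0.
    by rewrite -f0; exact: comp1_le.
  apply/funext => n; apply/matrixP => i j; rewrite ord1 mxE; apply: sqmod_le0.
  by rewrite -f0; exact: comp2_le.
Qed.

Let real_complete (x e : nat -> R) : e @ \oo --> 0 ->
  (forall k j, (k <= j)%N -> (x j - x k) ^+ 2 <= e k) -> cvgn x.
Proof.
move=> e0 he; apply/cauchy_cvgP; apply: cauchy_exP => eps eps0.
have e2 : 0 < eps ^+ 2 by rewrite exprn_gt0.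
have /cvgrPdist_lt /(_ _ e2) [k _ /(_ k (leqnn _))] := e0.
rewrite sub0r normrN => hk; exists (x k); exists k => // j /= kj.
rewrite /ball /= distrC -(@ltr_pXn2r _ 2)// ?nnegrE ?(ltW eps0)//.
rewrite real_normK ?num_real//; apply: le_lt_trans (he _ _ kj) _.
exact: le_lt_trans (ler_norm _) hk.
Qed.

(** Coordinates converge, and every finite partial sum of the squared distance inherits the bound
    [e k]; the partial sums then grow to the squared norm. The rate e survives unchanged in the
    conclusion. *)
Lemma hilb_complete (f : nat -> H) (e : nat -> R) : e @ \oo --> 0 ->
  (forall k j, (k <= j)%N -> sqnorm (f j - f k) <= e k) ->
  exists h, forall k, sqnorm (h - f k) <= e k.
Proof.
move=> e0 he.
have cx (z : nat -> C) : (forall k j, (k <= j)%N -> sqmod (z j - z k) <= e k) ->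
    exists w : C, (fun j => complex.Re (z j)) @ \oo --> complex.Re w /\
      (fun j => complex.Im (z j)) @ \oo --> complex.Im w.
  move=> hz; have cr : cvgn (fun j => complex.Re (z j)).
    apply: (real_complete e0) => k j kj; apply: le_trans (hz k j kj).
    by case: (z j) (z k) => ? ? [? ?]; rewrite /sqmod /= lerDl sqr_ge0.
  have ci : cvgn (fun j => complex.Im (z j)).
    apply: (real_complete e0) => k j kj; apply: le_trans (hz k j kj).
    by case: (z j) (z k) => ? ? [? ?]; rewrite /sqmod /= lerDr sqr_ge0.
  by exists (limn (fun j => complex.Re (z j)) +i* limn (fun j => complex.Im (z j))).
have /choice[u hu] : forall i : 'I_d, exists w : C,
    (fun j => complex.Re ((hval (f j)).1 i 0)) @ \oo --> complex.Re w /\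
    (fun j => complex.Im ((hval (f j)).1 i 0)) @ \oo --> complex.Im w.
  move=> i; apply: cx => k j kj.
  apply: le_trans (he k j kj); have := comp1_le (f j - f k) i.
  by rewrite /= !mxE.
have /choice[g hg] : forall nc : nat * 'I_r, exists w : C,
    (fun j => complex.Re ((hval (f j)).2 nc.1 nc.2 0)) @ \oo --> complex.Re w /\
    (fun j => complex.Im ((hval (f j)).2 nc.1 nc.2 0)) @ \oo --> complex.Im w.
  move=> [n c]; apply: cx => k j kj.
  apply: le_trans (he k j kj); have := comp2_le (f j - f k) n c.
  by rewrite /= !mxE.
pose p : pre := (\col_i u i, fun n => \col_c g (n, c)).
have sq (z : nat -> C) (w v : C) : (fun j => complex.Re (z j)) @ \oo --> complex.Re w ->
    (fun j => complex.Im (z j)) @ \oo --> complex.Im w ->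
    (fun j => sqmod (z j - v)) @ \oo --> sqmod (w - v).
  move=> h1 h2.
  have sqE (y : C) : sqmod (y - v) = (complex.Re y - complex.Re v) * (complex.Re y - complex.Re v)
     + (complex.Im y - complex.Im v) * (complex.Im y - complex.Im v).
    by case: y v {h1 h2} => ? ? [? ?].
  rewrite sqE; under eq_fun do rewrite sqE.
  by apply: cvgD; apply: cvgM; apply: cvgB => //; exact: cvg_cst.
have pB k N : comp_sum (p - hval (f k)) N <= e k.
  have : (fun j => comp_sum (hval (f j) - hval (f k)) N) @ \oo --> comp_sum (p - hval (f k)) N.
    rewrite /comp_sum; apply: cvgD.
      apply: cvg_big => [|i _]; first exact: add_continuous.
      rewrite !mxE; under eq_fun do rewrite !mxE.
      by have [h1 h2] := hu i; exact: sq.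
    apply: cvg_big => [|n _]; first exact: add_continuous.
    apply: cvg_big => [|c _]; first exact: add_continuous.
    rewrite !mxE; under eq_fun do rewrite !mxE.
    by have [h1 h2] := hg (n, c); exact: sq.
  move=> /cvgr_to_le; apply; exists k => // j /= kj.
  by apply: le_trans (he k j kj); exact: comp_sum_le (f j - f k) N.
have l2B k : l2 (fun n => p.2 n - (hval (f k)).2 n).
  move=> c; apply: (@le_lt_trans _ _ (e k)%:E); last exact: ltry.
  apply: lime_le; first by apply: is_cvg_nneseries => n _ _; rewrite lee_fin sqmod_ge0.
  apply: nearW => N; rewrite sumEFin lee_fin; apply: le_trans (pB k N).
  rewrite /comp_sum; apply: le_trans (_ : \sum_(0 <= n < N) \sum_c sqmod ((p - hval (f k)).2 n c 0) <= _).
    by apply: ler_sum => n _; rewrite (bigD1 c)//= lerDl sumr_ge0// => *; exact: sqmod_ge0.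
  by rewrite lerDr sumr_ge0// => *; exact: sqmod_ge0.
have pH : in_hilb p.
  apply/asboolP; have := l2D (l2B 0%N) (l2_hval (f 0%N)).
  by under eq_fun do rewrite subrK.
exists (Hilb pH) => k; apply: cvgr_to_le (@comp_sum_cvg (Hilb pH - f k)) _.
by apply: nearW => N; exact: pB.
Qed.
End HilbHilbert.

(** * The Jost matrix *)

Section ConjugateTranspose.
Context (R : realType).
Local Notation C := R[i].

Lemma trmxCM m n p (A : 'M[C]_(m, n)) (B : 'M[C]_(n, p)) :
  (A *m B)^t* = B^t* *m A^t*.
Proof. by rewrite trmx_mul map_mxM. Qed.

Lemma trmxCZ m n z (A : 'M[C]_(m, n)) : (z *: A)^t* = z^*%C *: A^t*.
Proof. by rewrite linearZ/= map_mxZ. Qed.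

Lemma trmxC_scalar n (z : C) : (z%:M : 'M[C]_n)^t* = (z^*%C)%:M.
Proof. by rewrite tr_scalar_mx map_scalar_mx. Qed.

Lemma trmxC_det n (A : 'M[C]_n) : \det (A^t*) = (\det A)^*%C.
Proof. by rewrite det_map_mx det_tr. Qed.

Lemma trmxC_adj n (A : 'M[C]_n) : (\adj A)^t* = \adj (A^t*).
Proof. by rewrite trmx_adj map_mx_adj. Qed.

Lemma dotE n (u v : 'cV[C]_n) : dot u v = (v^t* *m u) 0 0.
Proof. by rewrite mxE; apply: eq_bigr => i _; rewrite !mxE mulrC. Qed.

Lemma dot_real n (Y : 'M[C]_n) (v : 'cV[C]_n) : Y^t* = Y ->
  complex.Im (dot (Y *m v) v) = 0.
Proof.
move=> hY; have : dot (Y *m v) v = (dot (Y *m v) v)^*%C.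
  rewrite -dot_conj !dotE trmxCM hY mulmxA; congr (_ 0 0).
by case: dot => x y [] /= h; lra.
Qed.

Lemma dot_eq0 n (v : 'cV[C]_n) : dot v v = 0 -> v = 0.
Proof.
rewrite dot_self => -[/eqP]; rewrite psumr_eq0 => [|i _]; last exact: sqmod_ge0.
move=> /allP h; apply/matrixP => i j; rewrite ord1 mxE.
by have := h i (mem_index_enum _); rewrite /= sqmod_eq0 => /eqP.
Qed.
End ConjugateTranspose.

Section Symbol.
Context (R : realType) (d r : nat) (a : R) (HC : 'M[R[i]]_d) (V : 'M[R[i]]_(d, r)).
Hypothesis a_gt0 : 0 < a.
Hypothesis hHC : HC = HC ^t*.
Local Notation C := R[i].
Local Notation borel := (measurableTypeR R).
Local Notation leb := (@lebesgue_measure R).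
Local Notation D := (`](- (2 * a)), (2 * a)[%classic : set borel).

Definition pencil (x : R) : 'M[C]_d := (x%:C)%:M - HC.
Definition chi (x : R) : C := \det (pencil x).
Definition pw (x : R) : 'M[C]_(d, r) := \adj (pencil x) *m V.
(** This is [chi] times the function a^-1 V^* (x - HC)^-1 V, with the poles of the resolvent
    cleared. *)
Definition weyl (x : R) : 'M[C]_r := (a^-1)%:C *: (V^t* *m pw x).
(** For x = 2a cos(theta) with theta in [0, pi] this is exp(i theta). *)
Definition zeta (x : R) : C := (x / (2 * a)) +i* (semic a x / (2 * a)).
(** [chebphi n] is proportional in n to sin((n+1) theta). The combination chi sin((n+1) theta) - Y
    sin(n theta) occurs in the formal eigenvectors, and chi - zeta Y is, up to a constant, its
    coefficient of exp(-i (n+1) theta). *)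
Definition jost (x : R) : 'M[C]_r := (chi x)%:M - zeta x *: weyl x.
(** The adjugate form is visibly measurable, and it gives 0 where the determinant vanishes; [U_off]
    relies on that default. *)
Definition jost_inv (x : R) : 'M[C]_r := (\det (jost x))^-1 *: \adj (jost x).

Lemma pencil_herm x : (pencil x)^t* = pencil x.
Proof. by rewrite linearB/= map_mxB trmxC_scalar conjcR -hHC. Qed.

Lemma chi_real x : (chi x)^*%C = chi x.
Proof. by rewrite -trmxC_det pencil_herm. Qed.

Lemma pw_adj x : (pw x)^t* = V^t* *m \adj (pencil x).
Proof. by rewrite trmxCM trmxC_adj pencil_herm. Qed.

Lemma pencil_pw x : pencil x *m pw x = chi x *: V.
Proof. by rewrite mulmxA mul_mx_adj mul_scalar_mx. Qed.

Lemma pw_pencil x : (pw x)^t* *m pencil x = chi x *: V^t*.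
Proof. by rewrite pw_adj -mulmxA mul_adj_mx mul_mx_scalar. Qed.

Lemma weyl_adjE x : weyl x = (a^-1)%:C *: ((pw x)^t* *m V).
Proof. by rewrite pw_adj /weyl /pw mulmxA. Qed.

Lemma weyl_herm x : (weyl x)^t* = weyl x.
Proof. by rewrite {1}/weyl trmxCZ conjcR trmxCM trmxCK weyl_adjE. Qed.

Lemma zeta_norm x : `|x| <= 2 * a -> (zeta x)^*%C * zeta x = 1.
Proof.
move=> xa; have sq := semic_sq a_gt0 xa.
apply/eqP; rewrite eq_complex /=; apply/andP; split; apply/eqP; last by ring.
have -> : x / (2 * a) * (x / (2 * a)) - - (semic a x / (2 * a)) * (semic a x / (2 * a)) =
  (x ^+ 2 + semic a x ^+ 2) / (4 * a ^+ 2) by field; rewrite gt_eqF.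
by rewrite sq; field; rewrite gt_eqF.
Qed.

Lemma zeta_trace x : zeta x + (zeta x)^*%C = (x / a)%:C.
Proof.
apply/eqP; rewrite eq_complex /= subrr eqxx andbT; apply/eqP.
by field; rewrite gt_eqF.
Qed.

Lemma jost_gram x : `|x| <= 2 * a ->
  (jost x)^t* *m jost x =
  (chi x ^+ 2)%:M - ((x / a)%:C * chi x) *: weyl x + weyl x *m weyl x.
Proof.
move=> xa; rewrite -zeta_trace.
have -> : (jost x)^t* = (chi x)%:M - (zeta x)^*%C *: weyl x.
  by rewrite linearB/= map_mxB trmxC_scalar chi_real trmxCZ weyl_herm.
rewrite mulmxBl !mulmxBr -scalar_mxM -expr2 !mul_scalar_mx mul_mx_scalar.
rewrite -scalemxAl -scalemxAr !scalerA zeta_norm// scale1r.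
rewrite opprB -!addrA; congr (_ + _); rewrite addrC -addrA [RHS]addrC; congr (_ + _).
rewrite -opprD -scalerDl; congr (- (_ *: _)).
by rewrite mulrDl [LHS]addrC !(mulrC (chi x)) -!mulrDl.
Qed.

Lemma jost_gram_mul x (v : 'cV[C]_r) : `|x| <= 2 * a ->
  (jost x)^t* *m (jost x *m v) =
  chi x ^+ 2 *: v - (x%:C * (a^-1)%:C * chi x * (a^-1)%:C) *: (V^t* *m (pw x *m v)) +
  (a^-1)%:C ^+ 2 *: ((pw x)^t* *m (V *m (V^t* *m (pw x *m v)))).
Proof.
move=> xa; have := congr1 (mulmx^~ v) (jost_gram xa); rewrite /= -mulmxA => ->.
rewrite mulmxDl mulmxBl mul_scalar_mx; congr (_ - _ + _).
  rewrite /weyl -!scalemxAl scalerA -mulmxA; congr (_ *: _).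
  by rewrite (rmorphM (real_complex R)); ring.
rewrite {1}weyl_adjE /weyl -!scalemxAl -!scalemxAr -scalemxAl scalerA -expr2.
by rewrite -!mulmxA.
Qed.

(* If jost x *m w = 0, the imaginary part of dot (jost x *m w) w is a nonzero
   multiple of dot (weyl x *m w) w, so chi x * dot w w = 0. *)
Lemma jost_unit x : `|x| < 2 * a -> chi x != 0 -> \det (jost x) != 0.
Proof.
move=> xa chi0; apply/negP; rewrite -det_tr => /det0P[v v0 hv].
pose w : 'cV[C]_r := v^T.
have hw : jost x *m w = 0 by rewrite -[LHS]trmxK trmx_mul trmxK hv trmx0.
have w0 : w != 0 by apply: contra_neq v0 => w0; rewrite -[v]trmxK -/w w0 trmx0.
have sa := semic_gt0 xa.
have : dot (jost x *m w) w = 0 by rewrite hw dotE mulmx0 mxE.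
rewrite mulmxBl mul_scalar_mx -scalemxAl -[- _]scaleN1r dotDl !dotZl mulN1r.
have := dot_real w (weyl_herm x); rewrite dot_self.
case: (dot (weyl x *m w) w) => y z /= ->.
have := chi_real x; move: chi0; case: (chi x) => p q chi0 [] hq.
have q0 : q = 0 by lra.
rewrite q0 /zeta; simpc => -[] h1 /eqP.
rewrite oppr_eq0 mulf_eq0 mulf_eq0 invr_eq0 (gt_eqF sa) (gt_eqF (mulr_gt0 _ a_gt0))//= => /eqP y0.
move: h1; rewrite y0 mulr0 subr0 => /eqP; rewrite mulf_eq0 => /orP[/eqP p0|/eqP s0].
  by move: chi0; rewrite p0 q0 eqxx.
by move/eqP: w0; apply; apply: dot_eq0; rewrite dot_self s0.
Qed.

Lemma jost_invr x : \det (jost x) != 0 -> jost x *m jost_inv x = 1%:M.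
Proof.
by move=> h; rewrite /jost_inv -scalemxAr mul_mx_adj scale_scalar_mx mulVf.
Qed.

Lemma jost_invl x : \det (jost x) != 0 -> jost_inv x *m jost x = 1%:M.
Proof.
by move=> h; rewrite /jost_inv -scalemxAl mul_adj_mx scale_scalar_mx mulVf.
Qed.

Lemma chi_char_poly x : chi x = (char_poly HC).[x%:C].
Proof.
rewrite /chi /char_poly -horner_evalE -det_map_mx; congr (\det _).
apply/matrixP => i j; rewrite !mxE /= horner_evalE hornerD hornerN hornerC.
by rewrite hornerMn hornerX.
Qed.

Lemma chi_ae : {ae leb, forall x : borel, chi x != 0}.
Proof.
have [rs hrs] := closed_field_poly_normal (char_poly HC).
have fin : finite_set [set x : R | chi x = 0].
  apply: (@sub_finite_set _ _ ((@complex.Re R) @` [set` rs])).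
    move=> x /= /eqP; rewrite chi_char_poly hrs hornerZ mulf_eq0.
    rewrite (monicP (char_poly_monic _)) oner_eq0/= => h.
    by exists x%:C => //=; rewrite -root_prod_XsubC.
  exact/finite_image/finite_seq.
exists [set x : borel | chi x = 0]; split.
- exact: countable_measurable (finite_set_countable fin).
- exact: countable_lebesgue_measure0 (finite_set_countable fin).
- by move=> x /= /negP; rewrite negbK => /eqP.
Qed.

End Symbol.

(** * The transform onto L2 of the band *)

Section TransferAlgebra.
Context (F : fieldType) (d r : nat).
Context (Q : 'M[F]_(r, d)) (V : 'M[F]_(d, r)) (W : 'M[F]_(r, d)) (K : 'M[F]_d).
Variables (a b c p x : F).
Hypothesis ba : b * a = 1.
Hypothesis QK : Q *m (x%:M - K) = c *: W.

Let QKv (v : 'cV_d) : Q *m (K *m v) = x *: (Q *m v) - c *: (W *m v).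
Proof.
rewrite [c *: _]scalemxAl -QK mulmxBr mulmxBl mul_mx_scalar -scalemxAl mulmxA.
by rewrite opprB addrC subrK.
Qed.

(** The pointwise identity behind Z J = x Z. In the application Q is the adjoint of [pw], A and B
    are the functions of the sequence and of its left shift, and p is the value of phi_0. *)
Lemma transfer_mul (A B g : 'cV_r) (u : 'cV_d) :
  c *: (x *: A + p *: (W *m u)) +
    Q *m (p *: (K *m u + V *m g) - b *: (V *m (x *: B + p *: (a *: g)))) =
  x *: (c *: A + Q *m (p *: u - b *: (V *m B))).
Proof.
rewrite !(mulmxBr, mulmxDr) -!scalemxAr !mulmxDr -!scalemxAr QKv.
move: (W *m u) (Q *m u) (Q *m (V *m g)) (Q *m (V *m B)) => t1 t2 t3 t4.
apply/matrixP => i j; rewrite !mxE; ring: ba.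
Qed.

(** The pointwise identity behind Z Z^* = L^* L. Here C is V^* pw G, A is the function of its right
    shift, while B and e are those of the left shifts of chi G and pw G. The two hypotheses relate
    shifts to multiplication by x, boundary term included. *)
Lemma transfer_gram (G A B C : 'cV_r) (h e : 'cV_d) :
  V *m B = (x%:M - K) *m e + (a * p) *: h ->
  A + W *m e = (b * x) *: C ->
  c *: (c *: G - b *: A) + Q *m (p *: h - b *: (V *m (B - b *: C))) =
  c ^+ 2 *: G - (x * b * c * b) *: C + (b ^+ 2) *: (Q *m (V *m C)).
Proof.
move=> VB hA; have -> : A = (b * x) *: C - W *m e by rewrite -hA addrK.
rewrite (_ : V *m (B - b *: C) = (x%:M - K) *m e + (a * p) *: h - b *: (V *m C)).
  have QKe : Q *m ((x%:M - K) *m e) = c *: (W *m e) by rewrite mulmxA QK -scalemxAl.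
  rewrite !(mulmxBr Q) -!scalemxAr (mulmxBr Q) (mulmxDr Q) QKe -!scalemxAr.
  move: (W *m e) (Q *m h) (Q *m (V *m C)) => t1 t2 t3.
  by apply/matrixP => i j; rewrite !mxE; ring: ba.
by rewrite mulmxBr VB -scalemxAr.
Qed.
End TransferAlgebra.

Section Transform.
Context (R : realType) (d r : nat) (a : R) (HC : 'M[R[i]]_d) (V : 'M[R[i]]_(d, r)).
Hypothesis a_gt0 : 0 < a.
Hypothesis hHC : HC = HC ^t*.
Local Notation C := R[i].
Local Notation borel := (measurableTypeR R).
Local Notation leb := (@lebesgue_measure R).
Local Notation D := (`](- (2 * a)), (2 * a)[%classic : set borel).
Local Notation L2v := (L2v leb D).
Local Notation hat := (hat leb (chebphi a)).
Local Notation pairing := (@pairing _ _ R leb _).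
Local Notation H := (hilb R d r).
Local Notation T := (J a HC V).
Local Notation pencil := (pencil HC).
Local Notation chi := (chi HC).
Local Notation pw := (pw HC V).
Local Notation jost := (jost a HC V).
Local Notation jost_inv := (jost_inv a HC V).
Local Notation delta0 := (delta0 a).
Local Notation real := (realize a_gt0).

Let pL := chebphi_L2 a_gt0.
Let rL k g : L2v (@realize R a a_gt0 k g) := realize_L2v a_gt0 g.
Local Notation lshift g := (fun n : nat => g n.+1).

Lemma bmeas_pencil : entrywise (bmeas D) (fun x : borel => pencil x).
Proof.
move=> i j; rewrite (_ : (fun x => _) = (fun x => (i == j)%:R * x%:C + - HC i j)).
  apply: bmeasD; last exact: bmeas_cst.
  by apply: bmeasM; [exact: bmeas_cst|exact: bmeas_id].
by apply/funext => x; rewrite !mxE mulr_natl.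
Qed.

Let bm_add := @bmeasD _ borel R D.
Let bm_mul := @bmeasM _ borel R D.
Let bm_cst := @bmeas_cst _ borel R D.

Lemma bmeas_chi : bmeas D (fun x : borel => chi x).
Proof. exact (alg_det bm_cst bm_add bm_mul bmeas_pencil). Qed.

Lemma bmeas_pw : entrywise (bmeas D) (fun x : borel => pw x).
Proof.
apply: (entrywiseM bm_cst bm_add bm_mul); last exact: (entrywise_cst bm_cst).
exact: (entrywise_adj bm_cst bm_add bm_mul bmeas_pencil).
Qed.

Lemma bmeas_zeta : bmeas D (fun x : borel => zeta a x).
Proof.
split.
  split => /=; first by apply: measurable_funM => //; exact: measurable_cst.
  apply: measurable_funM; last exact: measurable_cst.
  by apply: continuous_measurable_fun; exact: semic_continuous.
exists 1 => x; rewrite /= itv_abs => /ltW xa.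
have /eqP := zeta_norm a_gt0 xa; rewrite mulrC mul_conjc eq_complex => /andP[/eqP h _].
by rewrite -[leRHS]h.
Qed.

Lemma bmeas_jost : entrywise (bmeas D) (fun x : borel => jost x).
Proof.
have hchi : entrywise (bmeas D) (fun x : borel => (chi x)%:M : 'M[C]_r).
  move=> i j; under [X in bmeas _ X]eq_fun do rewrite mxE; case: (i == j); first exact: bmeas_chi.
  exact: bmeas_cst.
apply: (entrywiseD bm_add hchi); apply: (entrywiseN bm_cst bm_mul).
apply: (entrywiseZ bm_mul bmeas_zeta); apply: (entrywiseZ bm_mul (bm_cst _)).
by apply: (entrywiseM bm_cst bm_add bm_mul (entrywise_cst bm_cst _)); exact: bmeas_pw.
Qed.

Lemma pairingDr k (F G G' : borel -> 'cV[C]_k) : L2v F -> L2v G -> L2v G' ->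
  pairing F (fun x => G x + G' x) = pairing F G + pairing F G'.
Proof.
move=> hF hG hG'; rewrite (pairing_conj (L2vD hG hG') hF) (pairingDl hG hG' hF) conjcD.
by rewrite -!(pairing_conj _ hF).
Qed.

Lemma pairingZr k z (F G : borel -> 'cV[C]_k) : L2v F -> L2v G ->
  pairing F (fun x => z *: G x) = z^*%C * pairing F G.
Proof.
move=> hF hG; rewrite (pairing_conj (L2vZ z hG) hF) (pairingZl z hG hF) conjcM.
by rewrite -(pairing_conj hG hF).
Qed.

Lemma pairingBl k (F F' G : borel -> 'cV[C]_k) : L2v F -> L2v F' -> L2v G ->
  pairing (fun x => F x - F' x) G = pairing F G - pairing F' G.
Proof.
move=> hF hF' hG; rewrite -mulN1r -(pairingZl _ hF' hG) -(pairingDl hF (L2vZ _ hF') hG).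
by congr cint; apply/funext => x; rewrite scaleN1r.
Qed.

Lemma pairingBr k (F G G' : borel -> 'cV[C]_k) : L2v F -> L2v G -> L2v G' ->
  pairing F (fun x => G x - G' x) = pairing F G - pairing F G'.
Proof.
move=> hF hG hG'; rewrite (pairing_conj (L2vB hG hG') hF) (pairingBl hG hG' hF).
by rewrite conjc_is rmorphB/= -!conjc_is -!(pairing_conj _ hF).
Qed.

Lemma pairing_aer k (F G G' : borel -> 'cV[C]_k) : L2v F -> L2v G -> L2v G' ->
  {ae leb, forall x, G x = G' x} -> pairing F G = pairing F G'.
Proof.
move=> hF hG hG' e; rewrite (pairing_conj hG hF) (pairing_conj hG' hF).
by rewrite (pairing_ae hG hG' hF e).
Qed.

(** By [hdot_Synth] this is the adjoint of [Synth]: the left shift here is the adjoint of the right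
    shift in [synth]. With the formula given outright, [transform_J] reduces to a pointwise
    check. *)
Definition transform (f : H) (x : borel) : 'cV[C]_r :=
  chi x *: real (hval f).2 x +
  (pw x)^t* *m (delta0 (hval f).1 x -
    (a^-1)%:C *: (V *m real (lshift (hval f).2) x)).

Let l2_hval (f : H) : l2 (hval f).2.
Proof. by have /asboolP := hvalP f. Qed.

Lemma transform_L2v f : L2v (transform f).
Proof.
apply: L2vD; first exact: L2v_bscale bmeas_chi (rL _).
apply: L2v_bmul; first exact: bmeas_adjoint bmeas_pw.
apply: L2vB; first exact: delta0_L2v.
exact/L2vZ/L2v_mx/rL.
Qed.

Let real_unique k (g : nat -> 'cV[C]_k) F : L2v F -> hat F = g ->
  {ae leb, forall x, real g x = F x}.
Proof. exact: realize_ae. Qed.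

Lemma transform_linear z f g :
  {ae leb, forall x, transform (z *: f + g) x = z *: transform f x + transform g x}.
Proof.
have h1 := @real_unique _ (hval (z *: f + g)).2 _ (L2vD (L2vZ z (rL (hval f).2)) (rL (hval g).2)).
have h2 := @real_unique _ (lshift (hval (z *: f + g)).2) _
  (L2vD (L2vZ z (rL (lshift (hval f).2))) (rL (lshift (hval g).2))).
apply: filterS2 (h1 _) (h2 _).
- move=> x e1 e2; rewrite /transform e1 e2 /delta0 /=.
  have -> (p c : C) (u v : 'cV[C]_d) (A B : 'cV[C]_r) :
      p *: (z *: u + v) - c *: (V *m (z *: A + B)) =
      z *: (p *: u - c *: (V *m A)) + (p *: v - c *: (V *m B)).
    rewrite mulmxDr -scalemxAr !scalerDr scalerN !scalerA opprD addrACA.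
    by rewrite (mulrC p) (mulrC c).
  by rewrite mulmxDr -scalemxAr !scalerDr !scalerA (mulrC (chi x)) addrACA.
- apply/funext => n; rewrite (hatD pL n (L2vZ z (rL _)) (rL _)) (hatZ pL z n (rL _)).
  by rewrite !hat_realize.
- apply/funext => n; rewrite (hatD pL n (L2vZ z (rL _)) (rL _)) (hatZ pL z n (rL _)).
  by rewrite !hat_realize//; exact: l2_lshift.
Qed.

Let ba : (a^-1)%:C * a%:C = 1 :> C.
Proof. by rewrite -(rmorphM (real_complex R))/= mulVf ?gt_eqF. Qed.

Let real_shift_mulX (g : nat -> 'cV[C]_r) : l2 g ->
  {ae leb, forall x, real (fun n => a%:C *: (g n + g n.+2)) x =
     x%:C *: real (lshift g) x + delta0 (a%:C *: g 0%N) x}.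
Proof.
move=> hg; have hg' := l2_lshift hg.
apply: real_unique; first exact: L2vD (L2v_mulX a_gt0 (rL _)) (delta0_L2v a_gt0 _).
apply/funext => n; rewrite (hatD pL n (L2v_mulX a_gt0 (rL _)) (delta0_L2v a_gt0 _)).
rewrite hat_delta0//; case: n => [|n].
  by rewrite hat_mulX0 ?hat_realize ?scale1r//= scalerDr addrC.
by rewrite hat_mulXS ?hat_realize ?scale0r ?addr0//; exact: rL.
Qed.

Lemma transform_J f : {ae leb, forall x, transform (T f) x = x%:C *: transform f x}.
Proof.
set u := (hval f).1; set g := (hval f).2; have hg : l2 g by exact: l2_hval.
have h1 : {ae leb, forall x, real (hval (T f)).2 x =
    x%:C *: real g x + delta0 (V^t* *m u) x}.
  apply: real_unique; first exact: L2vD (L2v_mulX a_gt0 (rL _)) (delta0_L2v a_gt0 _).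
  apply/funext => n; rewrite (hatD pL n (L2v_mulX a_gt0 (rL _)) (delta0_L2v a_gt0 _)).
  rewrite hat_delta0//; case: n => [|n].
    by rewrite hat_mulX0 ?hat_realize ?scale1r//; exact: rL.
  by rewrite hat_mulXS ?hat_realize ?scale0r ?addr0//; exact: rL.
have h2 := real_shift_mulX hg.
apply: filterS2 h1 h2 => x e1 e2.
rewrite /transform e1 [lshift _](_ : _ = (fun n => a%:C *: (g n + g n.+2)))// e2.
rewrite /delta0 -/u -/g /=.
rewrite /Defs.J_fun /=.
exact (transfer_mul V _ ba (pw_pencil V hHC x) _ _ _ _).
Qed.

(** An integral over x of formal eigenvectors of [J] at energy x: their first entry is phi_0 pw G,
    their sequence is phi_n chi G - a^-1 phi_(n-1) V^* pw G. The right shift supplies the index n -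
    1 and the value 0 at n = 0. *)
Definition synth (G : borel -> 'cV[C]_r) : 'cV[C]_d * (nat -> 'cV[C]_r) :=
  (hat (fun x => pw x *m G x) 0,
   fun n => hat (fun x => chi x *: G x) n -
     (a^-1)%:C *: rshift (hat (fun x => V^t* *m (pw x *m G x))) n).

Let pwL (G : borel -> 'cV[C]_r) : L2v G -> L2v (fun x => pw x *m G x).
Proof. exact: L2v_bmul bmeas_pw. Qed.

Let chiL (G : borel -> 'cV[C]_r) : L2v G -> L2v (fun x => chi x *: G x).
Proof. exact: L2v_bscale bmeas_chi. Qed.

Let VpwL (G : borel -> 'cV[C]_r) : L2v G -> L2v (fun x => V^t* *m (pw x *m G x)).
Proof. by move=> hG; exact/L2v_mx/pwL. Qed.

Let l2_rs (G : borel -> 'cV[C]_r) : L2v G -> l2 (rshift (hat (fun x => V^t* *m (pw x *m G x)))).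
Proof. by move=> hG; apply/l2_rshift/(hat_l2 a_gt0)/VpwL. Qed.

Let synthL (G : borel -> 'cV[C]_r) x : 'cV[C]_r := chi x *: G x -
  (a^-1)%:C *: real (rshift (hat (fun y => V^t* *m (pw y *m G y)))) x.

Let synthL_L2v (G : borel -> 'cV[C]_r) : L2v G -> L2v (synthL G).
Proof. by move=> hG; apply: L2vB; [exact: chiL|exact/L2vZ/rL]. Qed.

Let hat_synthL (G : borel -> 'cV[C]_r) : L2v G -> hat (synthL G) = (synth G).2.
Proof.
move=> hG; apply/funext => n; rewrite (hatB pL n (chiL hG) (L2vZ _ (rL _))).
by rewrite (hatZ pL _ n (rL _)) hat_realize//; exact: l2_rs.
Qed.

Lemma synth_in_hilb (G : borel -> 'cV[C]_r) : L2v G -> synth G \in @in_hilb R d r.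
Proof.
move=> hG; apply/asboolP; rewrite -(hat_synthL hG).
exact/(hat_l2 a_gt0)/synthL_L2v.
Qed.

Definition Synth (G : borel -> 'cV[C]_r) : H := insubd 0 (synth G).

Lemma SynthE (G : borel -> 'cV[C]_r) : L2v G -> hval (Synth G) = synth G.
Proof. by move=> hG; rewrite /Synth insubdK// synth_in_hilb. Qed.

Lemma hdot_Synth (G : borel -> 'cV[C]_r) f : L2v G -> hdot (Synth G) f = pairing G (transform f).
Proof.
move=> hG; rewrite (@hdotE _ a a_gt0 _ _ (Synth G) f (synthL G) (real (hval f).2)) ?SynthE//.
- have hS := L2vZ ((a^-1)%:C) (rL (rshift (hat (fun y => V^t* *m (pw y *m G y))))).
  have hA := rL (hval f).2; have hB := rL (lshift (hval f).2).
  have hd := delta0_L2v a_gt0 (hval f).1.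
  have hE := L2vZ ((a^-1)%:C) (L2v_mx V hB).
  have hb := bmeas_adjoint bmeas_pw.
  rewrite /transform (pairingDr hG (L2v_bscale bmeas_chi hA) (L2v_bmul hb (L2vB hd hE))).
  rewrite -pairing_adjoint.
  rewrite (pairingBr (pwL hG) hd hE) (pairingZr _ (pwL hG) (L2v_mx V hB)) conjcR.
  rewrite (pairingBl (chiL hG) hS hA) (pairingZl _ (rL _) hA).
  rewrite (@pairing_shift _ a a_gt0 _ _ _ _ _ (VpwL hG) (rL _) hA hB).
  + rewrite (pairing_adjoint _ (fun=> V^t*)) trmxCK (pairing_delta0 a_gt0 _ (pwL hG)).
    rewrite addrCA; congr (_ + _).
    congr cint; apply/funext => x; rewrite dotZl [RHS]dot_conj dotZl conjcM chi_real//.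
    by rewrite -dot_conj.
  + by rewrite hat_realize//; exact: l2_rs.
  + rewrite !hat_realize//; exact: l2_lshift.
- exact: synthL_L2v.
- exact: hat_synthL.
- exact: hat_realize.
Qed.

Lemma transform_Synth (G : borel -> 'cV[C]_r) : L2v G ->
  {ae leb, forall x, D x -> transform (Synth G) x = (jost x)^t* *m (jost x *m G x)}.
Proof.
move=> hG.
have h1 : {ae leb, forall x, real (hval (Synth G)).2 x = synthL G x}.
  by apply: real_unique; [exact: synthL_L2v|rewrite SynthE// hat_synthL].
pose Gs := hat (fun x => V^t* *m (pw x *m G x)).
have l2G : l2 (hat (fun x => chi x *: G x)) by exact/(hat_l2 a_gt0)/chiL.
have l2P : l2 (hat (fun x => pw x *m G x)) by exact/(hat_l2 a_gt0)/pwL.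
set B := real (lshift (hat (fun x => chi x *: G x))).
set e := real (lshift (hat (fun x => pw x *m G x))).
have h2 : {ae leb, forall x, real (lshift (hval (Synth G)).2) x =
    B x - (a^-1)%:C *: (V^t* *m (pw x *m G x))}.
  apply: real_unique; first exact: L2vB (rL _) (L2vZ _ (VpwL hG)).
  apply/funext => n; rewrite (hatB pL n (rL _) (L2vZ _ (VpwL hG))).
  by rewrite (SynthE hG) (hat_realize a_gt0 (l2_lshift l2G)) (hatZ pL _ n (VpwL hG)).
set h0 := hat (fun x => pw x *m G x) 0.
(* This is the left shift of V chi G = (x - HC) pw G. Multiplication by x commutes with the left
   shift up to the first coefficient, which produces [h0]. *)
have h3 : {ae leb, forall x, V *m B x = (x%:C%:M - HC) *m e x +
    (a%:C * (chebphi a 0 x)%:C) *: h0}.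
  have L1 := L2vB (L2v_mulX a_gt0 (rL (lshift (hat (fun x => pw x *m G x)))))
    (L2v_mx HC (rL (lshift (hat (fun x => pw x *m G x))))).
  have L2 := delta0_L2v a_gt0 (a%:C *: h0).
  have : {ae leb, forall x, V *m B x = x%:C *: e x - HC *m e x + delta0 (a%:C *: h0) x}.
    apply: (hat_inj pL (chebphi_total a_gt0) (L2v_mx V (rL _)) (L2vD L1 L2)) => n.
    rewrite (hatD pL n L1 L2) (hat_delta0 a_gt0) (hat_mx pL V n (rL _)).
    rewrite (hat_realize a_gt0 (l2_lshift l2G)) -(hat_mx pL V n.+1 (chiL hG)).
    rewrite (hatB pL n (L2v_mulX a_gt0 (rL _)) (L2v_mx HC (rL _))) (hat_mx pL HC n (rL _)).
    rewrite (hat_realize a_gt0 (l2_lshift l2P)).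
    rewrite (_ : (fun x => V *m (chi x *: G x)) =
      (fun x => x%:C *: (pw x *m G x) - HC *m (pw x *m G x))); last first.
      apply/funext => x; rewrite -scalemxAr scalemxAl -pencil_pw -mulmxA.
      by rewrite mulmxBl mul_scalar_mx.
    rewrite (hatB pL n.+1 (L2v_mulX a_gt0 (pwL hG)) (L2v_mx HC (pwL hG))).
    rewrite (hat_mx pL HC n.+1 (pwL hG)) (hat_mulXS a_gt0 n (pwL hG)).
    case: n => [|n].
      rewrite (hat_mulX0 a_gt0 (rL _)) (hat_realize a_gt0 (l2_lshift l2P)).
      by rewrite scale1r addrAC scalerDr; congr (_ + _); rewrite addrC.
    rewrite (hat_mulXS a_gt0 n (rL _)) (hat_realize a_gt0 (l2_lshift l2P)).
    by rewrite scale0r addr0.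
  apply: filterS => x ->; rewrite mulmxBl mul_scalar_mx; congr (_ + _).
  by rewrite /delta0 scalerA mulrC.
(* The sum of the right and the left shift is multiplication by x / a. *)
have h4 : {ae leb, forall x, real (rshift Gs) x + V^t* *m e x =
    ((a^-1)%:C * x%:C) *: (V^t* *m (pw x *m G x))}.
  have L1 := rL (rshift Gs).
  have L2 := L2v_mx (V^t*) (rL (lshift (hat (fun x => pw x *m G x)))).
  have L3 := L2vZ (a^-1)%:C (L2v_mulX a_gt0 (VpwL hG)).
  have : {ae leb, forall x, real (rshift Gs) x + V^t* *m e x =
      (a^-1)%:C *: (x%:C *: (V^t* *m (pw x *m G x)))}.
    apply: (hat_inj pL (chebphi_total a_gt0) (L2vD L1 L2) L3) => n.
    rewrite (hatD pL n L1 L2) (hatZ pL _ n (L2v_mulX a_gt0 (VpwL hG))).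
    rewrite (hat_realize a_gt0 (l2_rs hG)) (hat_mx pL _ n (rL _)).
    rewrite (hat_realize a_gt0 (l2_lshift l2P)) -(hat_mx pL _ n.+1 (pwL hG)).
    case: n => [|n].
      by rewrite (hat_mulX0 a_gt0 (VpwL hG)) scalerA ba scale1r add0r.
    by rewrite (hat_mulXS a_gt0 n (VpwL hG)) scalerA ba scale1r.
  by apply: filterS => x ->; rewrite scalerA.
apply: filterS2 (filterI h1 h2) (filterI h3 h4) => x [e1 e2] [e3 e4].
rewrite /= itv_abs => /ltW xa.
rewrite /transform e1 e2 SynthE// /synthL /delta0.
rewrite (transfer_gram ba (pw_pencil V hHC x) _ e3 e4).
by rewrite jost_gram_mul.
Qed.

End Transform.

(** * Normalization of the transform to a co-isometry *)

Lemma cvg_integral_exhaust d (T : measurableType d) (R : realType)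
    (mu : {measure set T -> \bar R}) (K : nat -> set T) (g : T -> R) :
  (forall k, measurable (K k)) -> (forall k j, (k <= j)%N -> K k `<=` K j) ->
  measurable_fun setT g -> (forall x, 0 <= g x) ->
  (\int[mu]_x (\1_(K k) x * g x)%:E)%E @[k --> \oo] -->
  (\int[mu]_x (\1_(\bigcup_k K k) x * g x)%:E)%E.
Proof.
move=> mK ndK mg g0.
have := @cvg_monotone_convergence _ _ _ mu setT measurableT
  (fun k x => (\1_(K k) x * g x)%:E) _ _ _.
rewrite (_ : (fun x => limn _) = (fun x => (\1_(\bigcup_k K k) x * g x)%:E)); last first.
  apply/funext => x; apply/cvg_lim => //.
  have [[k _ Kx]|nKx] := pselect ((\bigcup_k K k) x).
    apply: (@cvg_near_cst _ _ _ _ _).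
    exists k => // j /= kj; rewrite !indicE !mem_set//; first by exists k.
    exact: ndK kj _ Kx.
  apply: (@cvg_near_cst _ _ _ _ _); apply: nearW => j.
  by rewrite !indicE !memNset// => Kx; apply: nKx; exists j.
apply=> [k|k x _|x _ k j kj].
- by apply/measurable_EFinP/measurable_funM => //; exact: measurable_indic.
- by rewrite lee_fin mulr_ge0.
- rewrite lee_fin ler_wpM2r// !indicE; case: (asboolP (K k x)) => [Kx|nK].
    by rewrite !mem_set//; exact: ndK kj _ Kx.
  by rewrite (memNset nK) ler0n.
Qed.

Section Diagonalization.
Context (R : realType) (d r : nat) (a : R) (HC : 'M[R[i]]_d) (V : 'M[R[i]]_(d, r)).
Hypothesis a_gt0 : 0 < a.
Hypothesis hHC : HC = HC ^t*.
Local Notation C := R[i].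
Local Notation borel := (measurableTypeR R).
Local Notation leb := (@lebesgue_measure R).
Local Notation D := (`](- (2 * a)), (2 * a)[%classic : set borel).
Local Notation L2v := (L2v leb D).
Local Notation pairing := (@pairing _ _ R leb _).
Local Notation H := (hilb R d r).
Local Notation T := (J a HC V).
Local Notation transform := (transform HC V a_gt0).
Local Notation Synth := (Synth a HC V).
Local Notation jost := (jost a HC V).
Local Notation jost_inv := (jost_inv a HC V).
Local Notation sqnorm := (sqnorm (@hdot R d r)).
Implicit Types (F G : borel -> 'cV[C]_r).

Let ipH : inner_product (@hdot R d r) := @hdot_inner_product R d r.

Definition diag_transform (f : H) (x : borel) : 'cV[C]_r :=
  (jost_inv x)^t* *m transform f x.
Local Notation U := diag_transform.

(** On [nice k] the inverse of [jost] is bounded, and by [jost_unit] these sets exhaust D up to a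
    null set. *)
Definition nice (k : nat) : set borel :=
  D `&` [set x | k.+1%:R^-1 <= sqmod (\det (jost x))].

Definition cut (k : nat) (x : borel) : C := (\1_(nice k) x)%:C.

Definition nice_inv (k : nat) (x : borel) : 'M[C]_r := cut k x *: jost_inv x.

Let mdet : cmeas (fun x : borel => \det (jost x)).
Proof.
have := alg_det (@bmeas_cst _ borel R D) (@bmeasD _ borel R D) (@bmeasM _ borel R D).
by move=> /(_ _ _ (bmeas_jost HC V a_gt0)) [].
Qed.

Lemma measurable_nice k : measurable (nice k).
Proof.
apply: measurableI; first exact: measurable_itv.
have := sqmod_measurable mdet measurableT (measurable_itv `[k.+1%:R^-1, +oo[).
by rewrite setTI; congr measurable; apply/seteqP; split => x /=; rewrite in_itv/= andbT.
Qed.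

Lemma nice_mono k j : (k <= j)%N -> nice k `<=` nice j.
Proof.
move=> kj x [Dx hx]; split => //=; apply: le_trans hx.
by rewrite lef_pV2 ?posrE// ler_nat.
Qed.

Lemma nice_det k x : nice k x -> \det (jost x) != 0.
Proof.
move=> [_ /=]; apply: contraTneq => ->.
by rewrite /sqmod /= expr0n addr0 -ltNge invr_gt0.
Qed.

Lemma nice_cover x : D x -> \det (jost x) != 0 -> (\bigcup_k nice k) x.
Proof.
move=> Dx d0.
have q0 : 0 < sqmod (\det (jost x)).
  by rewrite lt_neqAle sqmod_ge0 andbT eq_sym sqmod_eq0.
exists (Num.truncn (sqmod (\det (jost x)))^-1) => //; split => //=.
by rewrite -[leRHS]invrK lef_pV2 ?posrE ?invr_gt0// ltW// truncnS_gt.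
Qed.

Lemma nice_ae : {ae leb, forall x, D x -> (\bigcup_k nice k) x}.
Proof.
apply: filterS (chi_ae HC) => x cx Dx; apply: nice_cover => //.
by apply: (jost_unit V a_gt0 hHC) => //; rewrite -itv_abs.
Qed.

Lemma cut_out k x : ~ nice k x -> cut k x = 0.
Proof. by move=> h; rewrite /cut indicE memNset. Qed.

Lemma cut_in k x : nice k x -> cut k x = 1.
Proof. by move=> h; rewrite /cut indicE mem_set. Qed.

Lemma cut_mul k j x : (k <= j)%N -> cut k x * cut j x = cut k x.
Proof.
move=> kj; case: (pselect (nice k x)) => h.
  by rewrite !cut_in ?mulr1//; exact: nice_mono h.
by rewrite cut_out// mul0r.
Qed.

Lemma cut_real k x : (cut k x)^*%C = cut k x.
Proof. exact: conjcR. Qed.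

Lemma bmeas_cut k : bmeas D (cut k).
Proof.
split; first by apply: cmeas_real; apply: measurable_indic; exact: measurable_nice.
exists 1 => x _; rewrite /sqmod /= expr0n addr0 indicE.
by case: (_ \in _); rewrite ?expr1n ?expr0n.
Qed.

Lemma bmeas_nice_inv k : entrywise (bmeas D) (nice_inv k).
Proof.
have h : bmeas D (fun x => cut k x * (\det (jost x))^-1).
  split; first by apply: cmeasM; [case: (bmeas_cut k)|exact: cmeasV].
  exists k.+1%:R => x _; rewrite sqmodM; case: (pselect (nice k x)) => hx.
    have -> : sqmod (cut k x) = 1 by rewrite cut_in// /sqmod /= expr1n expr0n addr0.
    rewrite mul1r.
    have d0 := nice_det hx; have [_ /= hq] := hx.
    have : sqmod (\det (jost x)) * sqmod (\det (jost x))^-1 = 1.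
      by rewrite -sqmodM mulfV// /sqmod /= expr1n expr0n addr0.
    have q0 : 0 < sqmod (\det (jost x)) by apply: lt_le_trans hq; rewrite invr_gt0.
    move=> /(canRL (mulKf _)) ->; last by rewrite gt_eqF.
    by rewrite mulr1 -[leRHS]invrK lef_pV2 ?posrE ?invr_gt0.
  by rewrite cut_out// /sqmod /= expr0n addr0 mul0r.
rewrite (_ : nice_inv k = fun x => (cut k x * (\det (jost x))^-1) *: \adj (jost x)); last first.
  by apply/funext => x; rewrite /nice_inv -scalerA.
apply: (entrywiseZ (@bmeasM _ borel R D) h).
apply: (entrywise_adj (@bmeas_cst _ borel R D) (@bmeasD _ borel R D) (@bmeasM _ borel R D)).
exact: bmeas_jost.
Qed.

Let cutL k F : L2v F -> L2v (fun x => cut k x *: F x).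
Proof. exact: L2v_bscale (bmeas_cut k). Qed.

Let niceL k F : L2v F -> L2v (fun x => nice_inv k x *m F x).
Proof. exact: L2v_bmul (bmeas_nice_inv k). Qed.

(** By [hdot_partial] and [diag_transform_partial] this is adjoint to [cut k] times U, and U inverts
    it on [nice k]. The adjoint of the whole of U arises as its limit in k. *)
Definition partial_inverse k F : H := Synth (fun x => nice_inv k x *m F x).
Local Notation W := partial_inverse.

Lemma cut_diag_transform k f x :
  (nice_inv k x)^t* *m transform f x = cut k x *: U f x.
Proof. by rewrite trmxCZ cut_real -scalemxAl. Qed.

Lemma cutU_L2v k f : L2v (fun x => cut k x *: U f x).
Proof.
rewrite (_ : (fun x => _) = (fun x => (nice_inv k x)^t* *m transform f x)); last first.
  by apply/funext => x; rewrite cut_diag_transform.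
apply: L2v_bmul; first exact/bmeas_adjoint/bmeas_nice_inv.
exact: transform_L2v.
Qed.

Lemma hdot_partial k F f : L2v F -> hdot (W k F) f = pairing F (fun x => cut k x *: U f x).
Proof.
move=> hF; rewrite (hdot_Synth V a_gt0 hHC f (niceL k hF)) pairing_adjoint.
by congr cint; apply/funext => x; rewrite cut_diag_transform.
Qed.

Lemma diag_transform_out f x : ~ D x -> U f x = 0.
Proof. by move=> Dx; rewrite /diag_transform (L2v_out (transform_L2v _ _ _ _)) ?mulmx0. Qed.

Lemma diag_transform_partial k F : L2v F ->
  {ae leb, forall x, U (W k F) x = cut k x *: F x}.
Proof.
move=> hF; apply: filterS (transform_Synth V a_gt0 hHC (niceL k hF)) => x.
case: (pselect (D x)) => Dx; last first.
  by move=> _; rewrite diag_transform_out// (L2v_out hF Dx) scaler0.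
move=> /(_ Dx); rewrite /diag_transform => ->.
rewrite /nice_inv -scalemxAl -!scalemxAr; case: (pselect (nice k x)) => hx; last first.
  by rewrite cut_out ?scale0r.
rewrite [_ *m (jost_inv x *m _)]mulmxA jost_invr ?(nice_det hx)// mul1mx.
by rewrite mulmxA -trmxCM jost_invr ?(nice_det hx)// trmxC_scalar conjc1 mul1mx.
Qed.

Lemma diag_transform_linear z f g :
  {ae leb, forall x, U (z *: f + g) x = z *: U f x + U g x}.
Proof.
apply: filterS (transform_linear HC V a_gt0 z f g) => x e.
by rewrite /diag_transform e mulmxDr -scalemxAr.
Qed.

Lemma diag_transform_J f : {ae leb, forall x, U (T f) x = x%:C *: U f x}.
Proof.
apply: filterS (transform_J V a_gt0 hHC f) => x e.
by rewrite /diag_transform e -scalemxAr.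
Qed.

Let L2sq F : R := complex.Re (pairing F F).
Let vs F (x : borel) : R := \sum_i sqmod (F x i 0).

Let vs_ge0 F x : 0 <= vs F x.
Proof. by apply: sumr_ge0 => i _; exact: sqmod_ge0. Qed.

Let L2sqE F : L2v F -> ((L2sq F)%:E = \int[leb]_x (vs F x)%:E)%E.
Proof. exact: pairing_self. Qed.

Let L2sq_ge0 F : L2v F -> 0 <= L2sq F.
Proof. by move=> hF; rewrite -lee_fin L2sqE//; apply: integral_ge0 => x _; rewrite lee_fin. Qed.

Let vs_meas F : (forall i, cmeas (fun x => F x i 0)) -> measurable_fun setT (vs F).
Proof. by move=> h; apply: measurable_sum => i; exact: sqmod_measurable. Qed.

Let pairing_selfC F : L2v F -> pairing F F = (L2sq F)%:C.
Proof.
move=> hF; rewrite /L2sq; have := pairing_conj hF hF; case: (pairing F F) => x y [] /= h.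
apply/eqP; rewrite eq_complex/= eqxx/=; apply/eqP; move: h; lra.
Qed.

Lemma pairing_cauchy_schwarz F G : L2v F -> L2v G ->
  sqmod (pairing F G) <= complex.Re (pairing F F) * complex.Re (pairing G G).
Proof.
(* For d = 0 the space [hilb] is the sequence space alone, so Cauchy-Schwarz for [pairing] follows
   from that for [hdot]. *)
have hP E : L2v E -> ((0 : 'cV[C]_0), hat leb (chebphi a) E) \in @in_hilb R 0 r.
  by move=> hE; apply/asboolP; exact: (hat_l2 a_gt0).
move=> hF hG; pose f := Hilb (hP _ hF); pose g := Hilb (hP _ hG).
have d0 (u v : 'cV[C]_0) : dot u v = 0 by rewrite /dot big_ord0.
have := cauchy_schwarz (@hdot_inner_product R 0 r) f g; rewrite /Defs.sqnorm.
by rewrite (hdotE a_gt0 (f := f) (g := g) hF hG)// (hdotE a_gt0 (f := f) (g := f) hF hF)//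
  (hdotE a_gt0 (f := g) (g := g) hG hG)// !d0 !add0r.
Qed.

Let cut_pairingC k F G : pairing (fun x => cut k x *: F x) G =
  pairing F (fun x => cut k x *: G x).
Proof.
congr cint; apply/funext => x; rewrite dotZl [RHS]dot_conj dotZl conjcM cut_real.
by rewrite -dot_conj.
Qed.

Let cut_cut k j F : (k <= j)%N ->
  (fun x => cut j x *: (cut k x *: F x)) = (fun x => cut k x *: F x).
Proof. by move=> kj; apply/funext => x; rewrite scalerA mulrC cut_mul. Qed.

Let cut_vs k F x : vs (fun x => cut k x *: F x) x = \1_(nice k) x * vs F x.
Proof.
rewrite /vs mulr_sumr; apply: eq_bigr => i _; rewrite mxE sqmodM; congr (_ * _).
rewrite /cut indicE /sqmod /= expr0n addr0.
by case: (_ \in _); rewrite ?expr1n ?expr0n.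
Qed.

Let hdot_WW k j F : L2v F -> (k <= j)%N ->
  hdot (W j F) (W k F) = pairing F (fun x => cut k x *: F x).
Proof.
move=> hF kj; rewrite hdot_partial//.
rewrite (@pairing_aer _ a _ _ _ (fun x => cut j x *: (cut k x *: F x)) hF) ?cut_cut//.
- exact: cutU_L2v.
- exact: cutL.
- apply: filterS (diag_transform_partial k hF) => x ->.
  by rewrite scalerA mulrC cut_mul.
Qed.

(* From 0 <= |f - W G|^2 with G the restriction of U f to nice k. *)
Let cutU_le k f : L2sq (fun x => cut k x *: U f x) <= sqnorm f.
Proof.
set G := fun x => _; have hG : L2v G by exact: cutU_L2v.
have GG : (fun x => cut k x *: G x) = G by exact: cut_cut.
have := sqnorm_ge0 ipH (f - W k G); rewrite (sqnormB ipH).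
have -> : sqnorm (W k G) = L2sq G.
  transitivity (complex.Re (pairing G (fun x => cut k x *: G x))); last by rewrite GG.
  exact: congr1 (hdot_WW hG (leqnn k)).
have -> : hdot f (W k G) = (L2sq G)%:C.
  by rewrite (ip_conj ipH (W k G) f) (hdot_partial k f hG) (pairing_selfC hG) conjcR.
by move=> /=; lra.
Qed.

Let U_off f x : ~ (\bigcup_k nice k) x -> U f x = 0.
Proof.
move=> h; have [Dx|] := pselect (D x); last exact: diag_transform_out.
have d0 : \det (jost x) = 0.
  by apply/eqP/negPn/negP => /(nice_cover Dx).
by rewrite /diag_transform /jost_inv d0 invr0 scale0r trmx0 map_mx0 mul0mx.
Qed.

Let U_cmeas f i : cmeas (fun x => U f x i 0).
Proof.
have c1 := @cmeas_cst _ borel R; have c2 := @cmeasD _ borel R; have c3 := @cmeasM _ borel R.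
have h1 : entrywise (@cmeas _ borel R) (fun x : borel => (jost_inv x)^t*).
  move=> p q; under eq_fun do rewrite !mxE; apply: cmeas_conj; apply: cmeasM.
    exact: cmeasV.
  have := entrywise_adj (@bmeas_cst _ borel R D) (@bmeasD _ borel R D) (@bmeasM _ borel R D)
    (bmeas_jost HC V a_gt0) q p.
  by case; under eq_fun do rewrite mxE.
have h2 : entrywise (@cmeas _ borel R) (fun x : borel => transform f x).
  by move=> p q; rewrite ord1; exact: CL2_cmeas (transform_L2v HC V a_gt0 f p).
exact: (entrywiseM c1 c2 c3 h1 h2).
Qed.

(** Monotone convergence applied to [cutU_le], whose bound does not depend on k. This makes [U f]
    square integrable although the inverse of [jost] may be unbounded. *)
Let U_int_le f : (\int[leb]_x (vs (U f) x)%:E <= (sqnorm f)%:E)%E.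
Proof.
have := cvg_integral_exhaust (mu := leb) measurable_nice nice_mono (vs_meas (U_cmeas f)) (vs_ge0 (U f)).
rewrite [X in _ --> X](_ : _ = (\int[leb]_x (vs (U f) x)%:E)%E); last first.
  apply: eq_integral => x _; rewrite indicE; case: (pselect ((\bigcup_k nice k) x)) => hx.
    by rewrite mem_set// mul1r.
  rewrite memNset// mul0r /vs big1// => i _.
  by rewrite U_off// mxE /sqmod /= expr0n addr0.
move=> h; rewrite -(cvg_lim (@ereal_hausdorff R) h); apply: lime_le.
  by apply/cvg_ex; eexists; exact: h.
apply: nearW => k; rewrite [leLHS](_ : _ = (L2sq (fun x => cut k x *: U f x))%:E).
  by rewrite lee_fin cutU_le.
rewrite L2sqE; last exact: cutU_L2v.
by apply: eq_integral => x _; rewrite cut_vs.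
Qed.

Lemma diag_transform_L2v f : L2v (U f).
Proof.
move=> i; apply/CL2_sqmod; split; first exact: U_cmeas.
  apply/integrableP; split.
    by apply/measurable_EFinP; apply: sqmod_measurable; exact: U_cmeas.
  apply: le_lt_trans (ltry (sqnorm f)); apply: le_trans (U_int_le f).
  apply: ge0_le_integral => //.
  - by apply/measurable_EFinP/measurableT_comp => //; apply: sqmod_measurable; exact: U_cmeas.
  - by apply/measurable_EFinP; apply: vs_meas => j; exact: U_cmeas.
  - move=> x _; rewrite lee_fin ger0_norm ?sqmod_ge0// /vs (bigD1 i)//= lerDl.
    by apply: sumr_ge0 => j _; exact: sqmod_ge0.
by move=> x Dx; rewrite diag_transform_out// mxE.
Qed.

Let tail k F : R := L2sq F - complex.Re (pairing F (fun x => cut k x *: F x)).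

Let pairing_cut_self k F : L2v F ->
  pairing F (fun x => cut k x *: F x) = (L2sq (fun x => cut k x *: F x))%:C.
Proof.
move=> hF; rewrite -(pairing_selfC (cutL k hF)) -cut_pairingC.
by rewrite [RHS]cut_pairingC (cut_cut F (leqnn k)) cut_pairingC.
Qed.

Let tail_sq k F : L2v F -> L2sq (fun x => F x - cut k x *: F x) = tail k F.
Proof.
move=> hF; have hc := cutL k hF.
rewrite {1}/L2sq (pairingBl hF hc (L2vB hF hc)) (pairingBr hF hF hc) (pairingBr hc hF hc).
rewrite cut_pairingC (pairing_cut_self k hF) (pairing_selfC hF) (pairing_selfC hc).
by rewrite subrr subr0 /tail (pairing_cut_self k hF) /= .
Qed.

Let tail_cvg F : L2v F -> tail ^~ F @ \oo --> (0 : R).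
Proof.
move=> hF.
have := cvg_integral_exhaust (mu := leb) measurable_nice nice_mono
  (vs_meas (fun i => CL2_cmeas (hF i))) (vs_ge0 F).
have -> : (\int[leb]_x (\1_(\bigcup_k nice k) x * vs F x)%:E = (L2sq F)%:E)%E.
  rewrite L2sqE//; apply: ae_eq_integral => //.
  - apply/measurable_EFinP/measurable_funM.
      by apply: measurable_indic; apply: bigcup_measurable => k _; exact: measurable_nice.
    by apply: vs_meas => i; exact: CL2_cmeas (hF i).
  - by apply/measurable_EFinP; apply: vs_meas => i; exact: CL2_cmeas (hF i).
  - apply: filterS nice_ae => x hx _; rewrite indicE.
    have [Dx|Dx] := pselect (D x); first by rewrite mem_set ?mul1r//; exact: hx.
    rewrite /vs big1 ?mulr0// => i _.
    by rewrite (L2v_out hF Dx) mxE /sqmod /= expr0n addr0.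
rewrite (_ : (fun k => _) = EFin \o (fun k => L2sq F - tail k F)); last first.
  apply/funext => k /=; rewrite /tail opprB addrC subrK pairing_cut_self// L2sqE; last exact: cutL.
  by apply: eq_integral => x _; rewrite cut_vs.
move=> /fine_cvgP[_] h.
rewrite (_ : tail ^~ F = (fun k => L2sq F - (L2sq F - tail k F))); last first.
  by apply/funext => k; rewrite opprB addrC subrK.
rewrite -(subrr (L2sq F)); apply: cvgB; first exact: cvg_cst.
exact: h.
Qed.

Let sqnormB_le (w v : H) (A B t : R) : sqnorm w = A -> sqnorm v = B ->
  complex.Re (hdot w v) = B -> A - B <= t -> sqnorm (w - v) <= t.
Proof. by move=> hw hv hwv h; rewrite (sqnormB ipH) hw hv hwv; lra. Qed.

Let partial_tail k j F : L2v F -> (k <= j)%N -> sqnorm (W j F - W k F) <= tail k F.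
Proof.
move=> hF kj; apply: (sqnormB_le (congr1 (@complex.Re R) (hdot_WW hF (leqnn j)))
  (congr1 (@complex.Re R) (hdot_WW hF (leqnn k))) (congr1 (@complex.Re R) (hdot_WW hF kj))).
have t0 : 0 <= tail j F by rewrite -(tail_sq j hF); exact: L2sq_ge0 (L2vB hF (cutL j hF)).
by apply: lerB; [rewrite -subr_ge0; exact: t0|exact: lexx].
Qed.

Let L2sq_eq0 F : L2v F -> L2sq F = 0 -> {ae leb, forall x, F x = 0}.
Proof.
move=> hF F0; have h0 : forall i, cmeas (fun x => F x i 0) by move=> i; exact: CL2_cmeas (hF i).
have : (\int[leb]_x `|(vs F x)%:E| = 0)%E.
  by under eq_integral do rewrite gee0_abs ?lee_fin//; rewrite -L2sqE// F0.
move/ae_eq_integral_abs => /(_ measurableT) h.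
have /h : measurable_fun setT (fun x => (vs F x)%:E) by apply/measurable_EFinP; exact: vs_meas.
apply: filterS => x /= /(_ Logic.I) [] v0; apply/matrixP => i j; rewrite ord1 mxE.
apply: sqmod_le0; rewrite -v0 /vs (bigD1 i)//= lerDl.
by apply: sumr_ge0 => k _; exact: sqmod_ge0.
Qed.

(** The vectors [W k F] are Cauchy with rate [tail k F], and their limit is the required h. The
    identity passes to the limit by Cauchy-Schwarz, once in H and once for functions. *)
Let adjoint_exists F : L2v F ->
  exists h, forall f, hdot h f = pairing F (U f).
Proof.
move=> hF.
have [h hh] := hilb_complete (tail_cvg hF) (fun k j kj => @partial_tail k j F hF kj).
exists h => f; have hU := diag_transform_L2v f.
apply/eqP; rewrite -subr_eq0; apply/eqP/sqmod_le0.
have bound k : sqmod (hdot h f - pairing F (U f)) <=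
    tail k F * (2 * sqnorm f + 2 * L2sq (U f)).
  have -> : hdot h f - pairing F (U f) = hdot (h - W k F) f +
      - pairing (fun x => F x - cut k x *: F x) (U f).
    rewrite (ipBl ipH) (hdot_partial k f hF) -cut_pairingC (pairingBl hF (cutL k hF) hU).
    by ring.
  apply: le_trans (sqmodD_le _ _) _.
  have -> z : sqmod (- z) = sqmod z by case: (z) => p q; rewrite /sqmod /= !sqrrN.
  have t0 : 0 <= tail k F by rewrite -(tail_sq k hF); exact: L2sq_ge0 (L2vB hF (cutL k hF)).
  have b1 : sqmod (hdot (h - W k F) f) <= tail k F * sqnorm f.
    apply: le_trans (cauchy_schwarz ipH _ _) _.
    by rewrite ler_wpM2r ?(sqnorm_ge0 ipH)//; exact: hh.
  have b2 : sqmod (pairing (fun x => F x - cut k x *: F x) (U f)) <= tail k F * L2sq (U f).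
    apply: le_trans (pairing_cauchy_schwarz (L2vB hF (cutL k hF)) hU) _.
    by rewrite -(tail_sq k hF).
  lra.
have : (fun k => tail k F * (2 * sqnorm f + 2 * L2sq (U f))) @ \oo --> (0 : R).
  by rewrite -[X in _ --> X](mul0r (2 * sqnorm f + 2 * L2sq (U f))); apply: cvgM; [exact: tail_cvg|exact: cvg_cst].
by move=> /cvgr_to_ge; apply; apply: nearW.
Qed.

Theorem diag_transform_adjoint F : L2v F -> exists h,
  {ae leb, forall x, U h x = F x} /\ forall f, hdot h f = pairing F (U f).
Proof.
move=> hF; have [h hh] := adjoint_exists hF; exists h; split => //.
have hU := diag_transform_L2v h.
(* The inner product of h with [W k G], for G the truncated difference, is computed from the adjoint
   relation and from [hdot_partial]; comparing the two gives G norm zero. *)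
have cut0 k : {ae leb, forall x, cut k x *: (U h x - F x) = 0}.
  pose G x := cut k x *: (U h x - F x).
  have hG : L2v G by exact: cutL (L2vB hU hF).
  apply: (L2sq_eq0 hG); rewrite /L2sq {1}/G cut_pairingC.
  have e1 := hh (W k G).
  have e2 : pairing F (U (W k G)) = pairing F (fun x => cut k x *: G x).
    apply: (pairing_aer hF (diag_transform_L2v _) (cutL k hG)).
    exact: diag_transform_partial.
  have e3 : hdot h (W k G) = pairing (U h) (fun x => cut k x *: G x).
    rewrite (ip_conj ipH (W k G) h) (hdot_partial k h hG) -cut_pairingC.
    by rewrite -(pairing_conj (cutL k hG) hU).
  by rewrite (pairingBl hU hF (cutL k hG)) -e2 -e1 e3 subrr.
have : {ae leb, forall x, forall k, cut k x *: (U h x - F x) = 0}.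
  exact/ae_foralln.
apply: filterS2 nice_ae => x hx cx.
have [Dx|Dx] := pselect (D x).
  have [k _ kx] := hx Dx; have := cx k; rewrite cut_in// scale1r => /eqP.
  by rewrite subr_eq0 => /eqP.
by rewrite diag_transform_out// (L2v_out hF Dx).
Qed.

(** The normalization is invertible almost everywhere, so the kernel may be studied through
    [transform], whose coefficients are polynomial. *)
Lemma diag_transform_ker f : {ae leb, forall x, U f x = 0} ->
  {ae leb, forall x, transform f x = 0}.
Proof.
move=> Uf0; apply: filterS2 Uf0 (chi_ae HC) => x Ux cx.
have [Dx|Dx] := pselect (D x); last by rewrite (L2v_out (transform_L2v _ _ _ _)).
have d0 := jost_unit V a_gt0 hHC _ cx; have := congr1 (mulmx ((jost x)^t*)) Ux.
rewrite /diag_transform mulmxA -trmxCM jost_invl ?d0 -?itv_abs//.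
by rewrite trmxC_scalar conjc1 mul1mx mulmx0.
Qed.

End Diagonalization.

(** * Finite dimension of the kernel *)

Section FiniteDimension.
Context (R : realType) (H : lmodType R[i]).
Implicit Types (f g : H) (M : set H).

(** The spanning vectors must lie in M, so that an operator preserving M can be expanded on them.
    There is at least one of them because square matrices of size n.+1 form a ring. *)
Definition spanned M : Prop := exists (n : nat) (b : 'I_n.+1 -> H),
  (forall i, M (b i)) /\
  forall f, M f -> exists c : 'I_n.+1 -> R[i], f = \sum_(i < n.+1) c i *: b i.

Lemma spanned_finite_dimensional M : spanned M -> finite_dimensional M.
Proof. by move=> [n [b [_ hb]]]; exists n.+1, b. Qed.

(** Finitely many separating functionals bound the dimension: the kernel of the last one is spanned
    by induction, and one vector on which it does not vanish is added. *)
Lemma spanned_functionals (m : nat) M (L : nat -> H -> R[i]) : M 0 ->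
  (forall z f g, M f -> M g -> M (z *: f + g)) ->
  (forall i z f g, (i < m)%N -> M f -> M g -> L i (z *: f + g) = z * L i f + L i g) ->
  (forall f, M f -> (forall i, (i < m)%N -> L i f = 0) -> f = 0) ->
  spanned M.
Proof.
elim: m M => [|m IH] M M_0 hM hL h0.
  by exists 0%N, (fun=> 0); split => // f Mf; exists (fun=> 0); rewrite big_ord1 scale0r; exact: h0.
have lt_S i : (i < m)%N -> (i < m.+1)%N by move=> /ltnW.
pose M0 := [set f | M f /\ L m f = 0].
have M0M f : M0 f -> M f by case.
have [n [b [Mb hb]]] : spanned M0.
  apply: IH => [|z f g [Mf Lf] [Mg Lg]|i z f g im /M0M Mf /M0M Mg|f [Mf Lf] hf].
  - split=> //; have /eqP := hL m 1 0 0 (ltnSn m) M_0 M_0.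
    by rewrite scale1r addr0 mul1r -subr_eq0 opprD addrA subrr sub0r oppr_eq0 => /eqP.
  - by split; [exact: hM|rewrite hL// Lf Lg mulr0 addr0].
  - by rewrite hL// lt_S.
  - by apply: h0 => // i; rewrite ltnS leq_eqVlt => /predU1P[->|/hf].
have [[e [Me Le]]|nex] := pselect (exists e, M e /\ L m e <> 0); last first.
  exists n, b; split=> [i|f Mf]; first exact: M0M.
  by apply: hb; split => //; apply: contrapT => Lf; apply: nex; exists f.
exists n.+1, (fun i => if unlift ord0 i is Some j then b j else e); split=> [i|f Mf].
  by case: (unlift ord0 i) => // j; exact: M0M.
have [] := hb (f - (L m f / L m e) *: e).
  rewrite addrC -scaleNr; split; first exact: hM.
  by rewrite hL// mulNr divfK ?addNr//; apply/eqP.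
move=> c hc; exists (fun i => if unlift ord0 i is Some j then c j else L m f / L m e).
rewrite big_ord_recl unlift_none -[LHS](subrK ((L m f / L m e) *: e)) addrC; congr (_ + _).
by rewrite hc; apply: eq_bigr => i _; rewrite liftK.
Qed.

Lemma spanned_separating (I : finType) M (L : I -> H -> R[i]) : M 0 ->
  (forall z f g, M f -> M g -> M (z *: f + g)) ->
  (forall i z f g, M f -> M g -> L i (z *: f + g) = z * L i f + L i g) ->
  (forall f, M f -> (forall i, L i f = 0) -> f = 0) ->
  spanned M.
Proof.
move=> M_0 hM hL h0.
pose L' (k : nat) f := if insub k is Some j then L (enum_val (j : 'I_#|I|)) f else 0.
apply: (@spanned_functionals #|I| M L') => // [k z f g km Mf Mg|f Mf hf].
  by rewrite /L'; case: insubP => [j _ _|]; [exact: hL|rewrite km].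
apply: h0 => // i; have := hf (enum_rank i) (ltn_ord _).
by rewrite /L' valK enum_rankK.
Qed.
End FiniteDimension.

(** * Linear recursions that run backwards *)

Section BackwardRecursion.
Context (F : fieldType).

(* The lowest nonzero coefficient of p lets one solve forwards, whereas the
   vector recursion below only runs backwards. *)
Lemma scalar_recursion_determined N (p : {poly F}) (x : nat -> F) :
  p != 0 -> (size p <= N.+1)%N ->
  (forall n, \sum_(k < N.+1) p`_k * x (n + (N - k))%N = 0) ->
  (forall n, (n < N)%N -> x n = 0) -> forall n, x n = 0.
Proof.
move=> p0 pN rec x0.
have ex_s : exists s, p`_s != 0 by exists (size p).-1; rewrite -lead_coefE lead_coef_eq0.
have [s ps smin] := ex_minnP ex_s.
have sN : (s <= N)%N.
  by rewrite -ltnS; apply: leq_trans pN; rewrite ltnNge; apply: contra ps => /(nth_default 0)->.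
elim/ltn_ind => n IH; have [|nN] := ltnP n N; first exact: x0.
(* At this index the term k = s carries x n; terms with k < s have coefficient 0 and those with k >
   s involve earlier values. *)
have := rec (n - (N - s))%N.
have sO : (s < N.+1)%N by [].
rewrite (bigD1 (Ordinal sO))//= subnK; last exact: leq_trans (leq_subr _ _) nN.
rewrite big1 ?addr0 => [/eqP|k ks].
  by rewrite mulf_eq0 (negPf ps) => /eqP.
have [ks'|sk] := ltnP k s.
  have /eqP -> : p`_k == 0 by apply/negPn/negP => /smin; rewrite leqNgt ks'.
  by rewrite mul0r.
have sk' : (s < k)%N.
  by rewrite ltn_neqAle sk andbT eq_sym; apply: contra ks => /eqP h; apply/eqP/val_inj.
rewrite IH ?mulr0// -[ltnRHS](subnK (leq_trans (leq_subr s N) nN)) ltn_add2l.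
by rewrite ltn_sub2l// (leq_trans sk')// -ltnS.
Qed.

(* Cayley-Hamilton for the companion matrix makes every coordinate satisfy a
   scalar recursion. *)
Lemma vector_recursion_determined d (A B : 'M[F]_d) (w : nat -> 'cV[F]_d) :
  (forall n, w n = A *m w n.+1 + B *m w n.+2) ->
  (forall n, (n <= d + d)%N -> w n = 0) -> forall n, w n = 0.
Proof.
case: d A B w => [|d] A B w rec w0.
  by move=> n; apply/matrixP => -[].
pose C : 'M[F]_((d + d.+1).+1) := block_mx A B 1%:M 0.
pose X n : 'cV[F]_((d + d.+1).+1) := col_mx (w n) (w n.+1).
have CX n : X n = C *m X n.+1.
  rewrite /X /C [RHS](mul_block_col A B 1%:M 0 (w n.+1) (w n.+2)).
  by rewrite -rec mul1mx mul0mx addr0.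
have CkX k n : C ^+ k *m X (n + k)%N = X n.
  elim: k n => [|k IH] n; first by rewrite expr0 mul1mx (addn0 n).
  by rewrite exprSr -mulmxE -mulmxA (addnS n k) -CX IH.
pose N := (d + d.+1).+1; pose p := char_poly C.
have XE n : (forall m, (m < N)%N -> X m = 0) -> X n = 0.
  move=> X0; apply/matrixP => i j; rewrite ord1 [RHS]mxE.
  apply: (@scalar_recursion_determined N p (fun n => X n i 0)) => [||m|m mN].
  - exact/monic_neq0/char_poly_monic.
  - by rewrite size_char_poly.
  - have ch0 : (horner_mx C p *m X (m + N)%N) i 0 = 0.
      by rewrite /p Cayley_Hamilton mul0mx [LHS]mxE.
    rewrite -[RHS]ch0 -{2}[p]coefK poly_def linear_sum/= mulmx_suml summxE.
    rewrite /p size_char_poly; apply: eq_bigr => k _; rewrite linearZ/= rmorphXn/= horner_mx_X.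
    rewrite -scalemxAl [RHS]mxE; congr (_ * _).
    have kN : (k <= N)%N by rewrite -ltnS.
    by rewrite -(CkX k (m + (N - k))%N) -addnA (subnK kN).
  - by rewrite X0// mxE.
(* [X m] with m < N also involves the entry of index m + 1 <= N, which accounts for the non-strict
   bound on the initial values. *)
move=> n; have /(XE n) : forall m, (m < N)%N -> X m = 0.
  move=> m mN; rewrite /X !w0 ?col_mx0//; first exact: ltnW.
move=> h; have := congr1 (@usubmx F d.+1 d.+1 1) h.
by rewrite (col_mxKu (w n) (w n.+1)) linear0.
Qed.
End BackwardRecursion.

(** * The kernel of the transform; symmetry and boundedness of [J] *)

Section KernelDimension.
Context (R : realType) (d r : nat) (a : R) (HC : 'M[R[i]]_d) (V : 'M[R[i]]_(d, r)).
Hypothesis a_gt0 : 0 < a.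
Hypothesis hHC : HC = HC ^t*.
Local Notation C := R[i].
Local Notation borel := (measurableTypeR R).
Local Notation leb := (@lebesgue_measure R).
Local Notation D := (`](- (2 * a)), (2 * a)[%classic : set borel).
Local Notation L2v := (L2v leb D).
Local Notation hat := (hat leb (chebphi a)).
Local Notation pairing := (@pairing _ _ R leb _).
Local Notation H := (hilb R d r).
Local Notation pencil := (pencil HC).
Local Notation chi := (chi HC).
Local Notation transform := (transform HC V a_gt0).
Local Notation delta0 := (delta0 a).
Local Notation real := (realize a_gt0).
Local Notation lshift g := (fun n : nat => g n.+1).

Let pL := chebphi_L2 a_gt0.
Let rL k g : L2v (@realize R a a_gt0 k g) := realize_L2v a_gt0 g.

Lemma hat_ae k (F G : borel -> 'cV[C]_k) : L2v F -> L2v G ->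
  {ae leb, forall x, F x = G x} -> hat F = hat G.
Proof.
move=> hF hG e; apply/funext => n; apply/matrixP => i j; rewrite ord1.
pose E (x : borel) : 'cV[C]_k := (chebphi a n x)%:C *: delta_mx i 0.
have hE : L2v E.
  move=> l; rewrite (_ : (fun x => _) = fun x => (delta_mx i 0 : 'cV[C]_k) l 0 * (chebphi a n x)%:C).
    exact: CL2_scale (CL2_phi pL n).
  by apply/funext => x; rewrite mxE mulrC.
have hatE' (P : borel -> 'cV[C]_k) : hat P n i 0 = pairing P E.
  rewrite mxE; congr cint; apply/funext => x.
  rewrite /dot (bigD1 i)// big1 ?addr0 => [|l li]; rewrite !mxE ?eqxx ?(negPf li).
    by rewrite [RHS]addr0 mulr1.
  by rewrite mulr0 conjc0 mulr0.
by rewrite !hatE' (pairing_ae hF hG hE e).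
Qed.

Let hat_ext k (F G : borel -> 'cV[C]_k) n : (forall x, F x = G x) -> hat F n = hat G n.
Proof. by move=> h; have -> : F = G by exact/funext. Qed.

Let hat0 k n : hat (fun=> 0 : 'cV[C]_k) n = 0.
Proof.
have L0 : L2v (fun=> 0 : 'cV[C]_k) by exact: L2v0.
by rewrite -[RHS](scale0r (hat (fun=> 0) n)) -(hatZ pL 0 n L0); apply: hat_ext => x; rewrite scale0r.
Qed.

Let shifted e k (F G : borel -> 'cV[C]_e) := forall n, (k <= n)%N -> hat F n = hat G n.+1.

(** Multiplication by x commutes with the left shift except at the first site, so each factor x
    costs one index. *)
Let shifted_mulX e k (F G : borel -> 'cV[C]_e) : L2v F -> L2v G -> shifted k F G ->
  shifted k.+1 (fun x => x%:C *: F x) (fun x => x%:C *: G x).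
Proof.
move=> hF hG h [//|n] kn.
rewrite (hat_mulXS a_gt0 n hF) (hat_mulXS a_gt0 n.+1 hG) !h//.
by rewrite (leq_trans (ltnW kn))// leqnSn.
Qed.

Lemma bmeas_poly (p : {poly C}) : bmeas D (fun x : borel => p.[x%:C]).
Proof.
elim/poly_ind: p => [|p c IH].
  by under [X in bmeas _ X]eq_fun do rewrite horner0; exact: bmeas_cst.
under [X in bmeas _ X]eq_fun do rewrite !hornerE.
by apply: bmeasD; [apply: bmeasM IH (bmeas_id a_gt0)|exact: bmeas_cst].
Qed.

Let shifted_poly e (p : {poly C}) (F G : borel -> 'cV[C]_e) : L2v F -> L2v G ->
  shifted 0 F G ->
  shifted (size p) (fun x => p.[x%:C] *: F x) (fun x => p.[x%:C] *: G x).
Proof.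
move=> hF hG h0; have z0 (K : borel -> 'cV[C]_e) m : L2v K ->
    hat (fun x => (0 : {poly C}).[x%:C] *: K x) m = 0.
  move=> hK; rewrite -[RHS](scale0r (hat K m)) -(hatZ pL 0 m hK).
  by apply: hat_ext => x; rewrite horner0.
elim/poly_ind: p => [n _|p c IH n]; first by rewrite !z0.
rewrite size_MXaddC; have eK (K : borel -> 'cV[C]_e) :
    (fun x => (p * 'X + c%:P).[x%:C] *: K x) =
    (fun x => x%:C *: (p.[x%:C] *: K x) + c *: K x).
  by apply/funext => x; rewrite !hornerE scalerDl scalerA mulrC.
have Lp (K : borel -> 'cV[C]_e) : L2v K -> L2v (fun x => p.[x%:C] *: K x).
  by move=> hK; exact: L2v_bscale (bmeas_poly p) hK.
have hat_e (K : borel -> 'cV[C]_e) m : L2v K -> hat (fun x => (p * 'X + c%:P).[x%:C] *: K x) m =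
    hat (fun x => x%:C *: (p.[x%:C] *: K x)) m + c *: hat K m.
  move=> hK; rewrite eK (hatD pL m (L2v_mulX a_gt0 (Lp K hK)) (L2vZ c hK)).
  by rewrite (hatZ pL c m hK).
rewrite (hat_e _ _ hF) (hat_e _ _ hG) => hn.
rewrite (h0 n)//; congr (_ + _); move: IH hn; have [->|p0] := eqVneq p 0 => IH hn.
  have zX (K : borel -> 'cV[C]_e) m : L2v K ->
      hat (fun x => x%:C *: ((0 : {poly C}).[x%:C] *: K x)) m = 0.
    move=> hK; rewrite -[RHS](scale0r (hat K m)) -(hatZ pL 0 m hK).
    by apply: hat_ext => x; rewrite horner0 !scale0r scaler0.
  by rewrite (zX _ _ hF) (zX _ _ hG).
exact: (shifted_mulX (Lp _ hF) (Lp _ hG) IH).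
Qed.

(** The factor that follows V^* in [transform]. Applying the pencil turns its adjugate into [chi],
    and on the kernel [chi] times the sequence is expressed by [eta] again; hence its coefficients
    satisfy a closed recursion in dimension d. *)
Definition eta (f : H) (x : borel) : 'cV[C]_d := \adj (pencil x) *m
  (delta0 (hval f).1 x - (a^-1)%:C *: (V *m real (lshift (hval f).2) x)).

Lemma transform_eta f x :
  transform f x = chi x *: real (hval f).2 x + V^t* *m eta f x.
Proof. by rewrite /transform (pw_adj V hHC) /eta mulmxA. Qed.

Lemma eta_L2v f : L2v (eta f).
Proof.
apply: L2v_bmul.
  exact: (entrywise_adj (@bmeas_cst _ borel R D) (@bmeasD _ borel R D)
    (@bmeasM _ borel R D) (bmeas_pencil HC a_gt0)).
apply: L2vB; first exact: delta0_L2v.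
exact/L2vZ/L2v_mx/rL.
Qed.

Lemma eta_linear z f g : {ae leb, forall x, eta (z *: f + g) x = z *: eta f x + eta g x}.
Proof.
have l2_hval (e : H) : l2 (hval e).2 by have /asboolP := hvalP e.
have h := @realize_ae _ a a_gt0 _ (lshift (hval (z *: f + g)).2) _
  (L2vD (L2vZ z (rL (lshift (hval f).2))) (rL (lshift (hval g).2))).
apply: filterS (h _).
- move=> x e2; rewrite /eta e2 /delta0 /=.
  have -> (p c : C) (u v : 'cV[C]_d) (A B : 'cV[C]_r) :
      p *: (z *: u + v) - c *: (V *m (z *: A + B)) =
      z *: (p *: u - c *: (V *m A)) + (p *: v - c *: (V *m B)).
    rewrite mulmxDr -scalemxAr !scalerDr scalerN !scalerA opprD addrACA.
    by rewrite (mulrC p) (mulrC c).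
  by rewrite mulmxDr -scalemxAr.
- apply/funext => n; rewrite (hatD pL n (L2vZ z (rL _)) (rL _)) (hatZ pL z n (rL _)).
  by rewrite !hat_realize//; exact: l2_lshift.
Qed.

Let ker f := {ae leb, forall x, transform f x = 0}.

Let hat_chi_real f m : ker f -> hat (fun x => chi x *: real (hval f).2 x) m =
  - (V^t* *m hat (eta f) m).
Proof.
move=> kf; have hc := L2v_bscale (bmeas_chi HC a_gt0) (rL (hval f).2).
have hV := L2v_mx (V^t*) (eta_L2v f).
apply/eqP; rewrite -addr_eq0 -(hat_mx pL (V^t*) m (eta_L2v f)) -(hatD pL m hc hV).
rewrite (_ : hat _ = hat (fun=> 0 : 'cV[C]_r)).
  by rewrite hat0.
apply: hat_ae; [exact: L2vD hc hV|exact: L2v0|].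
by apply: filterS kf => x; rewrite transform_eta.
Qed.

Let pencil_eta f x : x%:C *: eta f x - HC *m eta f x =
  chi x *: delta0 (hval f).1 x - (a^-1)%:C *: (V *m (chi x *: real (lshift (hval f).2) x)).
Proof.
rewrite -mul_scalar_mx -mulmxBl /eta mulmxA mul_mx_adj mul_scalar_mx scalerBr.
congr (_ - _); rewrite -scalemxAr !scalerA; congr (_ *: _); exact: mulrC.
Qed.

Let ba : (a^-1)%:C * a%:C = 1 :> C.
Proof. by rewrite -(rmorphM (real_complex R))/= mulVf ?gt_eqF. Qed.

(* Where f is in the kernel, multiplication by the polynomial chi acts on far
   coefficients like a shift-invariant operator, so chi can be moved across the
   shift relating f and its left shift. *)
Let eta_recursion f n : ker f -> (d < n)%N ->
  hat (eta f) n = ((a^-1)%:C *: HC) *m hat (eta f) n.+1 +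
    (((a^-1)%:C ^+ 2 *: (V *m V^t*)) - 1%:M) *m hat (eta f) n.+2.
Proof.
move=> kf dn; have l2f : l2 (hval f).2 by have /asboolP := hvalP f.
have chiP (x : borel) : chi x = (char_poly HC).[x%:C] := chi_char_poly HC x.
have he := eta_L2v f; have hd := delta0_L2v a_gt0 (hval f).1.
have hB := rL (lshift (hval f).2); have hA := rL (hval f).2.
have hcB := L2v_bscale (bmeas_chi HC a_gt0) hB.
have hcd := L2v_bscale (bmeas_chi HC a_gt0) hd.
have h1 : hat (fun x => chi x *: delta0 (hval f).1 x) n.+1 = 0.
  rewrite (hat_ext _ (fun x => congr1 (fun z => z *: _) (chiP x))).
  have L0 : L2v (fun=> 0 : 'cV[C]_d) by exact: L2v0.
  (* The left shift of [delta0] is 0, so the coefficients of [chi] times [delta0] vanish from index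
     d + 2 on. *)
  rewrite -(shifted_poly (F := fun=> 0) L0 hd) ?size_char_poly//.
    by rewrite -[RHS](hat0 d n); apply: hat_ext => x; rewrite scaler0.
  by move=> m _; rewrite hat0 hat_delta0// scale0r.
have h2 : hat (fun x => chi x *: real (lshift (hval f).2) x) n.+1 = - (V^t* *m hat (eta f) n.+2).
  rewrite -hat_chi_real//; rewrite !(hat_ext _ (fun x => congr1 (fun z => z *: _) (chiP x))).
  apply: (shifted_poly hB hA); last by rewrite size_char_poly (leq_trans dn).
  by move=> m _; rewrite !hat_realize//; exact: l2_lshift.
have := hat_ext n.+1 (pencil_eta f).
rewrite (hatB pL n.+1 (L2v_mulX a_gt0 he) (L2v_mx HC he)).
rewrite (hatB pL n.+1 hcd (L2vZ _ (L2v_mx V hcB))) (hatZ pL _ n.+1 (L2v_mx V hcB)).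
rewrite (hat_mx pL V n.+1 hcB) (hat_mx pL HC n.+1 he) (hat_mulXS a_gt0 n he) h1 h2.
move: (hat (eta f) n) (hat (eta f) n.+1) (hat (eta f) n.+2) => p q s.
rewrite sub0r mulmxN scalerN opprK => /(canRL (subrK _)) /(congr1 ( *:%R (a^-1)%:C)).
rewrite scalerA ba scale1r => /(canRL (addrK _)) ->.
rewrite scalerDr scalerA -expr2 mulmxBl mul1mx -!scalemxAl mulmxA addrC addrA.
by rewrite addrC (addrC (- s)).
Qed.

Lemma transform_kernel_spanned :
  spanned [set f : H | {ae leb, forall x, transform f x = 0}].
Proof.
(* [eta_recursion] holds from index d + 1 on, and [vector_recursion_determined] asks for the first
   2d + 1 values from there. *)
pose N := (d.+1 + (d + d).+1)%N.
pose L (i : 'I_d + 'I_N * 'I_d) (f : H) : C :=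
  match i with inl i => (hval f).1 i 0 | inr p => hat (eta f) p.1 p.2 0 end.
apply: (@spanned_separating _ _ _ _ L) => [|z f g kf kg|i z f g kf kg|f kf hL].
- have := transform_linear HC V a_gt0 (-1) 0 0; apply: filterS => x.
  by rewrite scaler0 addr0 scaleN1r addNr.
- apply: filterS2 (filterI kf kg) (transform_linear HC V a_gt0 z f g) => x [f0 g0] ->.
  by rewrite f0 g0 scaler0 addr0.
- case: i => [i|[n i]]; first by rewrite /L /= !mxE.
  have e := hat_ae (eta_L2v (z *: f + g)) (L2vD (L2vZ z (eta_L2v f)) (eta_L2v g)) (eta_linear z f g).
  rewrite -[LHS]/(hat (eta (z *: f + g)) n i 0) e.
  rewrite (hatD pL n (L2vZ z (eta_L2v f)) (eta_L2v g)) (hatZ pL z n (eta_L2v f)).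
  have mE (u v : 'cV[C]_d) : (z *: u + v) i 0 = z * u i 0 + v i 0 by rewrite !mxE.
  exact: mE.
- have f1 : (hval f).1 = 0 by apply/matrixP => i j; rewrite ord1 mxE; exact: (hL (inl i)).
  have om0 n : (n < N)%N -> hat (eta f) n = 0.
    move=> nN; apply/matrixP => i j; rewrite ord1 [RHS]mxE.
    exact: (hL (inr (Ordinal nN, i))).
  have omd n : hat (eta f) (d.+1 + n)%N = 0.
    have rec m := @eta_recursion f (d.+1 + m)%N kf (leq_addr m d.+1).
    have w0 m : (m <= d + d)%N -> hat (eta f) (d.+1 + m)%N = 0.
      by move=> mN; apply: om0; rewrite ltn_add2l ltnS.
    apply: (vector_recursion_determined (w := fun n => hat (eta f) (d.+1 + n)%N) _ w0).
    by move=> m; rewrite !addnS; exact: rec.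
  have om n : hat (eta f) n = 0.
    have [/om0//|nN] := ltnP n N.
    by rewrite -(subnKC (leq_trans (leq_addr _ _) nN)) omd.
  have e0 : {ae leb, forall x, eta f x = 0}.
    apply: (hat_inj pL (chebphi_total a_gt0) (eta_L2v f)); first exact: L2v0.
    by move=> n; rewrite om hat0.
  (* With eta = 0 the kernel equation reads chi times the sequence function = 0, and [chi] is
     nonzero almost everywhere. *)
  have A0 : {ae leb, forall x, real (hval f).2 x = 0}.
    apply: filterS2 (filterI kf e0) (chi_ae HC) => x [tx ex] cx.
    by move: tx; rewrite transform_eta ex mulmx0 addr0 => /eqP; rewrite scaler_eq0 (negPf cx) => /eqP.
  have l2f : l2 (hval f).2 by have /asboolP := hvalP f.
  apply: val_inj; apply: injective_projections; first exact: f1.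
  have L0 : L2v (fun=> 0 : 'cV[C]_r) by exact: L2v0.
  apply/funext => n; rewrite -[LHS]/((hval f).2 n) -(hat_realize a_gt0 l2f).
  by rewrite (hat_ae (rL _) L0 A0) hat0.
Qed.

Local Notation T := (J a HC V).
Local Notation sqnorm := (sqnorm (@hdot R d r)).
Let ipH : inner_product (@hdot R d r) := @hdot_inner_product R d r.

Let l2_hval (f : H) : l2 (hval f).2. Proof. by have /asboolP := hvalP f. Qed.

Let hat_J f : hat (fun x => x%:C *: real (hval f).2 x + delta0 (V^t* *m (hval f).1) x) =
  (hval (T f)).2.
Proof.
apply/funext => n; rewrite (hatD pL n (L2v_mulX a_gt0 (rL _)) (delta0_L2v a_gt0 _)).
rewrite hat_delta0//; case: n => [|n].
  by rewrite (hat_mulX0 a_gt0 (rL _)) hat_realize ?scale1r//; exact: l2_hval.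
by rewrite (hat_mulXS a_gt0 n (rL _)) hat_realize ?scale0r ?addr0//; exact: l2_hval.
Qed.

Let hdot_J f g : hdot (T f) g =
  dot (HC *m (hval f).1) (hval g).1 + dot (V *m (hval f).2 0%N) (hval g).1 +
  (pairing (fun x => x%:C *: real (hval f).2 x) (real (hval g).2) +
   dot (V^t* *m (hval f).1) ((hval g).2 0%N)).
Proof.
have hX := L2v_mulX a_gt0 (rL (hval f).2).
have hd := delta0_L2v a_gt0 (V^t* *m (hval f).1).
rewrite (hdotE a_gt0 (f := T f) (g := g) (L2vD hX hd) (rL (hval g).2) (hat_J f)); last first.
  by rewrite hat_realize//; exact: l2_hval.
rewrite (pairingDl hX hd (rL _)) /= dotDl; congr (_ + (_ + _)).
rewrite (pairing_conj (rL (hval g).2) hd) (pairing_delta0 a_gt0 _ (rL _)) -dot_conj.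
by rewrite hat_realize//; exact: l2_hval.
Qed.

Lemma J_symmetric f g : hdot (T f) g = hdot f (T g).
Proof.
rewrite (ip_conj ipH (T g) f) !hdot_J !conjcD -!dot_conj.
rewrite -(pairing_conj (L2v_mulX a_gt0 (rL (hval g).2)) (rL (hval f).2)).
rewrite [dot (HC *m _) _]dot_mulmx -hHC.
rewrite [dot (V *m (hval f).2 0%N) _]dot_mulmx [dot (V^t* *m (hval f).1) _]dot_mulmx trmxCK.
rewrite -addrA -[RHS]addrA; congr (_ + _).
have -> : pairing (fun x => x%:C *: real (hval f).2 x) (real (hval g).2) =
    pairing (real (hval f).2) (fun x => x%:C *: real (hval g).2 x).
  congr cint; apply/funext => x; rewrite dotZl [RHS]dot_conj dotZl conjcM conjcR.
  by rewrite -dot_conj.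
by rewrite addrC [RHS]addrA; congr (_ + _); exact: addrC.
Qed.

Let dot_inner_product n : inner_product (@dot R n).
Proof.
split=> [z u v w|u v|u|u].
- by rewrite dotDl dotZl.
- exact: dot_conj.
- by rewrite /Defs.sqnorm dot_self/=; apply: sumr_ge0 => i _; exact: sqmod_ge0.
- by rewrite /Defs.sqnorm => h; apply: dot_eq0; move: h; rewrite dot_self/= => ->.
Qed.

Local Notation dsq n := (Defs.sqnorm (@dot R n)).
Let psq k (F : borel -> 'cV[C]_k) : R := complex.Re (pairing F F).

Let mulmx_bounded m n (M : 'M[C]_(m, n)) :
  exists2 c : R, 0 <= c & forall u, dsq m (M *m u) <= c * dsq n u.
Proof.
pose w i : 'cV[C]_n := \col_j (M i j)^*%C.
exists (\sum_i dsq n (w i)) => [|u].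
  by apply: sumr_ge0 => i _; exact: sqnorm_ge0 (dot_inner_product n) _.
have Mu i : (M *m u) i 0 = dot u (w i).
  by rewrite mxE; apply: eq_bigr => j _; rewrite mxE conjcK mulrC.
rewrite /Defs.sqnorm dot_self/= mulr_suml; apply: ler_sum => i _.
by rewrite Mu mulrC; exact: cauchy_schwarz (dot_inner_product n) _ _.
Qed.

Let psq_ge0 k (F : borel -> 'cV[C]_k) : L2v F -> 0 <= psq F.
Proof.
move=> hF; rewrite -lee_fin (pairing_self hF); apply: integral_ge0 => x _.
by rewrite lee_fin sumr_ge0// => i _; exact: sqmod_ge0.
Qed.

Let psqD_le k (F G : borel -> 'cV[C]_k) : L2v F -> L2v G ->
  psq (fun x => F x + G x) <= 2 * psq F + 2 * psq G.
Proof.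
move=> hF hG; have := psq_ge0 (L2vB hF hG); rewrite /psq.
rewrite (pairingDl hF hG (L2vD hF hG)) (pairingDr hF hF hG) (pairingDr hG hF hG).
rewrite (pairingBl hF hG (L2vB hF hG)) (pairingBr hF hF hG) (pairingBr hG hF hG).
move: (pairing F F) (pairing F G) (pairing G F) (pairing G G).
by move=> [p1 q1] [p2 q2] [p3 q3] [p4 q4] /=; lra.
Qed.

Lemma pairing_bscale_le k (g : borel -> C) K (F : borel -> 'cV[C]_k) : cmeas g -> 0 <= K ->
  (forall x, D x -> sqmod (g x) <= K) -> L2v F ->
  complex.Re (pairing (fun x => g x *: F x) (fun x => g x *: F x)) <=
  K * complex.Re (pairing F F).
Proof.
move=> mg K0 hg hF.
have hX : L2v (fun x => g x *: F x) by apply: L2v_bscale hF; split=> //; exists K.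
have ms (E : borel -> 'cV[C]_k) : L2v E -> measurable_fun setT (fun x => (\sum_i sqmod (E x i 0))%:E).
  move=> hE; apply/measurable_EFinP; apply: measurable_sum => i.
  by apply: sqmod_measurable; exact: CL2_cmeas (hE i).
rewrite -lee_fin EFinM (pairing_self hX) (pairing_self hF) -ge0_integralZl//; last 2 first.
- exact: ms.
- by move=> x _; rewrite lee_fin sumr_ge0// => i _; exact: sqmod_ge0.
apply: ge0_le_integral => //.
- by move=> x _; rewrite lee_fin sumr_ge0// => i _; exact: sqmod_ge0.
- exact: ms.
- by apply: measurable_funeM; exact: ms.
move=> x _; rewrite -EFinM lee_fin mulr_sumr; apply: ler_sum => i _.
have [Dx|Dx] := pselect (D x); last first.
  by rewrite (L2v_out hF Dx) scaler0 mxE /sqmod /= expr0n addr0 mulr0.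
by rewrite mxE sqmodM ler_wpM2r ?sqmod_ge0// hg.
Qed.

Let psq_mulX F : L2v F -> psq (fun x => x%:C *: F x : 'cV[C]_r) <= (2 * a) ^+ 2 * psq F.
Proof.
move=> hF; apply: pairing_bscale_le => //; first by case: (bmeas_id a_gt0).
  exact: sqr_ge0.
move=> x Dx; have xa : `|x| < 2 * a by rewrite -itv_abs.
rewrite /sqmod /= expr0n addr0 -(real_normK (num_real x)).
by rewrite lerXn2r ?nnegrE ?mulr_ge0 ?(ltW a_gt0) ?(ltW xa).
Qed.

Lemma J_bounded : exists2 c : R, 0 <= c & forall f, sqnorm (T f) <= c * sqnorm f.
Proof.
have sqE (f : H) : sqnorm f = dsq d (hval f).1 + psq (real (hval f).2).
  have hr := hat_realize a_gt0 (l2_hval f).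
  by rewrite /Defs.sqnorm (hdotE a_gt0 (rL _) (rL _) hr hr) (raddfD (@complex.Re R)).
have psq_delta0 (c : 'cV[C]_r) : psq (delta0 c) = dsq r c.
  by rewrite /psq (pairing_delta0 a_gt0 _ (delta0_L2v a_gt0 c)) hat_delta0// scale1r.
have g0_le (f : H) : dsq r ((hval f).2 0%N) <= psq (real (hval f).2).
  set g0 := (hval f).2 0%N; have := pairing_cauchy_schwarz a_gt0 (rL (hval f).2) (delta0_L2v a_gt0 g0).
  rewrite (pairing_delta0 a_gt0 _ (rL _)) hat_realize// -/g0 (ip_self (dot_inner_product r)).
  rewrite -[complex.Re (pairing (delta0 _) _)]/(psq (delta0 g0)) psq_delta0.
  rewrite /sqmod /= expr0n addr0 expr2.
  have := sqnorm_ge0 (dot_inner_product r) g0; rewrite le_eqVlt => /predU1P[<- _|q0].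
    exact: psq_ge0.
  by rewrite ler_pM2r.
have [c1 c10 h1] := mulmx_bounded HC; have [c2 c20 h2] := mulmx_bounded V.
have [c3 c30 h3] := mulmx_bounded (V^t*).
exists (2 * c1 + 2 * c2 + 2 * (2 * a) ^+ 2 + 2 * c3) => [|f].
  by rewrite !addr_ge0// mulr_ge0// sqr_ge0.
have hX := L2v_mulX a_gt0 (rL (hval f).2).
have hd := delta0_L2v a_gt0 (V^t* *m (hval f).1).
have -> : sqnorm (T f) = dsq d (HC *m (hval f).1 + V *m (hval f).2 0%N) +
    psq (fun x => x%:C *: real (hval f).2 x + delta0 (V^t* *m (hval f).1) x).
  rewrite /Defs.sqnorm (hdotE a_gt0 (f := T f) (g := T f) (L2vD hX hd) (L2vD hX hd) (hat_J f) (hat_J f)).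
  by rewrite (raddfD (@complex.Re R)).
have i1 := sqnormD_le (dot_inner_product d) (HC *m (hval f).1) (V *m (hval f).2 0%N).
have i2 := psqD_le hX hd; have i3 := psq_mulX (rL (hval f).2).
have i4 := h1 (hval f).1; have i5 := h2 ((hval f).2 0%N); have i6 := h3 (hval f).1.
have i7 := g0_le f; have e8 := psq_delta0 (V^t* *m (hval f).1).
have u0 := sqnorm_ge0 (dot_inner_product d) (hval f).1.
have g0 := psq_ge0 (rL (hval f).2).
rewrite sqE; apply: le_trans (lerD i1 i2) _; rewrite e8.
set s := dsq d (hval f).1 + _.
have us : dsq d (hval f).1 <= s by rewrite lerDl.
have ps : psq (real (hval f).2) <= s by rewrite lerDr.
rewrite addrA 3!(mulrDl _ _ s) -!(mulrA _ _ s); apply: lerD; last first.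
  by rewrite ler_wpM2l//; apply: le_trans i6 _; rewrite ler_wpM2l.
apply: lerD; last first.
  have -> : 2 * a * (2 * (a * s)) = (2 * a) ^+ 2 * s by ring.
  by rewrite ler_wpM2l//; apply: le_trans i3 _; rewrite ler_wpM2l ?sqr_ge0.
apply: lerD; rewrite ler_wpM2l//.
  by apply: le_trans i4 _; rewrite ler_wpM2l.
by apply: le_trans i5 _; rewrite ler_wpM2l//; exact: le_trans i7 ps.
Qed.

End KernelDimension.

(** * Polynomials of an operator *)

Section OperatorPolynomial.
Context (R : realType) (H : lmodType R[i]) (T : H -> H).
Hypothesis T_lin : forall z f g, T (z *: f + g) = z *: T f + T g.
Implicit Types (f g : H) (p q : {poly R[i]}).

Lemma op0 : T 0 = 0.
Proof.
have /eqP := T_lin 1 0 0.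
by rewrite scale1r addr0 scale1r -subr_eq0 opprD addrA subrr sub0r oppr_eq0 => /eqP.
Qed.

Lemma opD f g : T (f + g) = T f + T g.
Proof. by rewrite -{1}[f]scale1r T_lin scale1r. Qed.

Lemma opZ z f : T (z *: f) = z *: T f.
Proof. by rewrite -[z *: f]addr0 T_lin op0 addr0. Qed.

Lemma opB f g : T (f - g) = T f - T g.
Proof. by rewrite opD -scaleN1r opZ scaleN1r. Qed.

Lemma op_sum (I : Type) (s : seq I) (F : I -> H) :
  T (\sum_(i <- s) F i) = \sum_(i <- s) T (F i).
Proof. by elim: s => [|i s IH]; rewrite ?big_nil ?op0// !big_cons opD IH. Qed.

Lemma iter_op_lin n z f g : iter n T (z *: f + g) = z *: iter n T f + iter n T g.
Proof. by elim: n => //= n ->; rewrite T_lin. Qed.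

Definition opoly p f : H := \sum_(i < size p) p`_i *: iter i T f.

Lemma opoly_widen n p f : (size p <= n)%N ->
  opoly p f = \sum_(i < n) p`_i *: iter i T f.
Proof.
move=> pn; rewrite /opoly (big_ord_widen n (fun i => p`_i *: iter i T f) pn).
rewrite big_mkcond; apply: eq_bigr => i _; case: ltnP => // /(nth_default 0) ->.
by rewrite scale0r.
Qed.

Lemma opoly_lin p z f g : opoly p (z *: f + g) = z *: opoly p f + opoly p g.
Proof.
rewrite /opoly scaler_sumr -big_split; apply: eq_bigr => i _ /=.
by rewrite iter_op_lin scalerDr !scalerA mulrC.
Qed.

Lemma opoly_0 p : opoly p 0 = 0.
Proof.
rewrite /opoly big1// => i _; rewrite (_ : iter i T 0 = 0) ?scaler0//.
by elim: (nat_of_ord i) => //= n ->; exact: op0.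
Qed.

Lemma opolyD p q f : opoly (p + q) f = opoly p f + opoly q f.
Proof.
have h1 := size_polyD p q; set n := maxn _ _ in h1.
rewrite (@opoly_widen n (p + q))// (@opoly_widen n p) ?leq_maxl// (@opoly_widen n q) ?leq_maxr//.
by rewrite -big_split; apply: eq_bigr => i _ /=; rewrite coefD scalerDl.
Qed.

Lemma opolyZ z p f : opoly (z *: p) f = z *: opoly p f.
Proof.
rewrite (@opoly_widen (size p) (z *: p)) ?size_scale_leq// /opoly scaler_sumr.
by apply: eq_bigr => i _; rewrite coefZ scalerA.
Qed.

Lemma opolyC c f : opoly c%:P f = c *: f.
Proof. by rewrite (@opoly_widen 1) ?size_polyC_leq1// big_ord1 coefC. Qed.

Lemma opoly0 f : opoly 0 f = 0.
Proof. by rewrite -polyC0 opolyC scale0r. Qed.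

Lemma opolyMX p f : opoly (p * 'X) f = T (opoly p f).
Proof.
have sz : (size (p * 'X)%R <= (size p).+1)%N.
  by have [->|p0] := eqVneq p 0; rewrite ?mul0r ?size_poly0// size_mulX.
rewrite (opoly_widen f sz) big_ord_recl coefMX scale0r add0r op_sum.
by apply: eq_bigr => i _; rewrite coefMX /= opZ.
Qed.

Lemma opoly_op p f : opoly p (T f) = T (opoly p f).
Proof.
by rewrite /opoly op_sum; apply: eq_bigr => i _; rewrite opZ -iterS iterSr.
Qed.

Lemma opolyM p q f : opoly (p * q) f = opoly p (opoly q f).
Proof.
elim/poly_ind: p => [|p c IH]; first by rewrite mul0r !opoly0.
rewrite mulrDl -mulrA ['X * q]mulrC mulrA !opolyD !opolyMX IH.
by rewrite mul_polyC opolyZ opolyC.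
Qed.

Lemma opoly_XsubC c f : opoly ('X - c%:P) f = T f - c *: f.
Proof.
rewrite opolyD -polyCN opolyC -['X]mul1r opolyMX -polyC1 opolyC scale1r.
by rewrite scaleNr.
Qed.

Lemma opoly_eigen p z f : T f = z *: f -> opoly p f = p.[z] *: f.
Proof.
move=> Tf; elim/poly_ind: p => [|p c IH]; first by rewrite opoly0 horner0 scale0r.
by rewrite opolyD opolyMX opolyC IH opZ Tf !hornerE scalerDl scalerA.
Qed.

(** Cayley-Hamilton for a matrix of T on the spanning family. That family need not be free, so the
    matrix is a choice; only its action on the vectors b enters. *)
Lemma opoly_annihilator M : spanned M -> (forall f, M f -> M (T f)) ->
  exists2 q : {poly R[i]}, q != 0 & forall f, M f -> opoly q f = 0.
Proof.
move=> [n [b [Mb hb]]] MT.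
have /choice[A hA] : forall i, exists c : 'I_n.+1 -> R[i], T (b i) = \sum_j c j *: b j.
  by move=> i; apply: hb; apply: MT.
pose B : 'M[R[i]]_n.+1 := \matrix_(i, j) A i j.
have hp p i : opoly p (b i) = \sum_j (horner_mx B p) i j *: b j.
  elim/poly_ind: p i => [|p c IH] i.
    by rewrite opoly0 rmorph0 big1// => j _; rewrite mxE scale0r.
  rewrite rmorphD rmorphM/= horner_mx_X horner_mx_C opolyD opolyMX opolyC IH op_sum.
  have -> : \sum_j (horner_mx B p * B + c%:M) i j *: b j =
      \sum_j (horner_mx B p *m B) i j *: b j + \sum_j (c%:M : 'M[R[i]]_n.+1) i j *: b j.
    by rewrite -big_split; apply: eq_bigr => j _; rewrite mxE scalerDl.
  congr (_ + _); last first.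
    rewrite (bigD1 i)//= big1 ?addr0 => [|j ji]; rewrite mxE ?eqxx//.
    by rewrite eq_sym (negPf ji) scale0r.
  under eq_bigr do rewrite opZ hA scaler_sumr.
  rewrite exchange_big; apply: eq_bigr => j _; rewrite mxE scaler_suml.
  by apply: eq_bigr => k _; rewrite scalerA mxE.
exists (char_poly B); first exact/monic_neq0/char_poly_monic.
move=> f /hb[c ->]; have op_00 := opoly_0 (char_poly B).
elim/big_ind: _ => // [u v hu hv|i _].
  by rewrite -[u]scale1r opoly_lin hu hv scaler0 addr0.
rewrite -[c i *: _]addr0 opoly_lin op_00 hp Cayley_Hamilton big1 ?scaler0 ?addr0// => j _.
by rewrite mxE scale0r.
Qed.
End OperatorPolynomial.

Section RealPolynomials.
Context (R : realType).
Local Notation C := R[i].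
Local Notation real_poly := (map_poly (real_complex R)).

Lemma horner_real_poly (p : {poly R}) x : (real_poly p).[x%:C] = (p.[x])%:C.
Proof. exact: horner_map. Qed.

(** Here q' is q with conjugated coefficients. A nonnegative real multiple of q can serve as a
    density with respect to a spectral measure. *)
Lemma normsq_poly (q : {poly C}) : exists (p : {poly R}) (q' : {poly C}),
  q' * q = real_poly p /\ forall x, p.[x] = sqmod q.[x%:C].
Proof.
pose q1 := map_poly (@complex.Re R) q; pose q2 := map_poly (@complex.Im R) q.
have qE : q = real_poly q1 + 'i%C *: real_poly q2.
  apply/polyP => k; rewrite coefD coefZ !coef_map /=.
  by case: (q`_k) => u v; simpc.
exists (q1 ^+ 2 + q2 ^+ 2), (real_poly q1 - 'i%C *: real_poly q2); split => [|x].
  rewrite [X in _ * X]qE -subr_sqr rmorphD/= !rmorphXn/= exprZn.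
  by rewrite (_ : 'i%C ^+ 2 = -1) ?scaleN1r ?opprK// expr2; simpc.
have -> : q.[x%:C] = q1.[x] +i* q2.[x].
  by rewrite {1}qE hornerD hornerZ !horner_real_poly; simpc.
by rewrite !hornerE.
Qed.
End RealPolynomials.

(** * Spectral types of an operator with a finite-dimensional defect *)

Section DiagonalModel.
Context (R : realType) (H : lmodType R[i]) (ip : H -> H -> R[i]) (T : H -> H).
Context (r : nat) (a : R) (U : H -> measurableTypeR R -> 'cV[R[i]]_r).
Local Notation C := R[i].
Local Notation borel := (measurableTypeR R).
Local Notation leb := (@lebesgue_measure R).
Local Notation D := (`](- (2 * a)), (2 * a)[%classic : set borel).
Local Notation L2v := (L2v leb D).
Local Notation pairing := (@pairing _ _ R leb _).
Local Notation sqnorm := (sqnorm ip).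
Implicit Types (f g h : H) (F G : borel -> 'cV[C]_r) (z : C).

Definition kernel : set H := [set f | {ae leb, forall x, U f x = 0}].

(** These are the only facts about [J] that the spectral analysis uses: a bounded symmetric operator
    and a co-isometry onto L2 of the band that intertwines it with x and has finite-dimensional
    kernel. *)
Record diagonal_model : Prop := DiagonalModel {
  dm_a_gt0 : 0 < a;
  dm_ip : inner_product ip;
  dm_lin : forall z f g, T (z *: f + g) = z *: T f + T g;
  dm_sym : forall f g, ip (T f) g = ip f (T g);
  dm_bounded : exists2 c : R, 0 <= c & forall f, sqnorm (T f) <= c * sqnorm f;
  dm_L2 : forall f, L2v (U f);
  dm_U_lin : forall z f g,
    {ae leb, forall x, U (z *: f + g) x = z *: U f x + U g x};
  dm_U_T : forall f, {ae leb, forall x, U (T f) x = x%:C *: U f x};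
  dm_adjoint : forall F, L2v F -> exists h,
    {ae leb, forall x, U h x = F x} /\ forall f, ip h f = pairing F (U f);
  dm_kernel : spanned kernel }.

Hypothesis dm : diagonal_model.
Let a_gt0 := dm_a_gt0 dm.
Let ipH := dm_ip dm.
Let T_lin := dm_lin dm.
Let U_L2 := dm_L2 dm.

(** The adjoint of U as a function, chosen from [dm_adjoint], with value 0 outside [L2v]. *)
Definition wave (F : borel -> 'cV[C]_r) : H :=
  if pselect (L2v F) is left hF then sval (cid (dm_adjoint dm hF)) else 0.
Local Notation W := wave.

Lemma U_wave F : L2v F -> {ae leb, forall x, U (W F) x = F x}.
Proof. by move=> hF; rewrite /wave; case: pselect => // h; case: cid => ? []. Qed.

Lemma ip_wave F f : L2v F -> ip (W F) f = pairing F (U f).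
Proof. by move=> hF; rewrite /wave; case: pselect => // h; case: cid => ? []. Qed.

Let ip_eq f g : (forall h, ip f h = ip g h) -> f = g.
Proof.
move=> h; apply/eqP; rewrite -subr_eq0; apply/eqP/(sqnorm_eq0 ipH).
by rewrite /Defs.sqnorm (ipBl ipH) h subrr.
Qed.

Lemma wave_lin z F G : L2v F -> L2v G -> W (fun x => z *: F x + G x) = z *: W F + W G.
Proof.
move=> hF hG; have hz := L2vZ z hF; apply: ip_eq => h.
rewrite (ip_wave _ (L2vD hz hG)) (ipDl ipH) (ipZl ipH) (ip_wave _ hF) (ip_wave _ hG).
by rewrite (pairingDl hz hG (U_L2 h)) (pairingZl z hF (U_L2 h)).
Qed.

Lemma wave_ae F G : L2v F -> L2v G -> {ae leb, forall x, F x = G x} -> W F = W G.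
Proof.
move=> hF hG e; apply: ip_eq => h; rewrite (ip_wave _ hF) (ip_wave _ hG).
exact: pairing_ae.
Qed.

Lemma T_wave F : L2v F -> T (W F) = W (fun x => x%:C *: F x).
Proof.
move=> hF; have hX := L2v_mulX a_gt0 hF; apply: ip_eq => h.
rewrite (dm_sym dm) (ip_wave _ hF) (ip_wave _ hX).
rewrite (pairing_aer hF (U_L2 _) (L2v_mulX a_gt0 (U_L2 h)) (dm_U_T dm h)).
congr cint; apply/funext => x; rewrite dotZl dot_conj dotZl conjcM conjcR.
by rewrite -dot_conj.
Qed.

Lemma sqnorm_wave F : L2v F -> sqnorm (W F) = complex.Re (pairing F F).
Proof.
move=> hF; rewrite /Defs.sqnorm (ip_wave _ hF); congr complex.Re.
exact: (pairing_aer hF (U_L2 _) hF (U_wave hF)).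
Qed.

(** Since U is a co-isometry, f - U^* U f is the orthogonal projection of f to [kernel]. *)
Definition pp_part f : H := f - W (U f).
Local Notation P := pp_part.

Lemma pp_partK f : P f + W (U f) = f. Proof. exact: subrK. Qed.

Lemma wave_U_lin z f g : W (U (z *: f + g)) = z *: W (U f) + W (U g).
Proof.
rewrite -(wave_lin z (U_L2 f) (U_L2 g)); apply: wave_ae => //.
  exact: L2vD (L2vZ z (U_L2 f)) (U_L2 g).
exact: dm_U_lin.
Qed.

Lemma pp_part_lin z f g : P (z *: f + g) = z *: P f + P g.
Proof. by rewrite /pp_part wave_U_lin scalerBr opprD addrACA. Qed.

Lemma pp_part_kernel f : kernel (P f).
Proof.
have h := dm_U_lin dm (-1) (W (U f)) f.
apply: filterS2 h (U_wave (U_L2 f)) => x.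
by rewrite /pp_part addrC -scaleN1r => -> ->; rewrite scaleN1r addNr.
Qed.

Lemma wave_kernel e : kernel e -> W (U e) = 0.
Proof.
move=> ke; have L0 : L2v (fun=> 0 : 'cV[C]_r) by exact: L2v0.
rewrite (wave_ae (U_L2 e) L0 ke); apply: ip_eq => h; rewrite (ip_wave _ L0) (ip0l ipH).
rewrite /pairing -[RHS](cint0 leb); congr cint; apply/funext => x.
by rewrite /dot big1// => i _; rewrite mxE mul0r.
Qed.

Lemma pp_part_id e : kernel e -> P e = e.
Proof. by move=> ke; rewrite /pp_part wave_kernel// subr0. Qed.

Lemma pp_part_wave F : L2v F -> P (W F) = 0.
Proof.
move=> hF; rewrite /pp_part (wave_ae (U_L2 _) hF (U_wave hF)).
exact: subrr.
Qed.

Lemma ip_wave_kernel F e : L2v F -> kernel e -> ip (W F) e = 0.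
Proof.
move=> hF ke; rewrite -(pp_part_id ke) /pp_part (ipBr ipH).
rewrite !(ip_wave _ hF) (pairing_aer hF (U_L2 _) (U_L2 e) (U_wave (U_L2 e))).
exact: subrr.
Qed.

Lemma kernel_T e : kernel e -> kernel (T e).
Proof.
move=> ke; apply: filterS2 ke (dm_U_T dm e) => x h ->.
by rewrite h scaler0.
Qed.

Lemma wave_U_T f : W (U (T f)) = T (W (U f)).
Proof.
rewrite (T_wave (U_L2 f)); apply: wave_ae => //; first exact: L2v_mulX.
exact: dm_U_T.
Qed.

Lemma pp_part_T f : P (T f) = T (P f).
Proof. by rewrite /pp_part (opB T_lin) wave_U_T. Qed.

Lemma sqnorm_split f : sqnorm f = sqnorm (P f) + complex.Re (pairing (U f) (U f)).
Proof.
rewrite -{1}(pp_partK f) (sqnormD ipH) (sqnorm_wave (U_L2 f)).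
by rewrite (ip_conj ipH (W (U f))) (ip_wave_kernel (U_L2 f) (pp_part_kernel f)) conjc0 mulr0 addr0.
Qed.

Let vs F (x : borel) : R := \sum_i sqmod (F x i 0).

Let vs_ge0 F x : 0 <= vs F x.
Proof. by apply: sumr_ge0 => i _; exact: sqmod_ge0. Qed.

Let vs_out F x : L2v F -> ~ D x -> vs F x = 0.
Proof.
by move=> hF Dx; rewrite /vs big1// => i _; rewrite (L2v_out hF Dx) mxE /sqmod /= expr0n addr0.
Qed.

Let bmeas_real_poly (p : {poly R}) : bmeas D (fun x : borel => (p.[x])%:C).
Proof.
rewrite (_ : (fun x => _) = (fun x : borel => (map_poly (real_complex R) p).[x%:C])).
  exact: bmeas_poly.
by apply/funext => x; rewrite horner_real_poly.
Qed.

Let dot_real_scale (g : R) (v : 'cV[C]_r) : dot (g%:C *: v) v = (g * \sum_i sqmod (v i 0))%:C.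
Proof. by rewrite dotZl dot_self -(rmorphM (real_complex R)). Qed.

Let poly_vs_integrable (p : {poly R}) F : L2v F ->
  leb.-integrable setT (EFin \o (fun x : borel => p.[x] * vs F x)).
Proof.
move=> hF; have [h _] := dot_cintegrable (L2v_bscale (bmeas_real_poly p) hF) hF.
by apply: eq_integrable h => // x _; rewrite dot_real_scale.
Qed.

Let pairing_poly (p : {poly R}) F :
  pairing (fun x => (p.[x])%:C *: F x) F =
  (Rintegral leb setT (fun x : borel => p.[x] * vs F x))%:C.
Proof.
apply/eqP; rewrite eq_complex/=; apply/andP; split; apply/eqP.
  by apply: eq_Rintegral => x _; rewrite dot_real_scale.
transitivity (Rintegral leb setT (fun=> 0 : R)); last by rewrite Rintegral_cst// mul0r.
by apply: eq_Rintegral => x _; rewrite dot_real_scale.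
Qed.

Lemma opoly_wave (p : {poly C}) F : L2v F ->
  opoly T p (W F) = W (fun x => p.[x%:C] *: F x).
Proof.
move=> hF; elim/poly_ind: p => [|p c IH].
  rewrite opoly0; have L0 : L2v (fun=> 0 : 'cV[C]_r) by exact: L2v0.
  rewrite (_ : (fun x => _) = fun=> 0); last by apply/funext => x; rewrite horner0 scale0r.
  apply: ip_eq => h; rewrite (ip0l ipH) (ip_wave _ L0) /pairing -[LHS](cint0 leb).
  by congr cint; apply/funext => x; rewrite /dot big1// => i _; rewrite mxE mul0r.
have hp : L2v (fun x => p.[x%:C] *: F x) by exact: L2v_bscale (bmeas_poly a_gt0 p) hF.
rewrite opolyD (opolyMX T_lin) opolyC IH (T_wave hp) addrC -(wave_lin c hF (L2v_mulX a_gt0 hp)).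
congr W; apply/funext => x; rewrite !hornerE scalerDl addrC; congr (_ + _).
by rewrite scalerA mulrC.
Qed.

Local Notation real_poly := (map_poly (real_complex R)).

Let ip_suml (I : Type) (s : seq I) (F : I -> H) g :
  ip (\sum_(i <- s) F i) g = \sum_(i <- s) ip (F i) g.
Proof.
by elim: s => [|i s IH]; rewrite ?big_nil ?(ip0l ipH)// !big_cons (ipDl ipH) IH.
Qed.

Let spectral_moments f mu : spectral_measure ip T f mu -> has_moments mu.
Proof. by move=> h n; have [] := h n. Qed.

Lemma spectral_opoly f mu (p : {poly R}) : spectral_measure ip T f mu ->
  ip (opoly T (real_poly p) f) f = (Rintegral mu setT (fun x : borel => p.[x]))%:C.
Proof.
move=> hmu; rewrite (Rintegral_horner p (spectral_moments hmu)) (rmorph_sum (real_complex R)).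
rewrite /opoly ip_suml size_map_poly; apply: eq_bigr => i _.
by rewrite (ipZl ipH) coef_map (hmu i).2 -(rmorphM (real_complex R)).
Qed.

Let opoly_split q f : opoly T q (P f) = 0 -> opoly T q f = opoly T q (W (U f)).
Proof.
by move=> h; rewrite -{1}(pp_partK f) -[P f]scale1r (opoly_lin T_lin) h scaler0 add0r.
Qed.

Lemma ip_opoly_real q q' (p p' : {poly R}) f :
  opoly T q (P f) = 0 -> q' * q = real_poly p ->
  ip (opoly T (real_poly (p' * p)) f) f =
  (Rintegral leb setT (fun x : borel => (p' * p).[x] * vs (U f) x))%:C.
Proof.
move=> qP qq; rewrite -pairing_poly.
have -> : opoly T (real_poly (p' * p)) f = opoly T (real_poly (p' * p)) (W (U f)).
  by rewrite rmorphM/= -qq mulrA (opolyM T_lin _ q f) (opoly_split qP) (opolyM T_lin _ q (W (U f))).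
rewrite (opoly_wave _ (U_L2 f)) (_ : (fun x => _ *: _) = fun x => ((p' * p).[x])%:C *: U f x).
  by rewrite ip_wave//; exact: L2v_bscale (bmeas_real_poly _) (U_L2 f).
by apply/funext => x; rewrite horner_real_poly.
Qed.

(* The factor p = |q|^2 on the real line removes the component in the kernel. *)
Lemma spectral_density f mu q q' (p : {poly R}) : spectral_measure ip T f mu ->
  opoly T q (P f) = 0 -> q' * q = real_poly p -> (forall x, 0 <= p.[x]) ->
  forall A : set borel, measurable A ->
  (\int[mu]_(x in A) (p.[x])%:E = \int[leb]_(x in A) (p.[x] * vs (U f) x)%:E)%E.
Proof.
move=> hmu qP qq p0 A mA; have mom := spectral_moments hmu.
have pi := integrable_horner p mom.
have g0 (x : borel) : 0 <= p.[x] * vs (U f) x by rewrite mulr_ge0.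
have gi := poly_vs_integrable p (U_L2 f).
pose nu1 := density (m := mu) p0 pi; pose nu2 := density (m := leb) g0 gi.
have mX n : measurable_fun setT (fun x : borel => (x ^+ n)%:E).
  by apply/measurable_EFinP; exact: measurable_funX.
have i1 n : mu.-integrable setT (fun x : borel => (x ^+ n)%:E * (p.[x])%:E)%E.
  apply: eq_integrable (integrable_horner ('X^n * p) mom) => // x _.
  by rewrite hornerM hornerXn EFinM.
have i2 n : leb.-integrable setT (fun x : borel => (x ^+ n)%:E * (p.[x] * vs (U f) x)%:E)%E.
  apply: eq_integrable (poly_vs_integrable ('X^n * p) (U_L2 f)) => // x _.
  by rewrite /= hornerM hornerXn -mulrA EFinM.
have m1 : has_moments nu1 by move=> n; apply: integrable_density.
have m2 : has_moments nu2 by move=> n; apply: integrable_density.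
have supp : nu2 [set x : borel | 2 * a < `|x|] = 0%E.
  rewrite /nu2 /density; apply: integral0_eq => x /= xa.
  have nD : ~ D x by rewrite /= itv_abs ltNge (ltW xa).
  by rewrite vs_out ?mulr0.
have C0 : 0 < 2 * a by rewrite mulr_gt0.
apply: (moment_unique m1 m2 _ C0 supp mA) => n.
have e1 : Rintegral nu1 setT (fun x : borel => x ^+ n) =
    Rintegral mu setT (fun x : borel => ('X^n * p).[x]).
  rewrite /Rintegral integral_density//; congr fine; apply: eq_integral => x _.
  by rewrite hornerM hornerXn EFinM.
have e2 : Rintegral nu2 setT (fun x : borel => x ^+ n) =
    Rintegral leb setT (fun x : borel => ('X^n * p).[x] * vs (U f) x).
  rewrite /Rintegral integral_density//; congr fine; apply: eq_integral => x _.
  by rewrite hornerM hornerXn -mulrA EFinM.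
have := ip_opoly_real 'X^n qP qq; rewrite (spectral_opoly _ hmu) e1 e2.
by case.
Qed.

Let kernel_annihilator : exists (q q' : {poly C}) (p : {poly R}) (rs : seq R),
  [/\ forall e, kernel e -> opoly T q e = 0, q' * q = real_poly p,
      forall x, 0 <= p.[x] & forall x, x \notin rs -> p.[x] != 0].
Proof.
have [q q0 hq] := opoly_annihilator T_lin (dm_kernel dm) kernel_T.
have [p [q' [qq pE]]] := normsq_poly q.
have [ts hts] := closed_field_poly_normal q.
(* The real parts of all complex roots form a finite list containing every real root, hence every
   zero of p. *)
exists q, q', p, (map (@complex.Re R) ts); split => // [x|x]; first by rewrite pE sqmod_ge0.
apply: contra; rewrite pE sqmod_eq0.
rewrite hts hornerZ mulf_eq0 lead_coef_eq0 (negPf q0)/= => h.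
by apply/mapP; exists x%:C => //; rewrite -root_prod_XsubC.
Qed.

Let ae_notin (mu : {measure set borel -> \bar R}) (rs : seq R) :
  (forall x, mu [set x] = 0%E) -> {ae mu, forall x : borel, x \notin rs}.
Proof.
move=> mu0; elim: rs => [|y rs IH]; first exact: aeW.
have hy : {ae mu, forall x : borel, x != y}.
  by exists [set y]; split => // x /= /negP; rewrite negbK => /eqP.
by apply: filterS2 hy IH => x; rewrite in_cons negb_or => -> ->.
Qed.

Let vs_eq0 F x : vs F x = 0 -> F x = 0.
Proof.
move=> v0; apply/matrixP => i j; rewrite ord1 mxE.
apply: sqmod_le0; rewrite -v0 /vs (bigD1 i)//= lerDl.
by apply: sumr_ge0 => k _; exact: sqmod_ge0.
Qed.

Let poly_measurable (p : {poly R}) (A : set borel) :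
  measurable_fun A (fun x : borel => (p.[x])%:E).
Proof.
apply/measurable_EFinP/measurable_funTS; apply: continuous_measurable_fun.
exact: continuous_horner.
Qed.

(** Over the complement of A the mu side of [spectral_density] is 0, so p |U f|^2 vanishes almost
    everywhere off a null set. This serves pure point and singular continuous measures alike,
    countable sets being Lebesgue null. *)
Let concentrated_kernel f mu (A : set borel) : spectral_measure ip T f mu ->
  measurable A -> leb A = 0%E -> mu (~` A) = 0%E -> kernel f.
Proof.
move=> hmu mA lA muA; have [q [q' [p [rs [hq qq p0 prs]]]]] := kernel_annihilator.
have mAC := measurableC mA.
have := spectral_density hmu (hq _ (pp_part_kernel f)) qq p0 mAC.
rewrite null_set_integral//.
have mi : measurable_fun (~` A) (fun x : borel => (p.[x] * vs (U f) x)%:E).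
  by apply: measurable_funTS; exact: measurable_int (poly_vs_integrable p (U_L2 f)).
move=> /esym i0; have : (\int[leb]_(x in ~` A) `|(p.[x] * vs (U f) x)%:E| = 0)%E.
  by under eq_integral do rewrite gee0_abs ?lee_fin ?mulr_ge0//.
move=> /(ae_eq_integral_abs _ mAC mi) h.
have nA : {ae leb, forall x : borel, ~ A x}.
  by exists A; split => // x /=; apply: contrapT.
have h2 : {ae leb, forall x : borel, x \notin rs} by apply: ae_notin => x; exact: lebesgue_measure_set1.
apply: filterS2 (filterI h nA) h2 => x [/= hx nAx] xrs.
have [] := hx nAx => /eqP; rewrite mulf_eq0 (negPf (prs x xrs)) => /eqP.
exact: vs_eq0.
Qed.

Lemma pp_subspace_kernel f : pp_subspace ip T f -> kernel f.
Proof.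
move=> [mu hmu [S cS muS]].
have mS : measurable (S : set borel) by apply: countable_measurable => // t; exact: measurable_set1.
by apply: (concentrated_kernel hmu mS) => //; exact: countable_lebesgue_measure0.
Qed.

(** Once f is in the kernel, [spectral_density] says that p has integral 0 for mu. So mu sits on the
    finitely many zeros of p, and without atoms it is 0; its total mass is the squared norm of f. *)
Lemma sc_subspace_eq0 f : sc_subspace ip T f -> f = 0.
Proof.
move=> [mu hmu [pt0 [A [mA lA muA]]]]; have kf := concentrated_kernel hmu mA lA muA.
have [q [q' [p [rs [hq qq p0 prs]]]]] := kernel_annihilator.
have := spectral_density hmu (hq _ (pp_part_kernel f)) qq p0 measurableT.
rewrite [RHS](_ : _ = 0%E) => [i0|]; last first.
  rewrite (ae_eq_integral (fun=> 0%E))//; first by rewrite integral0.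
    exact: measurable_int (poly_vs_integrable p (U_L2 f)).
  apply: filterS kf => x Ux _; rewrite /vs big1 ?mulr0// => i _.
  by rewrite Ux mxE /sqmod /= expr0n addr0.
have : (\int[mu]_x `|(p.[x])%:E| = 0)%E.
  by under eq_integral do rewrite gee0_abs ?lee_fin//.
move=> /(ae_eq_integral_abs _ measurableT (@poly_measurable p setT)) h.
have h2 : {ae mu, forall x : borel, x \notin rs} by exact: ae_notin.
have mu0 : mu setT = 0%E.
  have : {ae mu, forall x : borel, False}.
    apply: filterS2 h h2 => x /= /(_ Logic.I) [] hx xrs.
    by have := prs x xrs; rewrite hx eqxx.
  move=> [N [mN muN hN]]; have -> // : [set: borel] = N.
  by apply/seteqP; split => // x _; apply: hN.
apply: (sqnorm_eq0 ipH); rewrite /Defs.sqnorm; have [_ /= ->] := hmu 0%N.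
rewrite /= /Rintegral; under eq_integral do rewrite expr0.
transitivity (fine (1 * mu [set: borel])%E); last by rewrite mu0 mule0.
by congr fine; exact: integral_cst.
Qed.

Lemma iter_opoly n f : iter n T f = opoly T (real_poly 'X^n) f.
Proof.
rewrite map_polyXn; elim: n => [|n IH].
  by rewrite expr0 -polyC1 opolyC scale1r.
by rewrite exprSr (opolyMX T_lin) -IH.
Qed.

(** If P f = 0 then |U f|^2 dx is a spectral measure of f. Conversely, dividing both sides of
    [spectral_density] by p, which is allowed off a finite set null for both measures, equates the
    squared norms of f and U f, and [sqnorm_split] leaves nothing for P f. *)
Lemma ac_subspaceP f : ac_subspace ip T f <-> P f = 0.
Proof.
have vsi : leb.-integrable setT (EFin \o vs (U f)).
  apply: eq_integrable (poly_vs_integrable 1 (U_L2 f)) => // x _.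
  by rewrite /= hornerC mul1r.
split=> [[mu hmu mul]|Pf0]; last first.
  exists (density (m := leb) (vs_ge0 (U f)) vsi); last exact: density_dominates.
  move=> n; have mX : measurable_fun setT (fun x : borel => (x ^+ n)%:E).
    by apply/measurable_EFinP; exact: measurable_funX.
  have i2 : leb.-integrable setT (fun x : borel => (x ^+ n)%:E * (vs (U f) x)%:E)%E.
    apply: eq_integrable (poly_vs_integrable 'X^n (U_L2 f)) => // x _.
    by rewrite /= hornerXn EFinM.
  split; first exact: integrable_density.
  (* The constant 1 is already an annihilator, since P f = 0. *)
  have h := @ip_opoly_real 1 1 1 'X^n f; rewrite iter_opoly -['X^n]mulr1 h ?rmorph1 ?mulr1//.
    congr (_%:C); rewrite /Rintegral integral_density//; congr fine.
    by apply: eq_integral => x _; rewrite hornerXn EFinM.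
  by rewrite Pf0 opoly_0.
have [q [q' [p [rs [hq qq p0 prs]]]]] := kernel_annihilator.
have mom := spectral_moments hmu; have pi := integrable_horner p mom.
have g0 (x : borel) : 0 <= p.[x] * vs (U f) x by rewrite mulr_ge0.
have gi := poly_vs_integrable p (U_L2 f).
pose nu1 := density (m := mu) p0 pi; pose nu2 := density (m := leb) g0 gi.
have nuE : forall A : set borel, measurable A -> A `<=` setT -> nu1 A = nu2 A.
  by move=> A mA _; exact: (spectral_density hmu (hq _ (pp_part_kernel f)) qq p0 mA).
have hl : {ae leb, forall x : borel, x \notin rs} by apply: ae_notin => x; exact: lebesgue_measure_set1.
have hm : {ae mu, forall x : borel, x \notin rs}.
  move/null_content_dominatesP : mul => mul; apply: ae_notin => x.
  by apply: mul; [exact: measurable_set1|exact: lebesgue_measure_set1].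
have mV : measurable_fun setT (fun x : borel => ((p.[x])^-1)%:E).
  apply/measurable_EFinP; rewrite (_ : (fun x => _) = (fun x => p.[x] `^ (-1))).
    apply: (measurableT_comp (measurable_powR _)); apply: continuous_measurable_fun.
    exact: continuous_horner.
  by apply/funext => x; rewrite powR_inv1.
have V0 (x : borel) : (0 <= ((p.[x])^-1)%:E)%E by rewrite lee_fin invr_ge0.
have e1 : (\int[nu1]_x ((p.[x])^-1)%:E = mu setT)%E.
  rewrite ge0_integral_density//.
  rewrite (ae_eq_integral (cst 1%E))//; first by rewrite integral_cst// mul1e.
    by apply: emeasurable_funM => //; exact: poly_measurable.
  by apply: filterS hm => x xrs _ /=; rewrite -EFinM mulVf// prs.
have e2 : (\int[nu2]_x ((p.[x])^-1)%:E = \int[leb]_x (vs (U f) x)%:E)%E.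
  rewrite ge0_integral_density//; apply: ae_eq_integral => //.
  - by apply: emeasurable_funM => //; exact: measurable_int gi.
  - exact: measurable_int vsi.
  by apply: filterS hl => x xrs _ /=; rewrite -EFinM mulrA mulVf ?mul1r// prs.
apply: (sqnorm_eq0 ipH).
have := sqnorm_split f.
have -> : sqnorm f = complex.Re (pairing (U f) (U f)).
  have sE : sqnorm f = Rintegral mu setT (fun x : borel => x ^+ 0).
    by rewrite /Defs.sqnorm; have [_ /= ->] := hmu 0%N.
  rewrite sE /Rintegral; under eq_integral do rewrite expr0.
  transitivity (fine (mu [set: borel])).
    by congr fine; rewrite -[RHS]mul1e; exact: integral_cst.
  by rewrite -e1 (eq_measure_integral _ nuE) e2 -(pairing_self (U_L2 f)).
by move=> h; lra.
Qed.

(** The fibres in [ac_multiplicity] are indexed by all natural numbers; the r entries are padded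
    with zeros. *)
Definition extend_section (F : borel -> 'cV[C]_r) (x : R) (k : nat) : C :=
  if insub k is Some i then F x (i : 'I_r) 0 else 0.

Let extend_sum F x :
  (\sum_(0 <= k <oo) (sqmod (extend_section F x k))%:E = (vs F x)%:E)%E.
Proof.
have s0 : sqmod (0 : C) = 0 by rewrite /sqmod /= expr0n addr0.
rewrite (nneseries_split 0 r) => [|k _]; last by rewrite lee_fin sqmod_ge0.
rewrite [X in (_ + X)%E]eseries0 ?adde0 => [|k]; last first.
  by rewrite add0n => rk _; rewrite /extend_section insubF ?s0// ltnNge rk.
rewrite add0n big_mkord sumEFin; congr _%:E; apply: eq_bigr => i _.
by rewrite /extend_section valK.
Qed.

Lemma diagonal_ac_multiplicity : ac_multiplicity ip T
  (fun x => if x \in `]- (2 * a), 2 * a[ then Some r else Some 0%N).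
Proof.
set N := fun x => _; split.
  move=> k; have [kr|rk] := ltnP k r.
    rewrite (_ : [set x | _] = D); first exact: measurable_itv.
    by apply/seteqP; split=> x /=; rewrite /N; case: ifP.
  rewrite (_ : [set x | _] = set0)//.
  by apply/seteqP; split=> x //=; rewrite /N; case: ifP => _ /=; rewrite ?ltnNge ?rk.
have below_in x k : ~~ below k (N x) -> forall F, L2v F -> extend_section F x k = 0.
  rewrite /N /extend_section; case: ifP => xD /=.
    by move=> kr F hF; rewrite insubF//; apply/negbTE.
  by move=> _ F hF; case: insub => // i; rewrite (L2v_out hF) ?mxE//= xD.
exists (fun f => extend_section (U f)); split.
- move=> f _; split => [k|x k hk|].
  + rewrite /extend_section; case: insub => [i|]; last by split; exact: measurable_cst.
    exact: CL2_cmeas (U_L2 f i).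
  + exact: below_in hk _ (U_L2 f).
  + under eq_integral do rewrite extend_sum.
    by rewrite -(pairing_self (U_L2 f)) ltry.
- move=> z f g _ _; apply: filterS (dm_U_lin dm z f g) => x e k.
  rewrite /extend_section; case: insub => [i|]; last by rewrite mulr0 addr0.
  by rewrite e !mxE.
- move=> f /ac_subspaceP Pf0; under eq_integral do rewrite extend_sum.
  by rewrite -(pairing_self (U_L2 f)) (sqnorm_split f) Pf0 (sqnorm0 ipH) add0r.
- move=> F [mF F0 Fi]; pose G (x : borel) : 'cV[C]_r := \col_i F x i.
  have GE x : extend_section G x = F x.
    apply/funext => k; rewrite /extend_section; case: insubP => [i _ <-|rk]; first by rewrite mxE.
    by rewrite F0// /N; case: ifP => _ //=; apply: contra rk => /leq_trans; apply.
  have hG : L2v G.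
    move=> i; apply/CL2_sqmod; under eq_fun do rewrite mxE.
    split; [exact: mF| |by move=> x Dx; rewrite mxE F0// /N; case: ifP].
    apply/integrableP; split.
      apply/measurable_EFinP; under eq_fun do rewrite mxE.
      by apply: sqmod_measurable; exact: mF.
    apply: le_lt_trans Fi; apply: ge0_le_integral => //.
    - apply/measurable_EFinP/measurableT_comp => //; under eq_fun do rewrite mxE.
      by apply: sqmod_measurable; exact: mF.
    - under eq_fun do rewrite -GE extend_sum; apply/measurable_EFinP; apply: measurable_sum => j.
      by apply: sqmod_measurable; under eq_fun do rewrite mxE; exact: mF.
    - move=> x _; rewrite -GE extend_sum lee_fin ger0_norm ?sqmod_ge0// /vs (bigD1 i)//= lerDl.
      by apply: sumr_ge0 => j _; exact: sqmod_ge0.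
  exists (W G); first by apply/ac_subspaceP; exact: pp_part_wave.
  by apply: filterS (U_wave hG) => x e k; rewrite -GE /extend_section e.
- move=> f _; apply: filterS (dm_U_T dm f) => x e k.
  rewrite /extend_section; case: insub => [i|]; last by rewrite mulr0.
  by rewrite e mxE.
Qed.

Lemma diagonal_sc_spectrum : sc_spectrum ip T = set0.
Proof.
(* The subspace is zero, so the identity serves as resolvent at every z. *)
apply/seteqP; split=> // z; apply; exists id; split=> [f //|f|f|].
- by move=> /sc_subspace_eq0 ->; rewrite (op0 T_lin) scaler0 subr0.
- by move=> /sc_subspace_eq0 ->; rewrite (op0 T_lin) scaler0 subr0.
- by exists 1 => f _; rewrite mul1r.
Qed.

Lemma diagonal_pp_finite : finite_dimensional (pp_subspace ip T).
Proof.
have [n [b hb]] := spanned_finite_dimensional (dm_kernel dm).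
by exists n, b => f /pp_subspace_kernel; exact: hb.
Qed.

(** * The spectrum off and on the band *)

Definition on_band z : Prop := exists2 x : R, x \in `[- (2 * a), 2 * a] & z = x%:C.

Let off_band_dist z : ~ on_band z ->
  exists2 e : R, 0 < e & forall x, `|x| <= 2 * a -> e <= sqmod (x%:C - z).
Proof.
case: z => p q nz; have [q0|q0] := eqVneq q 0; last first.
  exists (q ^+ 2); first by rewrite exprn_even_gt0.
  by move=> x _; rewrite /sqmod; simpc; rewrite sqrrN /= lerDr sqr_ge0.
have hp : 2 * a < `|p|.
  rewrite ltNge; apply/negP => hp; apply: nz; exists p; last by rewrite q0.
  by rewrite in_itv/= -ler_norml.
exists ((`|p| - 2 * a) ^+ 2); first by rewrite exprn_gt0// subr_gt0.
move=> x xa; rewrite /sqmod; simpc; rewrite /= q0 oppr0 expr0n addr0.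
rewrite -(real_normK (num_real (x - p))) lerXn2r ?nnegrE ?subr_ge0 ?(ltW hp)//.
by rewrite distrC (le_trans _ (lerB_dist _ _))// lerB.
Qed.

Let kernel_0 : kernel 0.
Proof.
have := dm_U_lin dm (-1) 0 0; apply: filterS => x.
by rewrite scaler0 addr0 scaleN1r addNr.
Qed.

(** The intertwining relation gives (x - z) U f = 0, and x - z has no zero on D. *)
Let eigen_kernel z f : ~ on_band z -> T f = z *: f -> kernel f.
Proof.
move=> nz Tf; have h1 := dm_U_T dm f; rewrite Tf in h1.
have h2 := dm_U_lin dm z f 0; rewrite addr0 in h2.
apply: filterS2 (filterI h1 h2) kernel_0 => x [e1 e2] e3.
have [Dx|Dx] := pselect (D x); last by rewrite (L2v_out (U_L2 f)).
move: e2; rewrite e1 e3 addr0 => /eqP; rewrite -subr_eq0 -scalerBl scaler_eq0.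
move=> /orP[|/eqP//]; rewrite subr_eq0 => /eqP xz; exfalso; apply: nz; exists x => //.
by move: Dx; rewrite /= !in_itv/= => /andP[/ltW-> /ltW->].
Qed.

Let opoly_bounded (p : {poly C}) :
  exists2 c : R, 0 <= c & forall f, sqnorm (opoly T p f) <= c * sqnorm f.
Proof.
have [b b0 hb] := dm_bounded dm; elim/poly_ind: p => [|p c [e e0 IH]].
  by exists 0 => // f; rewrite opoly0 (sqnorm0 ipH) mul0r.
exists (2 * (b * e) + 2 * sqmod c) => [|f].
  by rewrite addr_ge0 ?mulr_ge0 ?sqmod_ge0.
rewrite opolyD (opolyMX T_lin) opolyC; apply: le_trans (sqnormD_le ipH _ _) _.
rewrite [leRHS]mulrDl -[2 * sqmod c * _]mulrA -[2 * (b * e) * _]mulrA -[b * e * _]mulrA.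
apply: lerD; rewrite ler_wpM2l// ?(sqnormZ ipH)//.
by apply: le_trans (hb _) _; rewrite ler_wpM2l.
Qed.

Let sqnorm_waveU f : sqnorm (W (U f)) <= sqnorm f.
Proof. by rewrite (sqnorm_wave (U_L2 f)) (sqnorm_split f) lerDr (sqnorm_ge0 ipH). Qed.

(* On the kernel, with q1 the part of an annihilating polynomial prime to
   'X - z, the quotient of q1 - q1.[z] by 'X - z inverts T - z up to -q1.[z]. *)
Let resolvent_off z : ~ on_band z -> (forall f, T f = z *: f -> f = 0) ->
  resolvent_set_on ip T setT z.
Proof.
move=> nz inj; have [e e0 he] := off_band_dist nz.
have [q q0 hq] := opoly_annihilator T_lin (dm_kernel dm) kernel_T.
have [m [q1]] := multiplicity_XsubC q z; rewrite q0 /= => q1z qE.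
have hq1 f : kernel f -> opoly T q1 f = 0.
  move=> kf; have := hq f kf; rewrite qE mulrC (opolyM T_lin); move: (opoly T q1 f) => g.
  elim: m {qE} g => [|m IH] g; first by rewrite expr0 -polyC1 opolyC scale1r.
  rewrite exprSr (opolyM T_lin) => /IH; rewrite (opoly_XsubC T_lin) => /eqP.
  by rewrite subr_eq0 => /eqP; exact: inj.
set c := q1.[z]; have c0 : c != 0 by [].
have /factor_theorem[Q QE] : root (q1 - c%:P) z by rewrite rootE !hornerE subrr.
have Qk f : kernel f -> opoly T Q (T f - z *: f) = - (c *: f).
  move=> kf; rewrite -(opoly_XsubC T_lin) -(opolyM T_lin) -QE opolyD -polyCN opolyC.
  by rewrite hq1// add0r scaleNr.
have Qk' f : kernel f -> T (opoly T Q f) - z *: opoly T Q f = - (c *: f).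
  move=> kf; rewrite -(Qk _ kf) -(opoly_op T_lin) addrC -scaleNr -(opoly_lin T_lin).
  by rewrite addrC scaleNr.
pose g (x : borel) : C := (x%:C - z)^-1.
have xz (x : borel) : D x -> x%:C - z != 0.
  move=> Dx; have xa : `|x| < 2 * a by rewrite -itv_abs.
  apply: contraTneq (he x (ltW xa)) => ->.
  by rewrite /sqmod /= expr0n addr0 -ltNge.
have mg : cmeas g.
  apply: cmeasV; apply: cmeasD; last exact: cmeas_cst.
  by case: (bmeas_id a_gt0).
have gK (x : borel) : D x -> sqmod (g x) <= e^-1.
  move=> Dx; have xa : `|x| < 2 * a by rewrite -itv_abs.
  have : sqmod (x%:C - z) * sqmod (g x) = 1.
    by rewrite -sqmodM mulfV ?xz// /sqmod /= expr1n expr0n addr0.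
  have q0' : 0 < sqmod (x%:C - z) := lt_le_trans e0 (he x (ltW xa)).
  move=> /(canRL (mulKf (lt0r_neq0 q0'))) ->.
  by rewrite mulr1 lef_pV2 ?posrE// he// ltW.
have bg : bmeas D g by split => //; exists e^-1.
have gL F : L2v F -> L2v (fun x => g x *: F x) by exact: L2v_bscale.
have gW F : L2v F -> (fun x => x%:C *: (g x *: F x) + - z *: (g x *: F x)) = F.
  move=> hF; apply/funext => x; rewrite -scalerDl scalerA.
  have [Dx|Dx] := pselect (D x); last by rewrite (L2v_out hF) ?scaler0.
  by rewrite mulfV ?scale1r ?xz.
exists (fun f => W (fun x => g x *: U f x) - c^-1 *: opoly T Q (P f)); split => // [f _|f _|].
- have hg := gL _ (U_L2 f).
  have hW : W (fun x => x%:C *: (g x *: U f x)) - z *: W (fun x => g x *: U f x) = W (U f).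
    rewrite addrC -scaleNr -(wave_lin _ hg (L2v_mulX a_gt0 hg)).
    by congr W; rewrite -[RHS](gW _ (U_L2 f)); apply/funext => x; rewrite addrC.
  rewrite (opB T_lin) (opZ T_lin) (T_wave hg) scalerBr opprD addrACA -opprD hW.
  rewrite [z *: (c^-1 *: _)]scalerA (mulrC z) -scalerA -scalerBr Qk'; last exact: pp_part_kernel.
  by rewrite scalerN scalerA mulVf// scale1r opprK addrC pp_partK.
- have hz := dm_U_lin dm (- z) f (T f).
  have -> : W (fun x => g x *: U (T f - z *: f) x) = W (U f).
    apply: wave_ae => //; first exact: gL.
    apply: filterS2 hz (dm_U_T dm f) => x; rewrite addrC scaleNr => -> ->.
    rewrite -{3}(gW _ (U_L2 f)) scalerDr !scalerA addrC.
    by rewrite (mulrC (g x)) (mulrC (g x)).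
  have -> : P (T f - z *: f) = T (P f) - z *: P f.
    by rewrite addrC -scaleNr pp_part_lin pp_part_T scaleNr addrC.
  by rewrite Qk ?scalerN ?scalerA ?mulVf// ?scale1r ?opprK 1?addrC ?pp_partK//; exact: pp_part_kernel.
- have [b b0 hb] := opoly_bounded Q.
  exists (2 * e^-1 + 2 * (sqmod c^-1 * b)) => f _.
  rewrite -[X in sqnorm (_ + X)]scaleN1r; apply: le_trans (sqnormD_le ipH _ _) _.
  rewrite [leRHS]mulrDl -[2 * e^-1 * _]mulrA -[2 * (sqmod c^-1 * b) * _]mulrA -[sqmod c^-1 * b * _]mulrA.
  apply: lerD; rewrite ler_wpM2l//.
    rewrite (sqnorm_wave (gL _ (U_L2 f))).
    have e10 : 0 <= e^-1 by rewrite invr_ge0 ltW.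
    have := pairing_bscale_le mg e10 gK (U_L2 f).
    move=> /le_trans; apply; rewrite ler_wpM2l// -(sqnorm_wave (U_L2 f)).
    exact: sqnorm_waveU.
  rewrite !(sqnormZ ipH) (_ : sqmod (-1) = 1) ?mul1r; last first.
    by rewrite /sqmod /= oppr0 sqrrN expr1n expr0n addr0.
  rewrite ler_wpM2l ?sqmod_ge0//; apply: le_trans (hb _) _; rewrite ler_wpM2l//.
  by rewrite (sqnorm_split f) lerDl -(sqnorm_wave (U_L2 f)) (sqnorm_ge0 ipH).
Qed.

Let norm_lt_sqmod z (e : R) : 0 < e -> (`|z| < e%:C) = (sqmod z < e ^+ 2).
Proof.
move=> e0; rewrite normc_def ltcR -/(sqmod z).
rewrite -{2}[sqmod z]sqr_sqrtr ?sqmod_ge0// ltr_pXn2r// nnegrE ?sqrtr_ge0//.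
exact: ltW.
Qed.

Let eigenvalue_off z : spectrum ip T z -> ~ on_band z ->
  exists2 f, T f = z *: f & f != 0.
Proof.
move=> sz nz; apply: contrapT => nex; apply: sz; apply: resolvent_off => // f Tf.
by apply/eqP/negPn/negP => f0; apply: nex; exists f.
Qed.

(** Off the band the spectrum consists of eigenvalues with eigenvectors in the kernel. These are
    roots of an annihilating polynomial, hence finitely many, and their eigenspaces are
    finite-dimensional. *)
Let discrete_off z : spectrum ip T z -> ~ on_band z -> discrete_spectrum ip T z.
Proof.
move=> sz nz; split => //.
- have [q q0 hq] := opoly_annihilator T_lin (dm_kernel dm) kernel_T.
  have [rs hrs] := closed_field_poly_normal q.
  have root_q w : spectrum ip T w -> ~ on_band w -> w \in rs.
    move=> sw nw; have [f Tf f0] := eigenvalue_off sw nw.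
    have := hq f (eigen_kernel nw Tf); rewrite (opoly_eigen T_lin _ Tf) => /eqP.
    rewrite scaler_eq0 (negPf f0) orbF {1}hrs hornerZ mulf_eq0 lead_coef_eq0 (negPf q0)/=.
    by rewrite -[_ == 0]/(root _ _) root_prod_XsubC.
  have [e1 e10 he1] : exists2 e, 0 < e & forall w, w \in rs -> sqmod (w - z) < e -> w = z.
    elim: rs {hrs root_q} => [|y rs [e e0 IH]]; first by exists 1.
    have [->|yz] := eqVneq y z.
      by exists e => // w; rewrite in_cons => /predU1P[->//|]; exact: IH.
    have s0 : 0 < sqmod (y - z).
      by rewrite lt_neqAle sqmod_ge0 andbT eq_sym sqmod_eq0 subr_eq0.
    exists (Num.min e (sqmod (y - z))) => [|w]; first by rewrite lt_min e0.
    rewrite in_cons lt_min => /predU1P[->|wrs] /andP[h1 h2]; last exact: IH.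
    by rewrite ltxx in h2.
  have [e2 e20 he2] := off_band_dist nz.
  (* [e1] separates z from the other roots and [e2] from the band; both bound squared distances,
     hence the square root. *)
  exists (Num.sqrt (Num.min e1 e2)); split; first by rewrite sqrtr_gt0 lt_min e10.
  move=> w sw; rewrite norm_lt_sqmod ?sqrtr_gt0 ?lt_min ?e10//.
  rewrite sqr_sqrtr ?le_min ?(ltW e10) ?(ltW e20)// lt_min => /andP[h1 h2].
  apply: he1 => //; apply: root_q => // -[x]; rewrite in_itv/= -ler_norml => xa wx.
  by have := he2 x xa; rewrite -wx leNgt h2.
- by have [f Tf f0] := eigenvalue_off sz nz; exists f.
- have [n [b hb]] := spanned_finite_dimensional (dm_kernel dm).
  by exists n, b => f Tf; apply: hb; exact: eigen_kernel Tf.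
Qed.

Hypothesis r_gt0 : (0 < r)%N.

Let bump (l u : R) (x : borel) : 'cV[C]_r :=
  (\1_(`]l, u[%classic : set borel) x)%:C *: delta_mx (Ordinal r_gt0) 0.

Let int_itv (l u : R) :
  (\int[leb]_x (\1_(`]l, u[%classic : set borel) x)%:E = if (l < u)%R then (u - l)%R%:E else 0)%E.
Proof.
rewrite integral_indic ?setIT//.
transitivity (if (l%:E < u%:E)%E then (u%:E - l%:E)%E else 0%E); last by rewrite lte_fin EFinB.
exact: (lebesgue_measure_itv `]l, u[).
Qed.

Let bump_L2v l u : - (2 * a) <= l -> u <= 2 * a -> L2v (bump l u).
Proof.
move=> hl hu i; pose I := `]l, u[%classic : set borel.
have mI : measurable I by exact: measurable_itv.
rewrite (_ : (fun x => _) = fun x => (delta_mx (Ordinal r_gt0) 0 : 'cV[C]_r) i 0 * (\1_I x)%:C).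
  apply: CL2_scale; apply/CL2_sqmod; split.
  - by apply: cmeas_real; exact: measurable_indic.
  - apply: (@eq_integrable _ _ _ leb setT _ (EFin \o \1_I)) => //.
      move=> x _; rewrite /= /sqmod /= expr0n addr0 indicE.
      by case: (_ \in _); rewrite ?expr1n ?expr0n.
    apply/integrableP; split; first by apply/measurable_EFinP; exact: measurable_indic.
    under eq_integral do rewrite /= ger0_norm//.
    by rewrite int_itv; case: ifP => // _; rewrite ltry.
  - move=> x Dx; rewrite indicE memNset// => Ix; apply: Dx; move: Ix.
    rewrite /I /= !in_itv/= => /andP[h1 h2].
    by rewrite (le_lt_trans hl h1) (lt_le_trans h2 hu).
by apply/funext => x; rewrite mxE mulrC.
Qed.

Let bump_norm l u : l < u -> - (2 * a) <= l -> u <= 2 * a ->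
  complex.Re (pairing (bump l u) (bump l u)) = u - l.
Proof.
move=> lu hl hu; apply: EFin_inj; rewrite (pairing_self (bump_L2v hl hu)).
rewrite (eq_integral (EFin \o \1_(`]l, u[%classic : set borel))).
  by rewrite int_itv lu.
move=> x _ /=; congr _%:E; rewrite (bigD1 (Ordinal r_gt0))//= big1 ?addr0 => [|j jr].
  rewrite !mxE !eqxx/= mulr1 indicE /sqmod /= expr0n addr0.
  by case: (_ \in _); rewrite ?expr1n ?expr0n.
by rewrite !mxE (negPf jr) mulr0 /sqmod /= expr0n addr0.
Qed.

(** A vector [W F] with F concentrated within e of x0 is moved by T - x0 by at most e times its
    norm, which contradicts a resolvent bound c when |c| e^2 < 1. The interval is cut to the band
    because x0 may be an endpoint. *)
Let band_spectrum (x0 : R) : `|x0| <= 2 * a -> spectrum ip T x0%:C.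
Proof.
move=> xa [S [_ _ hS [c hc]]]; rewrite ler_norml in xa; have /andP[xa1 xa2] := xa.
pose e := (1 + `|c|)^-1; have c1 : 0 < 1 + `|c| by rewrite ltr_pwDl.
have e0 : 0 < e by rewrite invr_gt0.
pose l := Num.max (- (2 * a)) (x0 - e); pose u := Num.min (2 * a) (x0 + e).
have hl : - (2 * a) <= l by rewrite le_max lexx.
have hu : u <= 2 * a by rewrite ge_min lexx.
have a20 : 0 < 2 * a by rewrite mulr_gt0.
have lu : l < u.
  rewrite lt_min !gt_max; apply/andP; split; apply/andP; split; move: xa1 xa2 e0 a20; lra.
have hF := bump_L2v hl hu; set F := bump l u in hF.
have nF : sqnorm (W F) = u - l by rewrite (sqnorm_wave hF) bump_norm.
pose g (x : borel) : C := (x - x0)%:C * (\1_(`]l, u[%classic : set borel) x)%:C.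
have mg : cmeas g.
  apply: cmeasM; apply: cmeas_real; last by apply: measurable_indic; exact: measurable_itv.
  by apply: measurable_funB => //; exact: measurable_cst.
have gK (x : borel) : D x -> sqmod (g x) <= e ^+ 2.
  move=> _; rewrite /g indicE.
  have [xI|xI] := pselect ((`]l, u[%classic : set borel) x); last first.
    by rewrite memNset// mulr0 /sqmod /= expr0n addr0 sqr_ge0.
  rewrite mem_set//; move: xI => /=; rewrite in_itv/= gt_max lt_min => /andP[/andP[_ h1] /andP[_ h2]].
  rewrite mulr1 /sqmod /= expr0n addr0 -(real_normK (num_real (x - x0))).
  by rewrite lerXn2r ?nnegrE ?(ltW e0)// ler_norml; apply/andP; split; move: h1 h2; lra.
have e20 : 0 <= e ^+ 2 by exact: sqr_ge0.
have hg : L2v (fun x => g x *: F x) by apply: L2v_bscale hF; split => //; exists (e ^+ 2).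
have Ty : T (W F) - x0%:C *: W F = W (fun x => g x *: F x).
  rewrite (T_wave hF) addrC -scaleNr -(wave_lin _ hF (L2v_mulX a_gt0 hF)).
  congr W; apply/funext => x; rewrite addrC -scalerDl /F /bump !scalerA /g.
  congr (_ *: _); rewrite indicE; case: (_ \in _); last by rewrite !mulr0.
  by rewrite !mulr1 (rmorphB (real_complex R)).
pose N := complex.Re (pairing (fun x => g x *: F x) (fun x => g x *: F x)).
have NE : sqnorm (W (fun x => g x *: F x)) = N := sqnorm_wave hg.
have h2 : u - l <= c * N.
  have := hc (T (W F) - x0%:C *: W F) Logic.I.
  by rewrite (hS (W F) Logic.I) Ty nF NE.
have h1 : N <= e ^+ 2 * (u - l).
  apply: le_trans (pairing_bscale_le mg e20 gK hF) _.
  by apply: ler_wpM2l => //; rewrite -(sqnorm_wave hF) nF.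
have N0 : 0 <= N by rewrite -NE (sqnorm_ge0 ipH).
clearbody N; clear NE Ty.
have ul : 0 < u - l by rewrite subr_gt0.
have h3 : u - l <= `|c| * e ^+ 2 * (u - l).
  apply: le_trans h2 _; apply: (@le_trans _ _ (`|c| * N)); first by rewrite ler_wpM2r// ler_norm.
  by rewrite -mulrA ler_wpM2l.
have h4 : `|c| * e ^+ 2 < 1.
  have ec : e * (1 + `|c|) = 1 by rewrite mulVf// gt_eqF.
  have e1 : e <= 1 by rewrite invf_le1// lerDl.
  have ce : `|c| * e < 1 by move: ec e0; rewrite mulrDr mulr1 (mulrC e); lra.
  by rewrite expr2 mulrA (le_lt_trans _ ce)// ler_piMr// mulr_ge0// ltW.
by move: h3; rewrite leNgt gtr_pMl// h4.
Qed.

Theorem diagonal_essential_spectrum :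
  essential_spectrum ip T = [set x%:C | x in `[- (2 * a), 2 * a]].
Proof.
apply/seteqP; split=> [z [sz nd]|z [x xa <-]].
  have [[x xa zx]|nz] := pselect (on_band z); first by exists x.
  by exfalso; apply: nd; exact: discrete_off.
have xa' : `|x| <= 2 * a by move: xa; rewrite /= in_itv/= -ler_norml.
split; first exact: band_spectrum.
(* Isolation fails: moving x by t towards the centre of the band, with t < e and t <= 2a, reaches
   another point y of the band, hence of the spectrum. *)
move=> [_ [e [e0 he]] _ _]; pose t := Num.min (e / 2) (2 * a).
have a20 : 0 < 2 * a by rewrite mulr_gt0.
have t0 : 0 < t by rewrite lt_min divr_gt0.
have te : t < e by rewrite gt_min ltr_pdivrMr// ltr_pMr// ltr1n.
have t2 : t <= 2 * a by rewrite ge_min lexx orbT.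
pose y := if x <= 0 then x + t else x - t.
have yx : `|y - x| = t.
  by rewrite /y; case: ifP => _; rewrite addrAC subrr add0r ?normrN ger0_norm// ltW.
have ya : `|y| <= 2 * a.
  move: xa'; rewrite !ler_norml /y => /andP[h1 h2].
  by case: (leP x 0) => x0; apply/andP; split; lra.
have yz : y%:C = x%:C :> C.
  apply: he; first exact: band_spectrum.
  rewrite norm_lt_sqmod// -(rmorphB (real_complex R)) /sqmod /= expr0n addr0.
  by rewrite -(real_normK (num_real (y - x))) yx ltrXn2r// ?nnegrE ltW.
by case: yz => yx0; move: yx t0; rewrite yx0 subrr normr0 => <-; rewrite ltxx.
Qed.

End DiagonalModel.

Lemma J_linear (R : realType) (d r : nat) (a : R) (HC : 'M[R[i]]_d) (V : 'M[R[i]]_(d, r))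
    z (f g : hilb R d r) : J a HC V (z *: f + g) = z *: J a HC V f + J a HC V g.
Proof.
apply: val_inj; apply: injective_projections.
  rewrite -[LHS]/(HC *m (z *: (hval f).1 + (hval g).1) + V *m (z *: (hval f).2 0%N + (hval g).2 0%N)).
  by rewrite !mulmxDr -!scalemxAr addrACA -scalerDr.
apply/funext => -[|n].
  rewrite -[LHS]/(a%:C *: (z *: (hval f).2 1%N + (hval g).2 1%N) +
    V^t* *m (z *: (hval f).1 + (hval g).1)).
  rewrite mulmxDr -scalemxAr [a%:C *: (_ + _)]scalerDr (scalerA a%:C z) (mulrC a%:C z) -(scalerA z) addrACA.
  by rewrite -scalerDr.
rewrite -[LHS]/(a%:C *: (z *: (hval f).2 n + (hval g).2 n + (z *: (hval f).2 n.+2 + (hval g).2 n.+2))).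
by rewrite addrACA -scalerDr [LHS]scalerDr (scalerA a%:C z) (mulrC a%:C z) -(scalerA z).
Qed.

Lemma J_diagonal_model (R : realType) (d r : nat) (a : R) (HC : 'M[R[i]]_d)
    (V : 'M[R[i]]_(d, r)) (a_gt0 : 0 < a) (hHC : HC = HC ^t*) :
  diagonal_model (@hdot R d r) (J a HC V) a (diag_transform HC V a_gt0).
Proof.
split => //.
- exact: hdot_inner_product.
- exact: J_linear.
- exact: J_symmetric.
- exact: J_bounded.
- exact: diag_transform_L2v.
- exact: diag_transform_linear.
- exact: diag_transform_J.
- exact: diag_transform_adjoint.
- rewrite (_ : kernel _ = [set f | {ae lebesgue_measure, forall x, transform HC V a_gt0 f x = 0}]).
    exact: transform_kernel_spanned.
  apply/seteqP; split => f; first exact: diag_transform_ker.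
  by apply: filterS => x e; rewrite /diag_transform e mulmx0.
Qed.

Theorem proposition2p11 (R : realType) (q d r : nat)
    (hq : prime_power q) (hd : (0 < d)%N) (hr : (0 < r)%N)
    (HC : 'M[R[i]]_d) (hHC : HC = HC ^t*) (V : 'M[R[i]]_(d, r)) :
  let a : R := Num.sqrt q%:R in
  let ip := @hdot R d r in
  let T := J a HC V in
  [/\ essential_spectrum ip T = [set x%:C | x in `[- (2 * a), 2 * a]],
      sc_spectrum ip T = set0,
      finite_dimensional (pp_subspace ip T)
    & exists2 N : R -> option nat, ac_multiplicity ip T N &
        {ae @lebesgue_measure R,
          forall x, x \in `]- (2 * a), 2 * a[ -> N x = Some r}].
Proof.
move=> a ip T; have a_gt0 : 0 < a.
  have [p [k [pr _ qE]]] := hq.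
  by rewrite /a sqrtr_gt0 ltr0n qE expn_gt0 prime_gt0.
have dm := J_diagonal_model V a_gt0 hHC; split.
- exact: diagonal_essential_spectrum dm hr.
- exact: diagonal_sc_spectrum dm.
- exact: diagonal_pp_finite dm.
- exists (fun x => if x \in `]- (2 * a), 2 * a[ then Some r else Some 0%N).
    exact: diagonal_ac_multiplicity dm.
  by apply: aeW => x ->.
Qed.
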